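(* Let $D<_{\mathrm{mdeg}}D'$ be a minimal, disjoint degeneration in $\mathrm{rep}^{\mathrm{inj}}_K(\mathcal{Q}_n,I_2)$ and let $W$ be a representation such that $D\oplus W<_{\deg}D'\oplus W$ is a degeneration in $\mathrm{rep}^{\mathrm{inj}}_K(\mathcal{Q}_n,I_2)(\underline{d}_B)$, where $\underline{d}_B=(1,2,\dots,n)$. Then the degeneration $D\oplus W<_{\deg}D'\oplus W$ is minimal if and only if every indecomposable direct summand $X$ of $W$ satisfies $$[X,D]-[X,D']=0\quad\text{and}\quad [D,X]-[D',X]=0 .$$
   Context: Let $K=\mathbf{C}$ and $n\ge 1$. $\mathcal{Q}_n$ is the quiver with vertices $1,\dots,n$, arrows $\alpha_i\colon i\to i+1$ for $1\le i\le n-1$, and a loop $\alpha\colon n\to n$. $I_2=(\alpha^2)$ is the ideal of the path algebra $K\mathcal{Q}_n$ generated by $\alpha^2$. $\mathrm{rep}_K(\mathcal{Q}_n,I_2)$ is the category of finite-dimensional representations $M=((M_i),(M_{\alpha_i}),M_\alpha)$ of $\mathcal{Q}_n$ over $K$ with $M_\alpha^2=0$; $\mathrm{rep}^{\mathrm{inj}}_K(\mathcal{Q}_n,I_2)$ is the full subcategory of those for which all maps $M_{\alpha_i}$ $(1\le i\le n-1)$ are injective; $(\underline d)$ appended means: of dimension vector $\underline d$. For a dimension vector $\underline d=(d_1,\dots,d_n)$, let $R_{\underline d}(\mathcal{Q}_n,I_2)$ be the affine variety of points of $\bigoplus_{i=1}^{n-1}\mathrm{Hom}(K^{d_i},K^{d_{i+1}})\oplus\mathrm{End}(K^{d_n})$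 whose last component squares to zero. The group $\mathrm{GL}_{\underline d}=\prod_i\mathrm{GL}_{d_i}(K)$ acts on it by base change, and orbits $\mathcal{O}_M$ correspond to isomorphism classes of representations $M$ of dimension vector $\underline d$. For $M,M'$ of the same dimension vector, write $M\le_{\deg}M'$ ($M'$ is a degeneration of $M$) if $\mathcal{O}_{M'}\subset\overline{\mathcal{O}_M}$ in $R_{\underline d}(\mathcal{Q}_n,I_2)$, and $M<_{\deg}M'$ if moreover $M\not\cong M'$. A degeneration $M<_{\deg}M'$ is minimal, written $M<_{\mathrm{mdeg}}M'$, if $M\le_{\deg}L\le_{\deg}M'$ implies $L\cong M$ or $L\cong M'$. It is disjoint if $M$ and $M'$ have no nonzero direct summand in common (up to isomorphism). Finally $[M,M']:=\dim_K\mathrm{Hom}(M,M')$. *)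

(* Defs.v *)
From HB Require Import structures.
From mathcomp Require Import all_boot all_order all_algebra.
From mathcomp Require Import mpoly.

Set Implicit Arguments.
Unset Strict Implicit.
Unset Printing Implicit Defensive.

Import GRing.Theory.
Local Open Scope ring_scope.

(* The quiver with n.+1 >= 1 vertices: the mathematical vertex i (1-based) is  *)
(* the ordinal i - 1, the arrows alpha_i are indexed by 'I_n, and the loop     *)
(* sits at ord_max.                                                            *)
Definition src (n : nat) (i : 'I_n) : 'I_n.+1 := widen_ord (leqnSn n) i.
Definition tgt (n : nat) (i : 'I_n) : 'I_n.+1 := lift ord0 i.

Definition dimvec (n : nat) := 'I_n.+1 -> nat.

(* Linear maps follow the MathComp convention: the matrix A : 'M_(p, q) stands *)
(* for the map v |-> v *m A on row vectors, so composites read left to right.  *)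
(* An inhabitant of [rep K d] is a representation on the spaces K^(d i), and   *)
(* equally a point of the affine variety R_d.                                  *)
Record rep (K : fieldType) (n : nat) (d : dimvec n) := Rep {
  arrow : forall i : 'I_n, 'M[K]_(d (src i), d (tgt i));
  loop : 'M[K]_(d ord_max);
  loop_sq0 : loop *m loop = 0
}.

Section Category.
Variables (K : fieldType) (n : nat).
Implicit Types d e f : dimvec n.

Definition rep_inj d (M : rep K d) : Prop :=
  forall i : 'I_n, injective (fun v : 'rV[K]_(d (src i)) => v *m arrow M i).

Definition dimvecD d e : dimvec n := fun i => (d i + e i)%N.

Lemma dsum_sq0 d e (M : rep K d) (N : rep K e) :
  block_mx (loop M) 0 0 (loop N) *m block_mx (loop M) 0 0 (loop N) = 0.
Proof.
by rewrite mulmx_block !mul0mx !mulmx0 !addr0 !add0r !loop_sq0 block_mx0.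
Qed.

Definition dsum d e (M : rep K d) (N : rep K e) : rep K (dimvecD d e) :=
  @Rep K n (dimvecD d e)
    (fun i => block_mx (arrow M i) 0 0 (arrow N i))
    (block_mx (loop M) 0 0 (loop N))
    (dsum_sq0 M N).

Definition is_hom d e (M : rep K d) (N : rep K e)
    (h : forall i : 'I_n.+1, 'M[K]_(d i, e i)) : Prop :=
  (forall i : 'I_n, arrow M i *m h (tgt i) = h (src i) *m arrow N i)
  /\ loop M *m h ord_max = h ord_max *m loop N.

Definition iso d e (M : rep K d) (N : rep K e) : Prop :=
  exists (h : forall i, 'M[K]_(d i, e i)) (k : forall i, 'M[K]_(e i, d i)),
    [/\ is_hom M N h, is_hom N M k,
        forall i, h i *m k i = 1%:M & forall i, k i *m h i = 1%:M].

Definition zero_dim d : Prop := forall i, d i = 0%N.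

Definition indecomposable d (X : rep K d) : Prop :=
  ~ zero_dim d /\
  forall e f (Y : rep K e) (Z : rep K f),
    iso X (dsum Y Z) -> zero_dim e \/ zero_dim f.

Definition direct_summand d e (X : rep K d) (W : rep K e) : Prop :=
  exists f (Y : rep K f), iso W (dsum X Y).

Definition disjoint_reps d e (M : rep K d) (N : rep K e) : Prop :=
  forall f (X : rep K f),
    direct_summand X M -> direct_summand X N -> zero_dim f.

(* Families (h_i) of matrices of varying sizes, flattened so as to inherit a   *)
(* vector space structure; [fam_mx] recovers the components.                   *)
Definition mxfam d e :=
  {ffun {i : 'I_n.+1 & ('I_(d i) * 'I_(e i))%type} -> K^o}.

Definition fam_mx d e (h : mxfam d e) (i : 'I_n.+1) : 'M[K]_(d i, e i) :=
  \matrix_(a, b) h (Tagged (fun j => ('I_(d j) * 'I_(e j))%type) (a, b)).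

Definition arrow_defect d e (M : rep K d) (N : rep K e) (i : 'I_n)
    (h : mxfam d e) : 'M[K]_(d (src i), e (tgt i)) :=
  arrow M i *m fam_mx h (tgt i) - fam_mx h (src i) *m arrow N i.

Definition loop_defect d e (M : rep K d) (N : rep K e)
    (h : mxfam d e) : 'M[K]_(d ord_max, e ord_max) :=
  loop M *m fam_mx h ord_max - fam_mx h ord_max *m loop N.

(* See [mem_Hom]: these are exactly the morphisms from M to N.                 *)
Definition Hom d e (M : rep K d) (N : rep K e) : {vspace mxfam d e} :=
  ((\bigcap_(i < n) lker (linfun (arrow_defect M N i)))
   :&: lker (linfun (loop_defect M N)))%VS.

Definition homdim d e (M : rep K d) (N : rep K e) : nat := \dim (Hom M N).

Lemma fam_mx_linear d e i : linear (fun h : mxfam d e => fam_mx h i).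
Proof. by move=> a g h; apply/matrixP=> x y; rewrite !mxE !ffunE. Qed.

Lemma arrow_defect_linear d e (M : rep K d) (N : rep K e) i :
  linear (arrow_defect M N i).
Proof.
move=> a g h; rewrite /arrow_defect !fam_mx_linear mulmxDr mulmxDl.
by rewrite -scalemxAr -scalemxAl scalerBr opprD addrACA.
Qed.

Lemma loop_defect_linear d e (M : rep K d) (N : rep K e) :
  linear (loop_defect M N).
Proof.
move=> a g h; rewrite /loop_defect !fam_mx_linear mulmxDr mulmxDl.
by rewrite -scalemxAr -scalemxAl scalerBr opprD addrACA.
Qed.

HB.instance Definition _ d e (M : rep K d) (N : rep K e) i :=
  GRing.isLinear.Build K (mxfam d e) _ _ (arrow_defect M N i)
    (arrow_defect_linear M N i).
HB.instance Definition _ d e (M : rep K d) (N : rep K e) :=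
  GRing.isLinear.Build K (mxfam d e) _ _ (loop_defect M N)
    (loop_defect_linear M N).

Lemma mem_Hom d e (M : rep K d) (N : rep K e) (h : mxfam d e) :
  h \in Hom M N <-> is_hom M N (fam_mx h).
Proof.
rewrite /Hom memv_cap; split.
  case/andP=> /subv_bigcapP hA hL; split=> [i|].
    by move: (hA i isT); rewrite -memvE memv_ker lfunE subr_eq0 => /eqP.
  by move: hL; rewrite memv_ker lfunE subr_eq0 => /eqP.
case=> hA hL; apply/andP; split.
  apply/subv_bigcapP=> i _.
  by rewrite -memvE memv_ker lfunE /= /arrow_defect hA subrr.
by rewrite memv_ker lfunE /= /loop_defect hL subrr.
Qed.

Lemma fam_mx_surj d e (h : forall i, 'M[K]_(d i, e i)) :
  exists g : mxfam d e, forall i, fam_mx g i = h i.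
Proof.
exists [ffun x => h (tag x) (tagged x).1 (tagged x).2] => i.
by apply/matrixP=> a b; rewrite mxE ffunE.
Qed.

End Category.

Section Degeneration.
Variables (K : fieldType) (n : nat).
Implicit Types d : dimvec n.

Definition GL_orbit d (M N : rep K d) : Prop :=
  exists g : forall i : 'I_n.+1, 'M[K]_(d i),
    [/\ forall i, g i \in unitmx,
        forall i : 'I_n,
          arrow N i = g (src i) *m arrow M i *m invmx (g (tgt i))
      & loop N = g ord_max *m loop M *m invmx (g ord_max)].

Definition coord d : finType :=
  ({i : 'I_n & ('I_(d (src i)) * 'I_(d (tgt i)))%type}
   + ('I_(d ord_max) * 'I_(d ord_max)))%type.

Definition coordinate d (M : rep K d) (c : coord d) : K :=
  match c with
  | inl ab => arrow M (tag ab) (tagged ab).1 (tagged ab).2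
  | inr ab => loop M ab.1 ab.2
  end.

Definition peval d (p : {mpoly K[#|coord d|]}) (M : rep K d) : K :=
  p.@[fun k => coordinate M (enum_val k)].

(* All polynomials on the ambient affine space are tested; since M already     *)
(* lies in R_d, this is the closure inside R_d.                                *)
Definition zariski_closure d (S : rep K d -> Prop) (M : rep K d) : Prop :=
  forall p : {mpoly K[#|coord d|]},
    (forall N, S N -> peval p N = 0) -> peval p M = 0.

Definition deg_le d (M M' : rep K d) : Prop :=
  forall N, GL_orbit M' N -> zariski_closure (GL_orbit M) N.

Definition deg_lt d (M M' : rep K d) : Prop := deg_le M M' /\ ~ iso M M'.

Definition mdeg_lt d (M M' : rep K d) : Prop :=
  deg_lt M M' /\
  forall L : rep K d, deg_le M L -> deg_le L M' -> iso L M \/ iso L M'.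

End Degeneration.

Definition dimvecB (n : nat) : dimvec n := fun i => i.+1.

(* Main.v *)
Require Import Defs.
From HB Require Import structures.
From mathcomp Require Import all_boot all_order all_algebra.
From mathcomp Require Import complex.
From mathcomp Require Import reals.
From mathcomp Require Import mpoly boolp zify ring.

Set Implicit Arguments.
Unset Strict Implicit.
Unset Printing Implicit Defensive.

Import GRing.Theory.

(** The argument is a computation of codimensions. Write [c M] for
    [homdim M M], the codimension of the orbit of [M] up to a constant
    depending only on the dimension vector. For injective representations
    whose dimension vector grows by at most one at each step (the thin ones),
    [c] increases strictly along proper degenerations, and a minimal
    degeneration increases it by exactly one; hence minimality and codimension
    one coincide ([mdeg_lt_codim1]). Since [homdim] is additive,
    [c (D + W) = c D + homdim D W + homdim W D + c W], so [D + W < D' + W] is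
    minimal if and only if
    [(homdim W D' - homdim W D) + (homdim D' W - homdim D W) = 0].
    Both differences are nonnegative by semicontinuity, and so are the
    corresponding ones for every direct summand of [W]; as they add up over a
    decomposition of [W], the sum vanishes exactly when every indecomposable
    summand contributes zero ([homdim_summands]).

    It remains to see that, between thin injective representations [M < M'],
    there is always a degeneration of [M] of codimension one which still
    degenerates to [M'] ([deg_lt_step]). Such a representation is a complete
    flag with an operator of square zero; choosing for each step of the flag a
    vector whose image lies as low as possible gives a basis permuted by the
    operator ([normal_form]), so isomorphism classes are described by link
    patterns, partial matchings of the labels [1..m] by oriented arcs
    [x -> s x]. Homomorphisms between patterns are counted by pairs of labels
    ([homdim_pattern]). Testing against the indecomposables with one arc shows
    that a degeneration can only increase the numbers [corner_count m s p q]
    of labels [x <= p] with [s x <= q] ([corner_count_deg_le]).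

    Conversely, let the corner counts of [s] be bounded by those of a
    different pattern [s']. At the first label [k] where they differ, the arc
    of [s] leaving [k] ends higher than that of [s']. Exchange [k] with the
    nearest later label, or else the head of this arc with the nearest earlier
    label, for which the corner counts stay below those of [s']; if no
    exchange is possible the arc can be deleted. Being nearest, the exchanged
    labels have no third one interfering between them, which makes the move
    raise [c] by exactly one ([move_below]). Every move is a degeneration,
    realised by a polynomial curve of operators ([elementary_move_deg]), and
    iterating moves shows that the comparison of corner counts characterises
    degenerations ([corner_count_le_deg]). *)

(** * Link patterns *)

(** The pair [s, t] encodes the operator on a space with basis indexed by
    [1..m] that sends the vector [x] to the vector [s x]. Labels start at one
    so that [s x = 0] can mean that [x] is sent to zero; [t] is the inverse
    partial map, from heads of arcs to tails. *)
Definition link_pattern (m : nat) (s t : nat -> nat) : Prop :=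
  [/\ forall x, s x != 0 -> [&& 0 < x, x <= m, 0 < s x & s x <= m],
      forall x, s x != 0 -> t (s x) = x,
      forall y, t y != 0 -> 0 < y /\ s (t y) = y
    & forall x, s x != 0 -> t x = 0].

(** The number of basis vectors of the [p]-th step of the flag which the
    operator sends into the [q]-th step. This is the dimension of the space of
    morphisms from the indecomposable with a generator at step [p] and its
    image at step [q]; see [homdim_test]. *)
Definition corner_count (m : nat) (s : nat -> nat) (p q : nat) : nat :=
  \sum_(1 <= i < m.+1) ((i <= p) && (s i <= q)).

(** The dimension of the endomorphism ring of the pattern: an endomorphism is
    freely determined by the images of the labels that are not heads; see
    [homdim_pattern_end]. *)
Definition end_count (m : nat) (s t : nat -> nat) : nat :=
  \sum_(1 <= x < m.+1) (t x == 0) * corner_count m s x (s x).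

Section Sums.

(** Two patterns related by a move agree except at two or three labels, so
    sums attached to them are compared through those labels alone. *)
Lemma sum_update m (l : seq nat) (F G : nat -> nat) :
    uniq l -> all (fun i => 0 < i <= m) l ->
    (forall i, 0 < i <= m -> i \notin l -> F i = G i) ->
  \sum_(1 <= i < m.+1) F i + \sum_(i <- l) G i
    = \sum_(1 <= i < m.+1) G i + \sum_(i <- l) F i.
Proof.
move=> Ul /allP al eFG.
have split_sum (H : nat -> nat) : \sum_(1 <= i < m.+1) H i =
    \sum_(i <- l) H i + \sum_(1 <= i < m.+1 | i \notin l) H i.
  rewrite (bigID (fun i => i \in l)) /=; congr (_ + _).
  rewrite -big_filter; apply: perm_big; apply: uniq_perm => //.
    by rewrite filter_uniq // iota_uniq.
  move=> i; rewrite mem_filter mem_index_iota.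
  by case: (boolP (i \in l)) => //= /al; lia.
rewrite !split_sum.
have -> : \sum_(1 <= i < m.+1 | i \notin l) F i =
          \sum_(1 <= i < m.+1 | i \notin l) G i.
  rewrite big_nat_cond [RHS]big_nat_cond; apply: eq_bigr => i /andP[im il].
  by apply: eFG.
by rewrite addnAC [RHS]addnAC; congr (_ + _); rewrite addnC.
Qed.

Lemma sum_le1 m (F : nat -> nat) x :
  0 < x <= m -> (forall i, 0 < i <= m -> i != x -> F i = 0) ->
  \sum_(1 <= i < m.+1) F i = F x.
Proof.
move=> xm F0; have := @sum_update m [:: x] F (fun _ => 0).
rewrite !big_seq1 [X in _ = X + _]big1 // addn0 add0n => -> //=.
  by rewrite xm.
by move=> i im; rewrite inE => /F0->.
Qed.

Variables (m : nat) (s t : nat -> nat).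
Hypothesis st : link_pattern m s t.

Lemma pattern_range x : s x != 0 -> [&& 0 < x, x <= m, 0 < s x & s x <= m].
Proof. by case: st => h *; exact: h. Qed.

Lemma pattern_tK x : s x != 0 -> t (s x) = x.
Proof. by case: st => _ h *; exact: h. Qed.

Lemma pattern_sK y : t y != 0 -> s (t y) = y.
Proof. by case: st => _ _ h _ /h[]. Qed.

Lemma pattern_t0 x : s x != 0 -> t x = 0.
Proof. by case: st => _ _ _ h *; exact: h. Qed.

Lemma pattern_t_range y : t y != 0 -> [&& 0 < y, y <= m, 0 < t y & t y <= m].
Proof.
case: st => h _ h2 _ ty; have [y0 sty] := h2 _ ty.
by have := h (t y); rewrite sty; lia.
Qed.

Lemma pattern_s0 y : t y != 0 -> s y = 0.
Proof. by move=> ty; case: (eqVneq (s y) 0) => // /pattern_t0; lia. Qed.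

(** All that is known about the two partial maps at one label, in a form that
    linear arithmetic can use. *)
Lemma pattern_facts x :
  (s x = 0 \/ 0 < x /\ x <= m /\ 0 < s x /\ s x <= m /\ t x = 0 /\ t (s x) = x)
  /\ (t x = 0 \/ 0 < x /\ x <= m /\ 0 < t x /\ t x <= m /\ s x = 0 /\ s (t x) = x).
Proof.
split.
  case: (eqVneq (s x) 0) => [|sx]; first by left.
  right; have /and4P[-> -> -> ->] := pattern_range sx.
  by rewrite (pattern_t0 sx) pattern_tK.
case: (eqVneq (t x) 0) => [|tx]; first by left.
right; have /and4P[-> -> -> ->] := pattern_t_range tx.
by rewrite (pattern_s0 tx) pattern_sK.
Qed.

Lemma pattern_s_inj x i : s x != 0 -> s i = s x -> i = x.
Proof. by move=> sx e; rewrite -(pattern_tK sx) -e pattern_tK // e. Qed.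

Lemma pattern_head_neq_tail x i : s x != 0 -> s i <> x.
Proof.
move=> sx e; have := pattern_t0 sx; have x0 := pattern_range sx.
have si : s i != 0 by lia.
by rewrite -e pattern_tK //; have := pattern_range si; lia.
Qed.

Lemma sum_arcs_by_head (F : nat -> nat -> nat) :
  \sum_(1 <= i < m.+1) (s i != 0) * F i (s i)
    = \sum_(1 <= z < m.+1) (t z != 0) * F (t z) z.
Proof.
transitivity (\sum_(1 <= i < m.+1) \sum_(1 <= z < m.+1) (s i == z) * F i z).
  apply: eq_big_nat => i im.
  case: (eqVneq (s i) 0) => [si0|si].
    rewrite mul0n big1_seq // => z; rewrite mem_index_iota => /andP[_ zm].
    by rewrite si0; case: eqP => // z0; lia.
  rewrite (@sum_le1 _ _ (s i)) ?eqxx //; first by have := pattern_range si; lia.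
  by move=> z _ zs; rewrite eq_sym (negPf zs).
rewrite exchange_big; apply: eq_big_nat => z zm.
case: (eqVneq (t z) 0) => [tz0|tz].
  rewrite mul0n big1_seq // => i; rewrite mem_index_iota => /andP[_ im].
  case: eqP => // si; have si0 : s i != 0 by lia.
  by have := pattern_tK si0; rewrite si; lia.
rewrite (@sum_le1 _ _ (t z)) ?pattern_sK ?eqxx //.
  by have := pattern_t_range tz; lia.
move=> i im it; case: eqP => // si.
have si0 : s i != 0 by lia.
by move: it; rewrite -si (pattern_tK si0) eqxx.
Qed.

End Sums.

(** * Elementary moves *)

Section Moves.
Variables (m : nat) (s t : nat -> nat).
Hypothesis st : link_pattern m s t.

Definition pointwise (f g : nat -> nat) := forall i, f i = g i.

(** All moves but [Delete] conjugate the pattern by the transposition of two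
    labels, in the direction which enlarges the corner counts. [SwapTails]
    includes the case where [y] is on no arc; in [LowerHead] it is the label
    [z] that is on no arc; [SwapTailHead] exchanges a tail [x] with a later
    head [y]; [Reverse] is the case where both belong to the same arc. *)
Variant elementary_move (u v : nat -> nat) : Prop :=
| SwapTails x y of x < y & y <= m & t y = 0 & s y < s x
  & pointwise u (fun i => if i == x then s y else if i == y then s x else s i)
  & pointwise v (fun z => if z == 0 then 0 else if z == s x then y
                          else if z == s y then x else t z)
| LowerHead k z of 0 < z & z < s k & s z = 0 & t z = 0
  & pointwise u (fun i => if i == k then z else s i)
  & pointwise v (fun i => if i == z then k else if i == s k then 0 else t i)
| SwapTailHead x y of x < y & s x != 0 & t y != 0 & t y != x
  & pointwise u (fun i => if i == x then 0 else if i == y then s x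
                          else if i == t y then x else s i)
  & pointwise v (fun z => if z == y then 0 else if z == x then t y
                          else if z == s x then y else t z)
| Reverse x of s x != 0 & x < s x
  & pointwise u (fun i => if i == x then 0 else if i == s x then x else s i)
  & pointwise v (fun z => if z == x then s x else if z == s x then 0 else t z)
| Delete k of s k != 0
  & pointwise u (fun i => if i == k then 0 else s i)
  & pointwise v (fun z => if z == s k then 0 else t z).

(** The arcs gained when [q] grows are counted at their heads, so that
    hypotheses on the labels of an interval of heads apply to them. *)
Lemma corner_count_cols p q q' : q <= q' ->
  corner_count m s p q' = corner_count m s p q +
    \sum_(1 <= z < m.+1) (t z != 0) * ((t z <= p) && (q < z <= q')).
Proof.
move=> qq; rewrite -(sum_arcs_by_head st (fun i z => (i <= p) && (q < z <= q'))).
rewrite /corner_count -big_split; apply: eq_big_nat => i im /=.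
by case: (leqP i p) => ip; lia.
Qed.

Lemma corner_count_rows p p' q : p <= p' ->
  corner_count m s p' q = corner_count m s p q +
    \sum_(1 <= i < m.+1) ((p < i <= p') && (s i <= q)).
Proof.
by move=> pp; rewrite /corner_count -big_split; apply: eq_big_nat => i im /=; lia.
Qed.

(* Each equality between labels met in a conditional is either substituted or
   transported through both partial maps before the arithmetic is tried. *)
Local Ltac split_ifs :=
  repeat match goal with
  | |- context [if ?a == ?b then _ else _] =>
      lazymatch a with
      | context [if _ then _ else _] => fail
      | _ => let e := fresh "e" in
             case: (eqVneq a b) => e;
             [have ? := congr1 t e; have ? := congr1 s e | ]; subst; try lia
      end
  end; try lia.

Lemma move_pattern u v : elementary_move u v -> link_pattern m u v.
Proof.
have F := pattern_facts st.
case=> [x y xy ym ty sxy uE vE|k z z0 zk sz tz uE vE|x y xy sx ty tyx uE vE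
       |x sx xsx uE vE|k sk uE vE].
- have [Fx _] := F x; have [Fy _] := F y.
  have [_ Fsx] := F (s x); have [_ Fsy] := F (s y).
  split=> i; rewrite !(uE, vE); have [Fi Fi'] := F i;
    have [_ Fsi] := F (s i); have [Fti _] := F (t i); split_ifs.
- have [Fk _] := F k; have [_ Fsk] := F (s k).
  split=> i; rewrite !(uE, vE); have [Fi Fi'] := F i;
    have [_ Fsi] := F (s i); have [Fti _] := F (t i); split_ifs.
- have [Fx _] := F x; have [_ Fy] := F y.
  have [_ Fsx] := F (s x); have [Fty _] := F (t y).
  split=> i; rewrite !(uE, vE); have [Fi Fi'] := F i;
    have [_ Fsi] := F (s i); have [Fti _] := F (t i); split_ifs.
- have [Fx _] := F x; have [_ Fsx] := F (s x).
  split=> i; rewrite !(uE, vE); have [Fi Fi'] := F i;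
    have [_ Fsi] := F (s i); have [Fti _] := F (t i); split_ifs.
- have [Fk _] := F k; have [_ Fsk] := F (s k).
  split=> i; rewrite !(uE, vE); have [Fi Fi'] := F i;
    have [_ Fsi] := F (s i); have [Fti _] := F (t i); split_ifs.
Qed.

Lemma corner_count_update (l : seq nat) (u : nat -> nat) p q :
    uniq l -> all (fun i => 0 < i <= m) l -> (forall i, i \notin l -> u i = s i) ->
  corner_count m u p q + \sum_(i <- l) ((i <= p) && (s i <= q))
    = corner_count m s p q + \sum_(i <- l) ((i <= p) && (u i <= q)).
Proof. by move=> Ul al us; apply: sum_update => // i _ /us->. Qed.

End Moves.

(** * Corner counts after a move *)

Section Counts.
Variables (m : nat) (s t : nat -> nat).
Hypothesis st : link_pattern m s t.

Local Notation F := (pattern_facts st).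

(** Every move adds to the corner counts the indicator of an explicit region
    of the [(p, q)]-plane. To know that a move of [s] stays below [s'] is thus
    to know that the two corner counts differ on this region. *)
Lemma corner_count_swap_tails x y u p q : x < y -> y <= m -> s y < s x ->
    pointwise u (fun i => if i == x then s y else if i == y then s x else s i) ->
  corner_count m u p q = corner_count m s p q + ((x <= p < y) && (s y <= q < s x)).
Proof.
move=> xy ym sxy uE; have [Fx _] := F x.
have := @corner_count_update m s [:: x; y] u p q.
rewrite !big_cons !big_nil !uE !eqxx /= !inE; have -> /= : (y == x) = false by lia.
(* [Wrap] delays the conclusion, so that the premises become side goals. *)
case/(_ _ _ _)/Wrap => //; try lia.
  move=> i; rewrite !inE uE. case: eqP => //=; case: eqP => //.
Qed.

Lemma corner_count_lower_head k z u p q : z < s k ->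
    pointwise u (fun i => if i == k then z else s i) ->
  corner_count m u p q = corner_count m s p q + ((k <= p) && (z <= q < s k)).
Proof.
move=> zk uE; have [Fk _] := F k.
have := @corner_count_update m s [:: k] u p q.
rewrite !big_cons !big_nil !uE !eqxx /=.
case/(_ _ _ _)/Wrap => //; try lia.
  by move=> i; rewrite !inE uE; case: eqP.
Qed.

Lemma corner_count_swap_tail_head x y u p q : x < y -> s x != 0 -> t y != 0 -> t y != x ->
    pointwise u (fun i => if i == x then 0 else if i == y then s x
                          else if i == t y then x else s i) ->
  corner_count m u p q = corner_count m s p q + ((x <= p < y) && (q < s x))
                   + ((t y <= p) && (x <= q < y)).
Proof.
move=> xy sx ty tyx uE; have [Fx _] := F x; have [_ Fy] := F y.
have tyy : t y != y by apply/eqP=> e; rewrite e in Fy; lia.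
have := @corner_count_update m s [:: x; y; t y] u p q.
rewrite !big_cons !big_nil !uE !eqxx /= !inE.
have -> /= : (y == x) = false by lia.
rewrite (negPf tyx) (negPf tyy).
case/(_ _ _ _)/Wrap => //; try lia.
  move=> i; rewrite !inE uE. case: eqP => //=; case: eqP => //; case: eqP => //.
Qed.

Lemma corner_count_reverse x u p q : s x != 0 -> x < s x ->
    pointwise u (fun i => if i == x then 0 else if i == s x then x else s i) ->
  corner_count m u p q = corner_count m s p q
    + ([&& x <= p, q < s x & (p < s x) || (x <= q)]).
Proof.
move=> sx xsx uE; have [Fx _] := F x; have [_ Fy] := F (s x).
have := @corner_count_update m s [:: x; s x] u p q.
rewrite !big_cons !big_nil !uE !eqxx /= !inE.
have -> /= : (s x == x) = false by lia.
case/(_ _ _ _)/Wrap => //; try lia.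
  by move=> i; rewrite !inE uE; case: eqP => //=; case: eqP.
Qed.

End Counts.

(** * Moves of codimension one *)

Section Counts.
Variables (m : nat) (s t : nat -> nat).
Hypothesis st : link_pattern m s t.

Local Notation F := (pattern_facts st).

(** Away from the labels [l] that take part in a move, the contribution of a
    label to [end_count] changes only if the corner of that label lies in the
    region of the move. *)
Lemma end_count_update (l : seq nat) (u v : nat -> nat) :
    uniq l -> all (fun i => 0 < i <= m) l ->
    (forall i, 0 < i <= m -> i \notin l ->
       [/\ u i = s i, (v i == 0) = (t i == 0)
         & t i = 0 -> corner_count m u i (s i) = corner_count m s i (s i)]) ->
  end_count m u v + \sum_(x <- l) (t x == 0) * corner_count m s x (s x)
    = end_count m s t + \sum_(x <- l) (v x == 0) * corner_count m u x (u x).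
Proof.
move=> Ul al H; apply: sum_update => // i im il.
have [-> -> h] := H i im il.
by case: (eqVneq (t i) 0) => [/h->|].
Qed.

(** The last hypothesis forbids a label between [x] and [y], not a head, whose
    image lies between those of [x] and [y]: such a label would place another
    pattern strictly between the two ends of the move. In its absence only
    [x] and [y] are affected, and their contributions change by one in total.
    The same mechanism is behind the other moves. *)
Lemma end_count_swap_tails x y u v :
    x < y -> y <= m -> t y = 0 -> s y < s x ->
    pointwise u (fun i => if i == x then s y else if i == y then s x else s i) ->
    pointwise v (fun z => if z == 0 then 0 else if z == s x then y
                          else if z == s y then x else t z) ->
    (forall z, x < z < y -> t z = 0 -> s z < s y \/ s x < s z) ->
  end_count m u v = (end_count m s t).+1.
Proof.
move=> xy ym ty sxy uE vE free; have [Fx _] := F x; have [Fy _] := F y.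
have [_ Fsx] := F (s x); have [_ Fsy] := F (s y).
have nE p q := corner_count_swap_tails st p q xy ym sxy uE.
have v0 i : (v i == 0) = (t i == 0).
  have [_ Fi] := F i.
  rewrite vE; case: (eqVneq i 0) => [|i0]; first by lia.
  case: (eqVneq i (s x)) => [e|_]; first by rewrite e; lia.
  by case: (eqVneq i (s y)) => [e|_] //; move: i0; rewrite e; lia.
have nyx : (y == x) = false by lia.
have := @end_count_update [:: x; y] u v.
rewrite !big_cons !big_nil !v0 !nE !uE !eqxx /= !inE nyx ty.
case/(_ _ _ _)/Wrap => //; try lia.
  move=> i im; rewrite !inE => /norP[/negPf nix /negPf niy]; rewrite uE v0 nix niy; split=> // ti.
  rewrite nE; case: (boolP (x <= i < y)) => [xiy|//]; last by lia.
  by have := free i; lia.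
have -> : t x = 0 by lia.
suff : corner_count m s y (s x) + corner_count m s x (s y) = corner_count m s x (s x) + corner_count m s y (s y).
  move: (end_count _ _ _) (end_count _ _ _) => A B.
  move: (corner_count _ _ _ _) (corner_count _ _ _ _) (corner_count _ _ _ _) (corner_count _ _ _ _).
  lia.
rewrite /corner_count -!big_split; apply: eq_big_nat => i im /=.
have [Fi _] := F i; have [_ Fi'] := F (s i).
case: (eqVneq i x) => [->|ix]; first lia.
case: (eqVneq i y) => [->|iy]; first lia.
have nsx : s i <> s x by move=> e; have := congr1 t e; lia.
have nsy : s i = s y -> s i = 0 by move=> e; have := congr1 t e; lia.
have {}free : x < i < y -> s i <= s y \/ s x < s i by have := free i; lia.
by clear -xy sxy ix iy nsx nsy free; lia.
Qed.

Lemma end_count_lower_head k z u v :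
    0 < z -> z < s k -> s z = 0 -> t z = 0 ->
    pointwise u (fun i => if i == k then z else s i) ->
    pointwise v (fun i => if i == z then k else if i == s k then 0 else t i) ->
    (forall i, k < i -> s i < z \/ s k < s i) ->
    (forall w, z < w < s k -> s w <> 0 \/ t w <> 0) ->
  end_count m u v = (end_count m s t).+1.
Proof.
move=> z0 zk sz tz uE vE freeT freeH; have [Fk _] := F k.
have [_ Fsk] := F (s k).
have nE p q := corner_count_lower_head st p q zk uE.
have kz : k != z by apply/eqP=> e; rewrite e in zk; lia.
have ksk : k != s k by apply/eqP=> e; have := congr1 t e; lia.
have zsk : (z == s k) = false by lia.
have := @end_count_update [:: k; z; s k] u v.
rewrite !big_cons !big_nil !vE !nE !uE !eqxx /= !inE.
rewrite (negPf kz) (negPf ksk) zsk !(eq_sym (s k)) zsk (negPf ksk) !(eq_sym z) (negPf kz).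
case/(_ _ _ _)/Wrap => //; try lia.
  move=> i im; rewrite !inE => /norP[/negPf nik /norP[/negPf niz /negPf nisk]].
  rewrite uE vE nik niz nisk; split=> // ti.
  rewrite nE; have [Fi _] := F i.
  by have := freeT i; lia.
have -> : t k = 0 by lia.
have -> : s (s k) = 0 by lia.
have -> : (t (s k) == 0) = false by lia.
rewrite tz sz.
suff : corner_count m s k z + corner_count m s (s k) 0 = corner_count m s k (s k) + corner_count m s z 0.
  have -> : (k == 0) = false by lia.
  move: (end_count _ _ _) (end_count _ _ _) => A B.
  move: (corner_count _ _ _ _) (corner_count _ _ _ _) (corner_count _ _ _ _) (corner_count _ _ _ _).
  by clear -z0 zk; lia.
rewrite (corner_count_cols st k (ltnW zk)) (corner_count_rows _ _ _ (ltnW zk)).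
rewrite addnA [RHS]addnAC; congr (_ + _); apply: eq_big_nat => w wm.
have [Fw Fw'] := F w.
case: (eqVneq w (s k)) => [->|wk]; first by rewrite leqnn; lia.
have := freeH w; have := freeT (t w) => fT fH.
have : t w = k -> w = s k by move=> e; rewrite e in Fw'; lia.
by clear -fT fH z0 zk wk Fw Fw'; lia.
Qed.

(** The region of this move is a sum of two rectangles. Labels strictly
    between [x] and [y] that are heads contribute once to each of the two
    special differences and cancel; the last two hypotheses say that the
    corners of the two new arcs meet the rectangles only once. *)
Lemma end_count_swap_tail_head x y u v :
    x < y -> s x != 0 -> t y != 0 -> t y != x ->
    pointwise u (fun i => if i == x then 0 else if i == y then s x
                          else if i == t y then x else s i) ->
    pointwise v (fun z => if z == y then 0 else if z == x then t y
                          else if z == s x then y else t z) ->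
    (forall z, x < z < y -> t z = 0 -> s x < s z) ->
    (forall z, x < z < y -> t z <> 0 -> t z < t y) ->
    ~~ [&& t y < y, x < s x & s x < y] ->
    ~~ [&& x < t y, t y < y & x < s x] ->
  end_count m u v = (end_count m s t).+1.
Proof.
move=> xy sx ty tyx uE vE freeT freeH over1 over2.
have [Fx _] := F x; have [_ Fy] := F y.
have [_ Fsx] := F (s x); have [Fty _] := F (t y).
have nE p q := corner_count_swap_tail_head st p q xy sx ty tyx uE.
have tyy : t y <> y by move=> e; rewrite e in Fy; lia.
have sxx : s x <> x by move=> e; rewrite e in Fx; lia.
have tysx : t y <> s x by move=> e; rewrite e in Fy Fty; lia.
have ux : u x = 0 by rewrite uE eqxx.
have uy : u y = s x by rewrite uE eqxx; case: eqP => //; lia.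
have ub : u (t y) = x by rewrite uE (negPf tyx) eqxx; case: eqP.
have vy : v y = 0 by rewrite vE eqxx.
have vx : v x = t y by rewrite vE eqxx; case: eqP => //; lia.
have vb : v (t y) = 0.
  by rewrite vE (negPf tyx); do 2![case: eqP => // _]; lia.
have := @end_count_update [:: x; y; t y] u v.
rewrite !big_cons !big_nil vx vy vb ux uy ub !nE.
case/(_ _ _ _)/Wrap => //=; first by rewrite !inE; clear -xy tyx tyy; lia.
  by clear -xy Fx Fy sx ty; lia.
  move=> i im; rewrite !inE => /norP[/negPf nix /norP[/negPf niy /negPf nity]].
  rewrite uE vE nix niy nity.
  have [Fi Fi'] := F i; have [_ Fsi] := F (s i).
  split=> //.
    by case: (eqVneq i (s x)) => // ->; clear -xy sx Fx; lia.
  move=> ti; rewrite nE.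
  have si1 : s i <> s x by move/(pattern_s_inj st sx); move/eqP: nix.
  have si2 : s i <> x by exact: (pattern_head_neq_tail st sx).
  have {}freeT := freeT i; have {}freeH := freeH (s i).
  by clear -Fi Fx freeT freeH si1 si2 xy sx nix ti; lia.
have -> : t x = 0 by lia.
have -> : t (t y) = 0 by lia.
rewrite (negPf ty) /=.
suff : corner_count m s y (s x) + corner_count m s (t y) x
       = corner_count m s x (s x) + corner_count m s (t y) (s (t y)).
  move: (corner_count _ _ _ (s x)) (corner_count _ _ _ (s x)).
  move: (corner_count _ _ _ x) (corner_count _ _ _ (s _)) (end_count _ _ _) (end_count _ _ _).
  by clear -over1 over2 xy tyx tyy sxx; lia.
have -> : s (t y) = y by lia.
rewrite (corner_count_cols st (t y) (ltnW xy)) (corner_count_rows _ _ _ (ltnW xy)).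
rewrite addnAC -!addnA; congr (_ + (_ + _)); apply: eq_big_nat => w wm.
have [Fw Fw'] := F w; have fT := freeT w; have fH := freeH w.
case: (eqVneq w y) => [->|wy]; first by clear -xy Fy ty; lia.
by clear -xy Fw Fw' wy fT fH; lia.
Qed.

Lemma end_count_reverse x u v : s x != 0 -> x < s x ->
    pointwise u (fun i => if i == x then 0 else if i == s x then x else s i) ->
    pointwise v (fun z => if z == x then s x else if z == s x then 0 else t z) ->
    (forall z, x < z < s x -> t z = 0 -> s x < s z) ->
    (forall z, x < z < s x -> t z <> 0 -> t z < s x) ->
  end_count m u v = (end_count m s t).+1.
Proof.
move=> sx xsx uE vE freeT freeH.
have [Fx _] := F x; have [_ Fsx] := F (s x).
have nE p q := corner_count_reverse st p q sx xsx uE.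
have sxx : (s x == x) = false by lia.
have ux : u x = 0 by rewrite uE eqxx.
have uy : u (s x) = x by rewrite uE eqxx sxx.
have vx : v x = s x by rewrite vE eqxx.
have vy : v (s x) = 0 by rewrite vE eqxx sxx.
have := @end_count_update [:: x; s x] u v.
rewrite !big_cons !big_nil vx vy ux uy !nE.
case/(_ _ _ _)/Wrap => //=; first by rewrite !inE; clear -xsx; lia.
  by clear -Fx sx; lia.
  move=> i im; rewrite !inE => /norP[/negPf nix /negPf niy].
  rewrite uE vE nix niy; split=> // ti; rewrite nE.
  have [Fi _] := F i.
  have si1 : s i <> s x by move/(pattern_s_inj st sx); move/eqP: nix.
  have si2 : s i <> x by exact: (pattern_head_neq_tail st sx).
  have {}freeT := freeT i; have {}freeH := freeH (s i).
  by clear -Fi Fx freeT freeH si1 si2 xsx sx nix niy ti; lia.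
have -> : t x = 0 by lia.
have -> : (t (s x) == 0) = false by lia.
rewrite (negPf sx) /=.
suff : (corner_count m s (s x) x).+1 = (corner_count m s x (s x)).+1.
  move: (corner_count _ _ _ (s x)) (corner_count _ _ _ _) (end_count _ _ _) (end_count _ _ _).
  by clear -xsx; lia.
have H1 := corner_count_cols st (s x) (ltnW xsx).
have H2 := corner_count_rows m s (s x) (ltnW xsx).
suff : \sum_(1 <= i < m.+1) ((x < i <= s x) && (s i <= s x)) =
       \sum_(1 <= z < m.+1) (t z != 0) * ((t z <= s x) && (x < z <= s x)).
  by move=> E; move: H2; rewrite H1 E => /addIn->.
apply: eq_big_nat => w wm; have [Fw Fw'] := F w.
have fT := freeT w; have fH := freeH w.
case: (eqVneq w (s x)) => [->|wy]; first by clear -xsx Fsx Fx; lia.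
by clear -xsx Fw Fw' wy fT fH; lia.
Qed.

Lemma corner_count_delete k u p q : s k != 0 ->
    pointwise u (fun i => if i == k then 0 else s i) ->
  corner_count m u p q = corner_count m s p q + ((k <= p) && (q < s k)).
Proof.
move=> sk uE; have [Fk _] := F k.
have := @corner_count_update m s [:: k] u p q.
rewrite !big_cons !big_nil !uE !eqxx /=.
case/(_ _ _ _)/Wrap => //; try lia.
  by move=> i; rewrite !inE uE; case: eqP.
Qed.

(** Only an arc going down can be deleted in codimension one: an arc going up
    has to be reversed before. *)
Lemma end_count_delete k u v : s k != 0 -> s k < k ->
    pointwise u (fun i => if i == k then 0 else s i) ->
    pointwise v (fun z => if z == s k then 0 else t z) ->
    (forall i, k < i -> i <= m -> t i = 0 -> s k < s i) ->
    (forall w, 0 < w < s k -> s w <> 0 \/ t w <> 0) ->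
  end_count m u v = (end_count m s t).+1.
Proof.
move=> sk skk uE vE freeT freeH; have [Fk _] := F k.
have [_ Fsk] := F (s k).
have nE p q := corner_count_delete p q sk uE.
have := @end_count_update [:: k; s k] u v.
rewrite !big_cons !big_nil !vE !nE !uE !eqxx /= !inE.
have -> : (k == s k) = false by lia.
have -> : (s k == k) = false by lia.
case/(_ _ _ _)/Wrap => //; try by clear -Fk skk sk; lia.
  move=> i im; rewrite !inE => /norP[/negPf nik /negPf nisk].
  rewrite uE vE nik nisk; split=> // ti.
  rewrite nE; have [Fi _] := F i.
  have {}freeT := freeT i.
  by clear -Fi freeT ti nik im; lia.
have -> : t k = 0 by lia.
have -> : s (s k) = 0 by lia.
have -> : (t (s k) == 0) = false by lia.
suff : corner_count m s k 0 + corner_count m s (s k) 0 = corner_count m s k (s k).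
  move: (corner_count _ _ _ _) (corner_count _ _ _ _) (corner_count _ _ _ _).
  move: (end_count _ _ _) (end_count _ _ _).
  by clear -skk sk; lia.
rewrite (corner_count_cols st k (leq0n (s k))); congr (_ + _).
apply: eq_big_nat => w wm.
have [Fw Fw'] := F w.
have fT := freeT (t w); have fH := freeH w.
have [_ Ftw] := F (t w).
case: (eqVneq w (s k)) => [->|wk]; first by clear -Fk sk skk Fsk; lia.
by clear -fT fH wk Fw Fw' Ftw wm sk; lia.
Qed.

End Counts.

(** * Moves that stay below a given pattern *)

Lemma least_nat (P : nat -> Prop) :
  (exists n, P n) -> exists2 n, P n & forall i, i < n -> ~ P i.
Proof.
move=> exP; have exQ : exists n, `[< P n >] by have [n Pn] := exP; exists n; apply/asboolP.
exists (ex_minn exQ); first by case: ex_minnP => n /asboolP.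
case: ex_minnP => n _ nmin i ilt Pi.
by have := nmin i (introT (asboolP _) Pi); lia.
Qed.

Lemma greatest_nat (P : nat -> Prop) b :
    (forall n, P n -> n <= b) ->
  (exists n, P n) -> exists2 n, P n & forall i, n < i -> ~ P i.
Proof.
move=> Pb exP; have exQ : exists n, `[< P n >] by have [n Pn] := exP; exists n; apply/asboolP.
have Qb n : `[< P n >] -> n <= b by move=> /asboolP/Pb.
exists (ex_maxn exQ Qb); first by case: ex_maxnP => n /asboolP.
case: ex_maxnP => n _ nmax i ilt Pi.
by have := nmax i (introT (asboolP _) Pi); lia.
Qed.

Section Basic.
Variables (m : nat) (s : nat -> nat).

Lemma corner_count_sat p q : m <= p -> corner_count m s p q = corner_count m s m q.
Proof. by move=> mp; apply: eq_big_nat => i im; lia. Qed.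

Lemma corner_count_full p : (forall i, s i <= m) -> corner_count m s p m = minn p m.
Proof.
move=> sm; transitivity (\sum_(1 <= i < m.+1) (i <= p : nat)).
  by apply: eq_big_nat => i im; rewrite sm andbT.
elim: m => [|n IH]; first by rewrite big_nil; lia.
by rewrite big_nat_recr //= IH; lia.
Qed.

Lemma corner_count_colsE p q q' : q <= q' ->
  corner_count m s p q' = corner_count m s p q +
    \sum_(1 <= i < m.+1) ((i <= p) && (q < s i <= q')).
Proof. by move=> qq; rewrite /corner_count -big_split; apply: eq_big_nat => i im /=; lia. Qed.

Lemma corner_count_at k q : 0 < k <= m -> corner_count m s k q = corner_count m s k.-1 q + (s k <= q).
Proof.
move=> km; rewrite (corner_count_rows m s q (leq_pred k)); congr (_ + _).
rewrite (@sum_le1 _ _ k) //; first by rewrite leqnn andbT; case: (s k <= q); lia.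
by move=> i im ik; lia.
Qed.

End Basic.

Lemma leq_sum_strict m (F G : nat -> nat) k : 0 < k <= m ->
  (forall i, 0 < i <= m -> F i + (i == k) <= G i) ->
  \sum_(1 <= i < m.+1) F i < \sum_(1 <= i < m.+1) G i.
Proof.
move=> km H.
have /leq_trans -> // : \sum_(1 <= i < m.+1) F i < \sum_(1 <= i < m.+1) (F i + (i == k)).
  rewrite big_split /= [X in _ < _ + X](@sum_le1 _ _ k) ?eqxx ?addn1 //.
  by move=> i _ /negPf->.
by rewrite big_nat [X in _ <= X]big_nat; apply: leq_sum => i; apply: H.
Qed.

Lemma leq_sum_nat m (F G : nat -> nat) :
  (forall i, 0 < i <= m -> F i <= G i) ->
  \sum_(1 <= i < m.+1) F i <= \sum_(1 <= i < m.+1) G i.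
Proof. by move=> H; rewrite big_nat [X in _ <= X]big_nat; apply: leq_sum => i; apply: H. Qed.

(** From here on [s] and [s'] are different patterns, the corner counts of
    [s] are bounded by those of [s'], and [k] is the first label where they
    differ. *)
Section Chain.
Variables (m : nat) (s t s' t' : nat -> nat).
Hypothesis st : link_pattern m s t.
Hypothesis st' : link_pattern m s' t'.
Hypothesis leN : forall p q, corner_count m s p q <= corner_count m s' p q.
Variable k : nat.
Hypothesis agree : forall i, i < k -> s i = s' i.
Hypothesis differ : s k <> s' k.

Local Notation F := (pattern_facts st).
Local Notation F' := (pattern_facts st').
Local Notation N := (corner_count m s).
Local Notation N' := (corner_count m s').

Lemma k_range : 0 < k <= m.
Proof. by have [Fk _] := F k; have [Fk' _] := F' k; lia. Qed.

Lemma N_before p q : p < k -> N p q = N' p q.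
Proof.
by move=> pk; apply: eq_big_nat => i im; case: (leqP i p) => //= ip; rewrite agree //; lia.
Qed.

Lemma N_at_k q : N k q + (s' k <= q) = N' k q + (s k <= q).
Proof.
have km := k_range; rewrite (corner_count_at s q km) (corner_count_at s' q km) addnAC N_before //.
by clear -km; lia.
Qed.

(** The counts of the rows before [k] are equal, so those of row [k] compare
    the two arcs leaving [k]. *)
Lemma s'k_lt : s' k < s k.
Proof. by have := leN k (s k); have := N_at_k (s k); move: (N _ _) (N' _ _); lia. Qed.

(** A move with region [R] applied to [s] leads to a pattern that is still
    bounded by [s']. *)
Definition fits (R : nat -> nat -> nat) := forall p q, N p q + R p q <= N' p q.

Lemma fits_sub (R R' : nat -> nat -> nat) : fits R -> (forall p q, R' p q <= R p q) -> fits R'.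
Proof. by move=> fR RR p q; apply: leq_trans (fR p q); rewrite leq_add2l. Qed.

Lemma fits_bool (R : nat -> nat -> bool) :
  (forall p q, R p q -> N p q < N' p q) -> fits R.
Proof.
move=> H p q; case: (boolP (R p q)) => [/H|_]; first by rewrite addn1.
by rewrite addn0.
Qed.

(** The label [k] can be exchanged with the later label [y]. The alternatives
    are the moves [SwapTails], [SwapTailHead] and [Reverse] at [k] and [y]. *)
Definition good_tail y := [/\ k < y, y <= m &
  [\/ [/\ t y = 0, s y < s k & fits (fun p q => (k <= p < y) && (s y <= q < s k))],
      [/\ t y <> 0, t y <> k &
          fits (fun p q => ((k <= p < y) && (q < s k)) + ((t y <= p) && (k <= q < y)))]
    | y = s k /\ fits (fun p q => [&& k <= p, q < s k & (p < s k) || (k <= q)])]].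

(** The head of the arc leaving [k] can be exchanged with the earlier label
    [z], by [LowerHead] or by [SwapTailHead] at [z] and [s k]. *)
Definition good_head z := [/\ 0 < z, z < s k, z <> k &
  [\/ [/\ s z = 0, t z = 0 & fits (fun p q => (k <= p) && (z <= q < s k))]
    | s z <> 0 /\
      fits (fun p q => ((z <= p < s k) && (q < s z)) + ((k <= p) && (z <= q < s k)))]].

Definition good_deletion := fits (fun p q => (k <= p) && (q < s k)).

Lemma swap_good y : k < y -> t y = 0 -> s y < s k -> y <= m ->
  (forall p q, k <= p < y -> s y <= q < s k -> N p q < N' p q) -> good_tail y.
Proof.
move=> ky ty syk ym H; split=> //; constructor 1; split=> //.
by apply: fits_bool => p q /andP[]; exact: H.
Qed.

(** First case: [k] is also a tail in [s']. If [k] cannot be exchanged with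
    any later label, then the head [s k] can be lowered. *)
Section Positive.
Hypothesis s'k : 0 < s' k.
Hypothesis no_tail : forall y, ~ good_tail y.

(** In the window of heads [s' k <= q < s k] the pattern [s'] has one more arc
    than [s], the one leaving [k]. The gain could be lost only to an arc of
    [s] starting in [k+1..p] with its head in the window, but the tail of the
    first such arc would be exchangeable with [k]. *)
Lemma column_gain p q : k <= p -> s' k <= q < s k ->
  N p q + N' p (s' k).-1 < N' p q + N p (s' k).-1.
Proof.
elim/ltn_ind: p q => p IH q kp ql.
have Sle : (s' k).-1 <= q by lia.
rewrite (corner_count_colsE m s p Sle) (corner_count_colsE m s' p Sle).
suff : \sum_(1 <= i < m.+1) ((i <= p) && ((s' k).-1 < s i <= q)) <
       \sum_(1 <= i < m.+1) ((i <= p) && ((s' k).-1 < s' i <= q)).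
  by move: (N _ _) (N' _ _) (\sum_(_ <= _ < _) _) (\sum_(_ <= _ < _) _); lia.
apply: (leq_sum_strict k_range) => i im.
case: (ltngtP i k) => [ik|ki|->]; first by rewrite agree //; lia.
  suff -> : (i <= p) && ((s' k).-1 < s i <= q) = false by lia.
  apply/negP=> /andP[ip /andP[s1 s2]]; have [Fi _] := F i.
  apply: (no_tail (y := i)); apply: swap_good; try by clear -ki s1 s2 Fi ql s'k im; lia.
  move=> p' q' pi qs; have := IH p' _ q' _ _; have := leN p' (s' k).-1.
  move: (N _ _) (N' _ _) (N _ _) (N' _ _) => a b c d.
  by clear -ip pi qs s1 ql s'k => H1 H2; have := H2; lia.
by have := s'k_lt; lia.
Qed.

Lemma window_gain p q : k <= p -> s' k <= q < s k -> N p q < N' p q.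
Proof.
move=> kp ql; have := column_gain kp ql; have := leN p (s' k).-1.
by move: (N _ _) (N' _ _) (N _ _) (N' _ _); clear; lia.
Qed.

(** The tail of an arc whose head lies in the window would be a good tail if it
    came after [k]. *)
Lemma window_head z : s' k <= z < s k -> t z <> 0 -> t z < k.
Proof.
move=> zl tz; rewrite ltnNge; apply/negP=> ktz; have [_ Fz] := F z.
have tzk : t z <> k by move=> e; rewrite e in Fz; lia.
apply: (no_tail (y := t z)); have [_ Ftz] := F (t z).
apply: swap_good; try by clear -tzk ktz zl Fz Ftz tz; lia.
move=> p q pz qz; apply: window_gain; first by clear -pz; lia.
by clear -qz zl Fz tz; lia.
Qed.

Lemma head_before z : t z <> 0 -> t z < k -> t' z = t z /\ s' z = 0.
Proof.
move=> tz tzk; have [_ Fz] := F z; have e := agree tzk.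
have sz : s' (t z) = z by lia.
have [Ftz _] := F' (t z); have [_ F'z] := F' z; rewrite sz in Ftz.
by clear -Fz tz Ftz F'z; lia.
Qed.

(** A label of the window on no arc would do. Otherwise the labels of the
    window are heads of arcs common to both patterns, or tails in [s], and
    [s' k] is among the latter. Let [q0] be the least height, not below
    [s' (s k)], at which the counts of row [s k] agree. Counting rows between
    [s' k] and [s k] at height [q0] shows that some tail of the window has its
    head at most at [q0]; the last such tail [z] works, because the counts
    differ on all rows from [z] to [s k] under [s z]. *)
Lemma good_head_exists : exists z, good_head z.
Proof.
have lk := s'k_lt; have km := k_range.
have [Fk _] := F k; have [Fk' _] := F' k.
have [_ Fl] := F (s k); have [_ Fl'] := F' (s' k).
case: (pselect (exists z, [/\ s' k <= z < s k, s z = 0 & t z = 0])) => [[z [zl sz tz]]|nofix].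
  exists z; split; try by clear -zl s'k; lia.
    by move=> zk; move: lk; rewrite -zk sz.
  constructor 1; split=> //; apply: fits_bool => p q /andP[kp qz].
  by apply: window_gain => //; clear -qz zl; lia.
have heads i : s' k <= i < s k -> s i = 0 -> s' i = 0 /\ t' i < k.
  move=> il si; case: (eqVneq (t i) 0) => [ti|/eqP ti].
    by case: nofix; exists i.
  by have tik := window_head il ti; have [-> ->] := head_before ti tik.
have sl' : s (s' k) <> 0.
  move=> sl'0; have [] := heads (s' k) _ sl'0; first by clear -lk; lia.
  by clear -Fk' s'k; lia.
have kl' : k < s' k.
  rewrite ltnNge; apply/negP; rewrite leq_eqVlt => /orP[/eqP e|/agree e].
    by rewrite e in Fl' Fk'; clear -Fk' Fl' km; lia.
  by clear -e sl' Fl' s'k Fk'; lia.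
have [q0 [q00 q01] q0min] : exists2 q0, N (s k) q0 = N' (s k) q0 /\ s' (s k) <= q0
    & forall q, q < q0 -> ~ (N (s k) q = N' (s k) q /\ s' (s k) <= q).
  apply: least_nat; exists m; split; last by have [F'l _] := F' (s k); clear -F'l; lia.
  rewrite !corner_count_full // => i; first by have [Fi _] := F' i; clear -Fi; lia.
  by have [Fi _] := F i; clear -Fi; lia.
have rows p q : p <= s k -> N' p q + N (s k) q + \sum_(1 <= i < m.+1) ((p < i <= s k) && (s' i <= q))
    = N p q + N' (s k) q + \sum_(1 <= i < m.+1) ((p < i <= s k) && (s i <= q)).
  move=> pl; rewrite (corner_count_rows m s q pl) (corner_count_rows m s' q pl).
  by move: (N _ _) (N' _ _) (\sum_(_ <= _ < _) _) (\sum_(_ <= _ < _) _); clear; lia.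
have [] := @greatest_nat (fun z => [/\ s' k <= z < s k, s z <> 0 & s z <= q0]) (s k).
- by move=> n [nl _ _]; clear -nl; lia.
- apply: contrapT => none.
  have := leN (s' k).-1 q0; have := @rows (s' k).-1 q0.
  suff : \sum_(1 <= i < m.+1) (((s' k).-1 < i <= s k) && (s i <= q0)) <
         \sum_(1 <= i < m.+1) (((s' k).-1 < i <= s k) && (s' i <= q0)).
    rewrite q00; move: (N _ _) (N' _ _) (N' _ _) (\sum_(_ <= _ < _) _) (\sum_(_ <= _ < _) _).
    by clear -lk => a b c d e; have : (s' k).-1 <= s k; lia.
  apply: (@leq_sum_strict _ _ _ (s' k)); first by clear -Fk' s'k; lia.
  move=> i im; have [_ Fi] := F i.
  case: (eqVneq i (s k)) => [->|ik]; first by rewrite q01; clear -lk; lia.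
  case: (boolP (s' k <= i < s k)) => [il|]; last by clear -ik s'k lk; lia.
  case: (eqVneq (s i) 0) => [si|/eqP si].
    have [si' ti'] := heads i il si; have ne : i <> s' k by move=> e; rewrite -e in sl'.
    by rewrite si si'; clear -ne; lia.
  have nsi : ~ s i <= q0 by move=> h; apply: none; exists i.
  case: (eqVneq i (s' k)) => [e|]; last by clear -nsi; lia.
  by rewrite e in nsi *; clear -nsi Fl' Fk' s'k lk; lia.
move=> z [zl sz zq] zmax; exists z; split; try by clear -zl kl'; lia.
constructor 2; split=> //.
have tail_gain p q : z <= p < s k -> q < s z -> N p q < N' p q.
  move=> zp qz; have pl : p <= s k by clear -zp; lia.
  have := @rows p q pl; have := @rows p q0 pl; have := leN p q0; have := leN (s k) q.
  rewrite q00.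
  have -> : \sum_(1 <= i < m.+1) ((p < i <= s k) && (s i <= q)) =
            \sum_(1 <= i < m.+1) ((p < i <= s k) && (s i <= q0)).
    apply: eq_big_nat => i im; case: (boolP (p < i <= s k)) => //= il.
    case: (eqVneq i (s k)) => [e|ik]; first by rewrite e; clear -Fk lk Fl; lia.
    have il' : z < i by clear -il zp; lia.
    have := zmax i il'; case: (eqVneq (s i) 0) => [->|/eqP si]; first by clear; lia.
    have wi : s' k <= i < s k by clear -il ik zp zl; lia.
    move=> h; have : ~ s i <= q0 by move=> h'; apply: h.
    by clear -zq qz; lia.
  have mono : \sum_(1 <= i < m.+1) ((p < i <= s k) && (s' i <= q)) + (q < s' (s k)) <=
         \sum_(1 <= i < m.+1) ((p < i <= s k) && (s' i <= q0)).
    have skm : 0 < s k <= m by clear -Fk lk; lia.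
    case: (boolP (q < s' (s k))) => ql.
      rewrite addn1; apply: (@leq_sum_strict _ _ _ (s k)) => // i im.
      case: (eqVneq i (s k)) => [->|ik]; first by clear -ql q01 zp; lia.
      by clear -qz zq; lia.
    by rewrite addn0; apply: leq_sum_nat => i im; clear -qz zq; lia.
  have := q0min q (leq_trans qz zq).
  move: mono; move: (N _ _) (N' _ _) (N _ _) (N' _ _) (N' _ _).
  move: (\sum_(_ <= _ < _) _) (\sum_(_ <= _ < _) _) (\sum_(_ <= _ < _) _).
  by clear; lia.
move=> p q; case: (boolP ((z <= p < s k) && (q < s z))) => [/andP[zp qz]|_].
  have := tail_gain _ _ zp qz; case: (boolP (z <= q < s k)) => zq'; last first.
    by move: (N _ _) (N' _ _); clear -zq'; lia.
  have kp : k <= p by clear -zp zl kl'; lia.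
  have ql : s' k <= q < s k by clear -zl zq'; lia.
  have := column_gain kp ql.
  have := @tail_gain p (s' k).-1 zp _; move: (N _ _) (N' _ _) (N _ _) (N' _ _).
  by clear -zl zq' qz s'k => a b c d; have : (s' k).-1 < s z; lia.
case: (boolP ((k <= p) && (z <= q < s k))) => [/andP[kp qz]|_]; last by have := leN p q; rewrite !addn0.
by rewrite add0n addn1; apply: window_gain => //; clear -qz zl; lia.
Qed.

End Positive.

(** Second case: [k] is not a tail in [s']. If [k] cannot be exchanged with
    any later label, then its arc can be deleted. *)
Section Vanishing.
Hypothesis s'k : s' k = 0.
Hypothesis no_tail : forall y, ~ good_tail y.

Lemma columns p q : k <= q ->
  N p q + N' p k.-1 + \sum_(1 <= z < m.+1) ((k <= z <= q) && (0 < t' z <= p))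
  = N' p q + N p k.-1 + \sum_(1 <= z < m.+1) ((k <= z <= q) && (0 < t z <= p)).
Proof.
move=> kq; have kq' : k.-1 <= q by lia.
have km := k_range.
rewrite (corner_count_cols st p kq') (corner_count_cols st' p kq').
have eqs (a : nat -> nat) : \sum_(1 <= z < m.+1) (a z != 0) * ((a z <= p) && (k.-1 < z <= q))
   = \sum_(1 <= z < m.+1) ((k <= z <= q) && (0 < a z <= p)).
  by apply: eq_big_nat => z zm; clear -km; lia.
rewrite !eqs; move: (N _ _) (N' _ _) (\sum_(_ <= _ < _) _) (\sum_(_ <= _ < _) _).
by clear; lia.
Qed.

(** Suppose that deletion fails and let [p1] be the first row with a
    coincidence of counts under [s k], at height [q0]. Up to [p1], every label
    after [k] that is not a head starts an arc going above [s k]. Let [p0] be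
    the last row where the counts agree to the left of column [k] and where no
    arc of [s'] into [k] has started. Comparing rows at height [q0] with
    columns at row [p0] shows that some head [y] in [k+1..p1] has its tail
    after [p0]; for the first such [y], the counts differ on all of the region
    needed to exchange [k] and [y]. *)
Lemma good_deletion_vanishing : good_deletion.
Proof.
apply: contrapT => bad; have km := k_range; have lk := s'k_lt; rewrite s'k in lk.
have [Fk _] := F k; have [_ Fl] := F (s k).
have exz : exists p, k <= p /\ exists2 q, q < s k & N p q = N' p q.
  apply: contrapT => none; apply: bad; apply: fits_bool => p q /andP[kp ql].
  have := leN p q; rewrite leq_eqVlt => /orP[/eqP e|//].
  by case: none; exists p; split=> //; exists q.
have [p1 [kp1 [q0 q0l p1q0]] p1min] := least_nat exz.
have pos p q : k <= p < p1 -> q < s k -> N p q < N' p q.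
  move=> /andP[kp pp1] ql; have := leN p q; rewrite leq_eqVlt => /orP[/eqP e|//].
  by case: (p1min p pp1); split=> //; exists q.
have kltp1 : k < p1.
  rewrite ltn_neqAle kp1 andbT; apply/eqP=> e.
  have := N_at_k q0; rewrite e p1q0 -e s'k; move: (N' _ _); clear -q0l; lia.
have tails y : k < y <= p1 -> y <= m -> t y = 0 -> s k < s y.
  move=> ky ym ty; rewrite ltnNge; apply/negP; rewrite leq_eqVlt => /orP[/eqP e|syk].
    have sk0 : s k != 0 by clear -lk; lia.
    by have := pattern_s_inj st sk0 e; clear -ky; lia.
  apply: (no_tail (y := y)); apply: swap_good => //; first by clear -ky; lia.
  by move=> p q kp /andP[_ ql]; apply: pos => //; clear -ky kp; lia.
pose low p := [/\ p <= m, N p k.-1 = N' p k.-1 & t' k = 0 \/ p < t' k].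
have base : low k.-1.
  split; first by clear -km; lia.
    by rewrite N_before //; clear -km; lia.
  have [_ Fk'] := F' k; case: Fk' => [|Fk']; first by left.
  right; rewrite ltnNge; apply/negP => t'k.
  have e : s (t' k) = k by rewrite agree; clear -Fk' t'k km; lia.
  have [Ft _] := F (t' k); rewrite e in Ft.
  by clear -Fk Ft km lk; lia.
have [p0 [p0m p0N p0t] p0max] : exists2 p, low p & forall i, p < i -> ~ low i.
  by apply: (@greatest_nat _ m) => [n []|] //; exists k.-1.
have kp0 : k.-1 <= p0 by rewrite leqNgt; apply/negP=> /p0max; apply.
have : exists y, [/\ k < y <= p1, y <= m & p0 < t y].
  apply: contrapT => none.
  have qk : k <= p1 by [].
  have := columns p0 qk; have := leN p0 p1; rewrite p0N.
  have := p1q0.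
  rewrite (corner_count_rows m s q0 qk) (corner_count_rows m s' q0 qk).
  have := N_at_k q0; rewrite s'k leq0n.
  have -> : (s k <= q0) = false by clear -q0l; lia.
  have -> : \sum_(1 <= i < m.+1) ((k < i <= p1) && (s i <= q0)) =
            \sum_(1 <= i < m.+1) ((k <= i <= p1) && (0 < t i <= p0)).
    apply: eq_big_nat => i im; have [_ Fi] := F i; have ti := tails i.
    case: (ltngtP i k) => [ik|ki|->]; first by clear -ik; lia.
      have nti : k < i <= p1 -> ~ p0 < t i.
        by move=> kip h; apply: none; exists i; split=> //; clear -im; lia.
      by clear -ki Fi ti nti q0l im; lia.
    by clear -Fk lk; lia.
  have : \sum_(1 <= i < m.+1) ((k <= i <= p1) && (0 < t' i <= p0)) <=
         \sum_(1 <= i < m.+1) ((k < i <= p1) && (s' i <= q0)).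
    apply: leq_sum_nat => i im; have [_ Fi] := F' i.
    case: (eqVneq i k) => [->|ik]; first by clear -p0t; lia.
    by clear -ik Fi; lia.
  move: (N _ _) (N _ _) (N' _ _) (N' _ _) (N' _ _).
  move: (\sum_(_ <= _ < _) _) (\sum_(_ <= _ < _) _) (\sum_(_ <= _ < _) _).
  by clear; lia.
case/least_nat => y [kyp1 ym p0y] ymin.
have [_ Fy] := F y.
have ty : t y <> 0 by clear -p0y; lia.
have kty : k <= t y by clear -kp0 p0y; lia.
have above p q : t y <= p -> k <= q < y -> N p q < N' p q.
  wlog pm : p / p <= m => [hw typ kq|].
    case: (leqP p m) => [pm|/ltnW mp]; first exact: hw.
    by rewrite (corner_count_sat s q mp) (corner_count_sat s' q mp); apply: hw => //; clear -Fy ty; lia.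
  move=> typ /andP[kq qy].
  have := columns p kq; have := columns p0 kq; have := leN p0 q; have := leN p k.-1.
  rewrite p0N.
  have -> : \sum_(1 <= z < m.+1) ((k <= z <= q) && (0 < t z <= p)) =
            \sum_(1 <= z < m.+1) ((k <= z <= q) && (0 < t z <= p0)).
    apply: eq_big_nat => z zm; case: (boolP (k <= z <= q)) => //= kz.
    case: (eqVneq z k) => [->|zk]; first by clear -Fk lk; lia.
    have : ~ p0 < t z.
      have zy : z < y by clear -kz qy; lia.
      by move=> h; apply: (ymin z zy); split=> //; clear -kz qy kyp1 zm zk; lia.
    by clear -typ p0y; lia.
  have : \sum_(1 <= z < m.+1) ((k <= z <= q) && (0 < t' z <= p0)) + (0 < t' k <= p) <=
         \sum_(1 <= z < m.+1) ((k <= z <= q) && (0 < t' z <= p)).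
    case: (boolP (0 < t' k <= p)) => t'k.
      rewrite addn1; apply: (leq_sum_strict km) => i im.
      case: (eqVneq i k) => [->|ik]; first by clear -p0t kq t'k; lia.
      by clear -p0y typ; lia.
    by rewrite addn0; apply: leq_sum_nat => i im; clear -p0y typ; lia.
  have : N p k.-1 = N' p k.-1 -> 0 < t' k <= p.
    move=> e; have p0p : p0 < p by clear -p0y typ; lia.
    rewrite -[_ <= _]negbK; apply/negP => h; apply: (p0max p p0p); split=> //.
    by clear -h; lia.
  move: (N _ _) (N' _ _) (N _ _) (N' _ _) (N _ _) (N' _ _).
  move: (\sum_(_ <= _ < _) _) (\sum_(_ <= _ < _) _) (\sum_(_ <= _ < _) _).
  by clear; lia.
have first p q : k <= p < y -> q < s k -> N p q < N' p q.
  by move=> kpy; apply: pos; clear -kyp1 kpy; lia.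
have Rgood : t y <> k -> ~ (t y < y /\ k < s k).
  move=> tyk [tyy ksk]; have [Fty _] := F (t y).
  have sky : s k < y.
    have := tails (t y); rewrite (_ : s (t y) = y); last by clear -Fy ty; lia.
    by apply; clear -Fty Fy ty kyp1 kty tyk tyy; lia.
  apply: (no_tail (y := s k)); split=> //; first by clear -Fk lk; lia.
  constructor 3; split=> //; apply: fits_bool => p q /and3P[kp ql].
  case: (ltnP p p1) => [pp1 _|p1p]; first by apply: pos => //; rewrite kp.
  case/orP=> [|kq]; first by clear -p1p sky kyp1; lia.
  by apply: above; clear -p1p sky kyp1 kq ql tyy; lia.
apply: (no_tail (y := y)); split=> //; first by clear -kyp1; lia.
case: (eqVneq (t y) k) => [tyk|/eqP tyk].
  have yl : y = s k by clear -Fy tyk ty; rewrite -tyk; lia.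
  constructor 3; split=> //; apply: fits_bool => p q /and3P[kp ql /orP[pl|kq]].
    by apply: first => //; rewrite yl kp.
  by apply: above; [rewrite tyk|rewrite yl kq].
constructor 2; split=> // p q; have h := Rgood tyk.
case: (boolP ((k <= p < y) && (q < s k))) => [/andP[kp ql]|_].
  have := first _ _ kp ql; move: (N _ _) (N' _ _); clear -h kp ql ty; lia.
case: (boolP ((t y <= p) && (k <= q < y))) => [/andP[typ kq]|_].
  by rewrite add0n addn1; apply: above.
by rewrite !addn0.
Qed.

End Vanishing.
End Chain.

Section Step.
Variables (m : nat) (s t s' t' : nat -> nat).
Hypothesis st : link_pattern m s t.
Hypothesis st' : link_pattern m s' t'.
Hypothesis leN : forall p q, corner_count m s p q <= corner_count m s' p q.

Local Notation F := (pattern_facts st).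

(** The nearest exchangeable label is used, so that a label violating the
    hypotheses of the codimension lemmas would be exchangeable itself and
    nearer: its region is contained in the region of the chosen move. *)
Lemma move_below : (exists i, s i <> s' i) ->
  exists u v, [/\ elementary_move m s t u v,
    forall p q, corner_count m u p q <= corner_count m s' p q
    & end_count m u v = (end_count m s t).+1].
Proof.
case/least_nat => k differ kmin.
have agree i : i < k -> s i = s' i by move=> /kmin /contrapT.
have km := k_range st st' differ.
have sk : s k != 0 by have := s'k_lt st st' leN agree differ; lia.
have [Fk _] := F k; have [_ Fsk] := F (s k).
pose fits := fits m s s'.
case: (pselect (exists y, good_tail m s t s' k y)) => [|no_tail].
  case/least_nat => y [ky ym [[ty syk fy]|[ty tyk fy]|[yl fy]]] ymin.
  - pose u i := if i == k then s y else if i == y then s k else s i.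
    pose v z := if z == 0 then 0 else if z == s k then y else if z == s y then k else t z.
    exists u, v; split; first by apply: (@SwapTails _ _ _ _ _ k y).
      by move=> p q; rewrite (corner_count_swap_tails st p q ky ym syk (u := u)).
    apply: (end_count_swap_tails st ky ym ty syk) => // z /andP[kz zy] tz.
    case: (ltnP (s z) (s y)) => syz; first by left.
    right; rewrite ltnNge leq_eqVlt; apply/negP => /orP[/eqP/(pattern_s_inj st sk)|szk]; first by lia.
    apply: (ymin z zy); split=> //; first by clear -zy ym; lia.
    by constructor 1; split=> //; apply: fits_sub fy _ => p q; clear -zy syz; lia.
  - pose u i := if i == k then 0 else if i == y then s k else if i == t y then k else s i.
    pose v z := if z == y then 0 else if z == k then t y else if z == s k then y else t z.
    have ty0 : t y != 0 by apply/eqP.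
    have tyk0 : t y != k by apply/eqP.
    have kty : k < t y.
      rewrite ltn_neqAle eq_sym tyk0 leqNgt; apply/negP => tk.
      by have := fy (t y) k; rewrite (N_before m agree differ k tk); clear -ky; lia.
    have freeT z : k < z < y -> t z = 0 -> s k < s z.
      move=> /andP[kz zy] tz; rewrite ltnNge leq_eqVlt; apply/negP => /orP[/eqP/(pattern_s_inj st sk)|szk]; first by lia.
      apply: (ymin z zy); split=> //; first by clear -zy ym; lia.
      by constructor 1; split=> //; apply: fits_sub fy _ => p q; clear -zy; lia.
    have over1 : ~~ [&& t y < y, k < s k & s k < y].
      apply/and3P=> -[tyy ksk sky]; apply: (ymin _ sky); split=> //; first by clear -sky ym; lia.
      by constructor 3; split=> //; apply: fits_sub fy _ => p q; clear -tyy ksk sky; lia.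
    exists u, v; split; first by apply: (@SwapTailHead _ _ _ _ _ k y).
      by move=> p q; rewrite (corner_count_swap_tail_head st p q ky sk ty0 tyk0 (u := u)) // -addnA.
    apply: (end_count_swap_tail_head st ky sk ty0 tyk0 (u := u)) => //.
      move=> z /andP[kz zy] tz; rewrite ltnNge; apply/negP => tyz.
      apply: (ymin z zy); split=> //; first by clear -zy ym; lia.
      constructor 2; split=> //; first by clear -tyz kty; lia.
      by apply: fits_sub fy _ => p q; clear -zy tyz; lia.
    apply/and3P=> -[_ tyy ksk].
    have [_ Fy] := F y; have [Fty _] := F (t y).
    have := freeT (t y); rewrite (_ : s (t y) = y); last by clear -Fy ty; lia.
    by move: over1; clear -Fty Fy ty kty tyy ksk; lia.
  - pose u i := if i == k then 0 else if i == s k then k else s i.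
    pose v z := if z == k then s k else if z == s k then 0 else t z.
    rewrite yl in ky ym ymin.
    exists u, v; split; first by apply: (@Reverse _ _ _ _ _ k).
      by move=> p q; rewrite (corner_count_reverse st p q sk ky (u := u)).
    apply: (end_count_reverse st sk ky (u := u)) => // z /andP[kz zl] tz.
      rewrite ltnNge leq_eqVlt; apply/negP => /orP[/eqP/(pattern_s_inj st sk)|szk]; first by lia.
      apply: (ymin z zl); split=> //; first by clear -zl ym; lia.
      by constructor 1; split=> //; apply: fits_sub fy _ => p q; clear -zl; lia.
    rewrite ltnNge; apply/negP => ltz; have [_ Fz] := F z.
    apply: (ymin z zl); split=> //; first by clear -zl ym; lia.
    constructor 2; split=> //; first by move=> e; rewrite e in Fz; clear -Fz zl km; lia.
    by apply: fits_sub fy _ => p q; clear -zl ltz; lia.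
have {}no_tail y : ~ good_tail m s t s' k y by move=> h; apply: no_tail; exists y.
have early i : k < i -> i <= m -> t i = 0 -> s i < s k ->
    ~ fits (fun p q => (k <= p < i) && (s i <= q < s k)).
  by move=> ki im ti sik fi; apply: (no_tail i); split=> //; constructor 1.
case: (pselect (exists z, good_head m s t s' k z)) => [|no_head].
  case/(@greatest_nat _ (s k)) => [z [_ /ltnW] //|z [z0 zl zk [[sz tz fz]|[sz fz]]] zmax].
  - pose u i := if i == k then z else s i.
    pose v i := if i == z then k else if i == s k then 0 else t i.
    exists u, v; split; first by apply: (@LowerHead _ _ _ _ _ k z).
      by move=> p q; rewrite (corner_count_lower_head st p q zl (u := u)).
    apply: (end_count_lower_head st z0 zl sz tz (u := u)) => // [i ki|w /andP[zw wl]].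
      have [Fi _] := F i.
      case: (ltnP (s i) z) => siz; first by left.
      right; rewrite ltnNge leq_eqVlt; apply/negP => /orP[/eqP/(pattern_s_inj st sk)|sik]; first by lia.
      apply: (early i ki) => //; try by clear -Fi siz z0; lia.
      by apply: fits_sub fz _ => p q; clear -siz; lia.
    apply: contrapT => /not_orP[/contrapT sw /contrapT tw].
    apply: (zmax w zw); split=> //; first by clear -zw; lia.
      by move=> e; rewrite e in sw; clear -sw sk; lia.
    by constructor 1; split=> //; apply: fits_sub fz _ => p q; clear -zw; lia.
  - have [_ Fz] := F z.
    have kz : k < z.
      rewrite ltn_neqAle eq_sym (introN eqP zk) leqNgt; apply/negP => tk.
      have := fz z 0; rewrite (N_before m agree differ 0 tk); clear -sz zl; lia.
    have tl : t (s k) = k by clear -Fk sk; lia.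
    have tl0 : t (s k) != 0 by rewrite tl; clear -km; lia.
    have tlz : t (s k) != z by rewrite tl eq_sym; apply/eqP.
    have sz0 : s z != 0 by apply/eqP.
    pose u i := if i == z then 0 else if i == s k then s z else if i == t (s k) then z else s i.
    pose v i := if i == s k then 0 else if i == z then t (s k) else if i == s z then s k else t i.
    exists u, v; split; first by apply: (@SwapTailHead _ _ _ _ _ z (s k)).
      by move=> p q; rewrite (corner_count_swap_tail_head st p q zl sz0 tl0 tlz (u := u)) // -addnA tl.
    apply: (end_count_swap_tail_head st zl sz0 tl0 tlz (u := u)) => //.
    + move=> w /andP[zw wl] tw; rewrite ltnNge leq_eqVlt; apply/negP => /orP[/eqP/(pattern_s_inj st sz0)|swz].
        by clear -zw; lia.
      apply: (zmax w zw); split; try by clear -zw kz wl; lia.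
      case: (eqVneq (s w) 0) => [sw|/eqP sw].
        by constructor 1; split=> //; apply: fits_sub fz _ => p q; clear -zw; lia.
      by constructor 2; split=> //; apply: fits_sub fz _ => p q; clear -zw swz; lia.
    + move=> w /andP[zw wl] tw; rewrite tl; have [_ Fw] := F w; have [Ftw _] := F (t w).
      rewrite ltnNge leq_eqVlt; apply/negP => /orP[/eqP e|ktw].
        by rewrite -e in Fw; clear -Fw e tw wl sk; lia.
      apply: (early (t w) ktw); try by clear -Fw Ftw tw wl; lia.
      by apply: fits_sub fz _ => p q; clear -Fw tw zw; lia.
    + apply/and3P => -[_ zsz szk]; apply: (early z kz); try by clear -Fz sz szk; lia.
        by have [Fz' _] := F z; clear -Fz' sz; lia.
      by apply: fits_sub fz _ => p q; clear -zsz; lia.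
    + by rewrite tl; apply/and3P => -[]; clear -kz; lia.
have {}no_head z : ~ good_head m s t s' k z by move=> h; apply: no_head; exists z.
have fD : good_deletion m s s' k.
  case: (posnP (s' k)) => s'k; first exact: (good_deletion_vanishing st st' leN agree differ).
  by have [z /no_head] := good_head_exists st st' leN agree differ s'k no_tail.
have lk : s k < k.
  rewrite ltnNge leq_eqVlt; apply/negP => /orP[/eqP e|kl].
    by rewrite -e in Fk; clear -Fk km; lia.
  apply: (no_tail (s k)); split=> //; first by clear -Fk sk; lia.
  by constructor 3; split=> //; apply: fits_sub fD _ => p q; clear; lia.
pose u i := if i == k then 0 else s i.
pose v i := if i == s k then 0 else t i.
exists u, v; split; first by apply: (@Delete _ _ _ _ _ k).
  by move=> p q; rewrite (corner_count_delete st p q sk (u := u)).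
apply: (end_count_delete st sk lk (u := u)) => // [i ki im ti|w /andP[w0 wl]].
  rewrite ltnNge leq_eqVlt; apply/negP => /orP[/eqP/(pattern_s_inj st sk)|sik]; first by lia.
  by apply: (early i ki) => //; apply: fits_sub fD _ => p q; clear; lia.
apply: contrapT => /not_orP[/contrapT sw /contrapT tw].
apply: (no_head w); split=> //.
  by move=> e; rewrite e in sw; clear -sw sk; lia.
by constructor 1; split=> //; apply: fits_sub fD _ => p q; clear; lia.
Qed.
End Step.

Local Open Scope ring_scope.

Local Notation coord := Defs.coord.
Local Notation Hom := Defs.Hom.

(** * Normal form of a square-zero matrix on a flag *)

Section Labels.
Variables (K : fieldType) (m : nat).

(** The basis vector of a label, zero for the labels [0] and [x > m]. *)
Definition label (x : nat) : 'rV[K]_m := \row_b (x == b.+1)%:R.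
Definition of_rows (r : nat -> 'rV[K]_m) : 'M[K]_m := \matrix_a r a.+1.
Definition pattern_mx (s : nat -> nat) : 'M[K]_m := of_rows (fun x => label (s x)).

Definition in_flag (v : 'rV[K]_m) (j : nat) : Prop := forall b : 'I_m, (j <= b)%N -> v 0 b = 0.

Lemma label0 : label 0 = 0.
Proof. by apply/rowP => b; rewrite !mxE. Qed.

Lemma label_out x : (m < x)%N -> label x = 0.
Proof. by move=> mx; apply/rowP => b; rewrite !mxE; case: eqP => // e; have := ltn_ord b; lia. Qed.

Lemma row_label (a : 'I_m) (A : 'M[K]_m) : label a.+1 *m A = row a A.
Proof.
rewrite rowE; congr (_ *m _); apply/rowP => b.
by rewrite !mxE eqSS eq_sym -val_eqE.
Qed.

Lemma label_mul x r : (0 < x <= m)%N -> label x *m of_rows r = r x.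
Proof.
case: x => // x xm; rewrite (row_label (Ordinal (_ : x < m)%N)).
by apply/rowP => b; rewrite !mxE.
Qed.

Lemma label_ext (A B : 'M[K]_m) :
  (forall x, (0 < x <= m)%N -> label x *m A = label x *m B) -> A = B.
Proof.
move=> AB; apply/row_matrixP => a; rewrite -!row_label; apply: AB.
by rewrite /= ltn_ord.
Qed.

Lemma label_pattern s x : s 0%N = 0%N -> (x <= m)%N -> label x *m pattern_mx s = label (s x).
Proof.
move=> s0 xm; case: (posnP x) => [->|x0]; first by rewrite label0 mul0mx s0 label0.
by rewrite label_mul // x0.
Qed.

Lemma pattern_le s t x : link_pattern m s t -> (s x <= m)%N.
Proof. by move=> st; have [Fx _] := pattern_facts st x; lia. Qed.

Lemma pattern_0 s t : link_pattern m s t -> s 0%N = 0%N.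
Proof. by move=> st; have [Fx _] := pattern_facts st 0%N; lia. Qed.

Lemma pattern_sq0 s t : link_pattern m s t -> pattern_mx s *m pattern_mx s = 0.
Proof.
move=> st; apply: label_ext => x xm; rewrite mulmxA mulmx0.
have s0 := pattern_0 st; have sxm := pattern_le x st.
rewrite !label_pattern //; last by lia.
suff -> : s (s x) = 0%N by rewrite label0.
case: (eqVneq (s x) 0%N) => [->//|sx].
by have [Fx _] := pattern_facts st x; have [_ Fsx] := pattern_facts st (s x); lia.
Qed.

Lemma in_flagW v i j : (i <= j)%N -> in_flag v i -> in_flag v j.
Proof. by move=> ij vi b jb; apply: vi; apply: leq_trans jb. Qed.

Lemma in_flag_full v : in_flag v m.
Proof. by move=> b; rewrite leqNgt ltn_ord. Qed.

Lemma in_flag0 v : in_flag v 0 -> v = 0.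
Proof. by move=> v0; apply/rowP => b; rewrite mxE v0. Qed.

Lemma in_flagD u v j : in_flag u j -> in_flag v j -> in_flag (u + v) j.
Proof. by move=> uj vj b jb; rewrite mxE uj // vj // addr0. Qed.

Lemma in_flagZ c v j : in_flag v j -> in_flag (c *: v) j.
Proof. by move=> vj b jb; rewrite mxE vj // mulr0. Qed.

Lemma in_flag_label x : in_flag (label x) x.
Proof. by move=> b xb; rewrite mxE; case: eqP => // e; lia. Qed.

(** Vectors of the [i]-th step whose coefficient at the last label of this
    step is one. *)
Definition monic_at (v : 'rV[K]_m) i := in_flag (v - label i) i.-1.

Lemma monic_in_flag v i : monic_at v i -> in_flag v i.
Proof.
move=> vi; rewrite -(subrK (label i) v); apply: in_flagD; last exact: in_flag_label.
exact: in_flagW (leq_pred i) vi.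
Qed.

Lemma leading_label w j : in_flag w j -> ~ in_flag w j.-1 ->
  exists2 c, c != 0 & in_flag (w - c *: label j) j.-1.
Proof.
case: j => // j wj nwj.
have jm : (j < m)%N.
  by rewrite ltnNge; apply/negP => mj; apply: nwj => b /=; have := ltn_ord b; lia.
pose a := Ordinal jm; exists (w 0 a).
  apply/eqP => wa; apply: nwj => b /= jb.
  case: (eqVneq (b : nat) j) => [e|ne]; last by apply: wj; lia.
  by rewrite -wa; congr (w 0 _); apply: val_inj.
move=> b /= jb; rewrite !mxE eqSS.
case: (eqVneq (b : nat) j) => [e|ne].
  rewrite mulr1; apply/eqP; rewrite subr_eq0; apply/eqP.
  by congr (w 0 _); apply: val_inj.
by rewrite mulr0 subr0; apply: wj; lia.
Qed.

Variable L : 'M[K]_m.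
Hypothesis LL : L *m L = 0.

(** The lowest step of the flag that [L] can reach from a vector of exact
    height [i] defines the arcs of the pattern of [L]. *)
Lemma lowest_image :
  exists s v, [/\ forall i, ~~ (0 < i <= m)%N -> s i = 0%N,
    forall i, (0 < i <= m)%N -> [/\ monic_at (v i) i, in_flag (v i *m L) (s i) & (s i <= m)%N]
    & forall i w, (0 < i <= m)%N -> monic_at w i -> ~ in_flag (w *m L) (s i).-1 \/ s i = 0%N].
Proof.
pose P i (jv : nat * 'rV[K]_m) := if (0 < i <= m)%N then
    [/\ monic_at jv.2 i, in_flag (jv.2 *m L) jv.1, (jv.1 <= m)%N
      & forall w, monic_at w i -> ~ in_flag (w *m L) jv.1.-1 \/ jv.1 = 0%N]
  else jv.1 = 0%N.
have /choice[f fP] : forall i, exists jv, P i jv.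
  move=> i; rewrite /P; case: (boolP (0 < i <= m)%N) => im; last by exists (0%N, 0).
  have [|j [v [vi vj]] jmin] := @least_nat (fun j => exists v : 'rV[K]_m, monic_at v i /\ in_flag (v *m L) j).
    exists m, (label i); split; last exact: in_flag_full.
    by move=> b _; rewrite subrr mxE.
  exists (j, v); split=> //=.
    rewrite leqNgt; apply/negP => /jmin; apply.
    by exists v; split=> //; apply: in_flag_full.
  move=> w wi; case: (posnP j) => [|j0]; [by right|left] => wj.
  by apply: (jmin j.-1); [lia | exists w].
exists (fun i => (f i).1), (fun i => (f i).2).
split=> [i /negPf im|i im|i w im]; have := fP i; rewrite /P im //; case=> // _ _ _.
exact.
Qed.

(** Let [s i] be the lowest step that contains the image of a vector of exact
    height [i], and [v i] such a vector. Two arcs with the same head would let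
    one lower the image of the higher vector by subtracting a multiple of the
    other, and a head is the height of a vector killed by [L]; so [s] is a
    link pattern. The adapted basis consists of the vectors [v i] for the
    labels that are not heads and of their images. *)
Lemma normal_form : exists s t (h : 'M[K]_m), [/\ link_pattern m s t,
  forall a b : 'I_m, (a < b)%N -> h a b = 0, forall a, h a a != 0
  & h *m L = pattern_mx s *m h].
Proof.
have [s [v [s_out sv smin]]] := lowest_image.
have s_in i : s i != 0%N -> (0 < i <= m)%N.
  by move=> si; apply/negPn/negP => /s_out; lia.
have top i : s i != 0%N -> exists2 c, c != 0 & in_flag (v i *m L - c *: label (s i)) (s i).-1.
  move=> si; have im := s_in _ si; have [vi vLi _] := sv i im.
  apply: leading_label => //; have [//|e] := smin i (v i) im vi.
  by rewrite e in si.
have s_inj i j : s i != 0%N -> s i = s j -> i = j.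
  wlog ij : i j / (i < j)%N => [H si e|].
    case: (ltngtP i j) => // ij; first exact: H.
    by apply/esym/H => //; rewrite -e.
  move=> si e; have sj : s j != 0%N by rewrite -e.
  have [ci ci0 Hi] := top i si; have [cj cj0 Hj] := top j sj.
  have im := s_in i si; have jm := s_in j sj.
  have [vi _ _] := sv i im; have [vj _ _] := sv j jm.
  have [] := smin j (v j - (cj / ci) *: v i) jm; last by move=> e'; rewrite e' in sj.
    rewrite /monic_at addrAC; apply: in_flagD => //.
    by rewrite -scaleNr; apply: in_flagZ; apply: in_flagW (monic_in_flag vi); lia.
  case; rewrite mulmxBl -scalemxAl.
  rewrite (_ : _ - _ = (v j *m L - cj *: label (s j)) - (cj / ci) *: (v i *m L - ci *: label (s i))).
    apply: in_flagD => //; rewrite -scaleNr; apply: in_flagZ; by rewrite -e.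
  by rewrite scalerBr scalerA divfK // e opprB addrA subrK.
have s_nil i : s i != 0%N -> s (s i) = 0%N.
  move=> si; have [c c0 Hi] := top i si; have im := s_in i si.
  have [_ _ sim] := sv i im.
  have sm : (0 < s i <= m)%N by lia.
  have [] // := smin (s i) (c^-1 *: (v i *m L)) sm.
    rewrite /monic_at (_ : _ - _ = c^-1 *: (v i *m L - c *: label (s i))); first exact: in_flagZ.
    by rewrite scalerBr scalerA mulVf // scale1r.
  by rewrite -scalemxAl -mulmxA LL mulmx0 scaler0; case=> b _; rewrite mxE.
pose t (j : nat) : nat := if j == 0%N then 0%N else (\sum_(1 <= i < m.+1) (s i == j) * i)%N.
have tsK i : s i != 0%N -> t (s i) = i.
  move=> si; rewrite /t (negPf si) (@sum_le1 _ _ i) ?eqxx ?mul1n //; first exact: s_in.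
  by move=> j _ ji; case: eqP => // e; case/eqP: ji; apply/esym/s_inj.
have stK j : t j != 0%N -> s (t j) = j /\ j != 0%N.
  rewrite /t; case: (eqVneq j 0%N) => // j0.
  case: (pselect (exists i, s i = j)) => [[i e]|none].
    have si : s i != 0%N by rewrite e.
    by have := tsK i si; rewrite e /t (negPf j0) => ->.
  rewrite big1 // => i _; case: eqP => // e; by case: none; exists i.
have st : link_pattern m s t.
  split.
  - move=> i si; have im := s_in i si; have [_ _ sim] := sv i im.
    by apply/and4P; split; lia.
  - exact: tsK.
  - by move=> j /stK[-> ?]; lia.
  - move=> i si; apply/eqP/negPn/negP => /stK[e _].
    have ti : s (t i) != 0%N by have := s_in i si; lia.
    by have := s_nil _ ti; rewrite e; lia.
pose r x := if t x == 0%N then v x else v (t x) *m L.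
exists s, t, (of_rows r).
have rlead x : (0 < x <= m)%N -> exists2 c, c != 0 & in_flag (r x - c *: label x) x.-1.
  move=> xm; rewrite /r; case: (eqVneq (t x) 0%N) => tx.
    by exists 1; [exact: oner_neq0 | rewrite scale1r; have [] := sv x xm].
  have [e _] := stK x tx; have stx : s (t x) != 0%N by lia.
  by have [c c0] := top _ stx; rewrite e => H; exists c.
split=> // [a b ab|a|].
- have am : (0 < a.+1 <= m)%N by rewrite /= ltn_ord.
  have [c c0 /(_ b)] := rlead a.+1 am; rewrite !mxE => /(_ (ltnW ab)).
  have -> : (a.+1 == b.+1)%N = false by lia.
  by rewrite mulr0 subr0.
- have am : (0 < a.+1 <= m)%N by rewrite /= ltn_ord.
  have [c c0 /(_ a)] := rlead a.+1 am; rewrite !mxE => /(_ (leqnn _)).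
  by rewrite eqxx mulr1 => /eqP; rewrite subr_eq0 => /eqP ->.
apply: label_ext => x xm; rewrite !mulmxA label_mul // label_pattern ?(pattern_0 st) //; last by lia.
rewrite /r; case: (eqVneq (t x) 0%N) => tx; last first.
  by rewrite -mulmxA LL mulmx0 (pattern_s0 st tx) label0 mul0mx.
case: (eqVneq (s x) 0%N) => sx.
  rewrite sx label0 mul0mx; apply: in_flag0; have [_ H _] := sv x xm.
  by rewrite sx in H.
have [_ _ sxm] := sv x xm.
rewrite label_mul; last by lia.
by rewrite tsK //; case: eqP => //; lia.
Qed.

End Labels.

(** * Polynomial functions and semicontinuity *)

Section PolynomialFunctions.
Variables (K : fieldType) (n : nat).
Implicit Types d e : dimvec n.

Definition polyfun d (F : rep K d -> K) : Prop :=
  exists p : {mpoly K[#|coord d|]}, forall N, peval p N = F N.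

Lemma polyfun_ext d (F G : rep K d -> K) : F =1 G -> polyfun F -> polyfun G.
Proof. by move=> FG [p pF]; exists p => N; rewrite pF. Qed.

Lemma polyfun_const d (c : K) : polyfun (fun _ : rep K d => c).
Proof. by exists c%:MP => N; rewrite /peval mevalC. Qed.

Lemma polyfun_coord d (c : coord d) : polyfun (fun N => coordinate N c).
Proof. by exists 'X_(enum_rank c) => N; rewrite /peval mevalXU enum_rankK. Qed.

Lemma polyfunD d (F G : rep K d -> K) :
  polyfun F -> polyfun G -> polyfun (fun N => F N + G N).
Proof. by move=> [p pF] [q qG]; exists (p + q) => N; rewrite /peval mevalD -pF -qG. Qed.

Lemma polyfunM d (F G : rep K d -> K) :
  polyfun F -> polyfun G -> polyfun (fun N => F N * G N).
Proof. by move=> [p pF] [q qG]; exists (p * q) => N; rewrite /peval mevalM -pF -qG. Qed.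

Lemma polyfun_sum d (I : Type) (r : seq I) (P : pred I) (F : I -> rep K d -> K) :
  (forall i, polyfun (F i)) -> polyfun (fun N => \sum_(i <- r | P i) F i N).
Proof.
move=> HF; elim: r => [|i r IH].
  by apply: polyfun_ext (polyfun_const _ 0) => N; rewrite big_nil.
case: (boolP (P i)) => Pi.
  by apply: polyfun_ext (polyfunD (HF i) IH) => N; rewrite big_cons Pi.
by apply: polyfun_ext IH => N; rewrite big_cons (negPf Pi).
Qed.

Lemma polyfun_prod d (I : Type) (r : seq I) (P : pred I) (F : I -> rep K d -> K) :
  (forall i, polyfun (F i)) -> polyfun (fun N => \prod_(i <- r | P i) F i N).
Proof.
move=> HF; elim: r => [|i r IH].
  by apply: polyfun_ext (polyfun_const _ 1) => N; rewrite big_nil.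
case: (boolP (P i)) => Pi.
  by apply: polyfun_ext (polyfunM (HF i) IH) => N; rewrite big_cons Pi.
by apply: polyfun_ext IH => N; rewrite big_cons (negPf Pi).
Qed.

Lemma polyfun_exp d (F : rep K d -> K) k : polyfun F -> polyfun (fun N => F N ^+ k).
Proof.
move=> HF; have := @polyfun_prod d _ (index_enum 'I_k) predT (fun _ => F) (fun _ => HF).
by apply: polyfun_ext => N; rewrite big_const_ord iter_mulr_1.
Qed.

Lemma polyfun_det d k (A : rep K d -> 'M[K]_k) :
  (forall i j, polyfun (fun N => A N i j)) -> polyfun (fun N => \det (A N)).
Proof.
move=> HA; apply: polyfun_sum => s; apply: polyfunM; first exact: polyfun_const.
by apply: polyfun_prod => i; apply: HA.
Qed.

Lemma polyfun_mulmx d k l p (A : rep K d -> 'M[K]_(k, l)) (B : rep K d -> 'M[K]_(l, p)) :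
  (forall i j, polyfun (fun N => A N i j)) ->
  (forall i j, polyfun (fun N => B N i j)) ->
  forall i j, polyfun (fun N => (A N *m B N) i j).
Proof.
move=> HA HB i j; apply: (@polyfun_ext _ (fun N => \sum_k A N i k * B N k j)).
  by move=> N; rewrite mxE.
by apply: polyfun_sum => r; apply: polyfunM.
Qed.

Lemma polyfun_arrow d i a b : polyfun (fun N : rep K d => arrow N i a b).
Proof.
exact: (polyfun_coord (inl (Tagged (fun i => ('I_(d (src i)) * 'I_(d (tgt i)))%type) (a, b)) : coord d)).
Qed.

Lemma polyfun_loop d a b : polyfun (fun N : rep K d => loop N a b).
Proof. exact: (polyfun_coord (inr (a, b) : coord d)). Qed.

Lemma polyfun_comp d e (F : rep K d -> rep K e) (p : {mpoly K[#|coord e|]}) :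
  (forall c, polyfun (fun N => coordinate (F N) c)) ->
  polyfun (fun N => peval p (F N)).
Proof.
move=> HF; apply: (@polyfun_ext _
  (fun N => \sum_(k <- msupp p) p@_k * \prod_i coordinate (F N) (enum_val i) ^+ k i)).
  by move=> N; rewrite /peval mevalE.
apply: polyfun_sum => k; apply: polyfunM; first exact: polyfun_const.
by apply: polyfun_prod => i; apply: polyfun_exp.
Qed.

Lemma closure_test d (S : rep K d -> Prop) M (F : rep K d -> K) :
  zariski_closure S M -> polyfun F -> F M != 0 -> exists2 N, S N & F N != 0.
Proof.
move=> cM [p pF] FM; apply: contrapT => none.
move: FM; rewrite -pF cM ?eqxx // => N SN; rewrite pF; apply/eqP.
by apply: contrapT => /negP FN; apply: none; exists N.
Qed.

(** Upper semicontinuity of the dimension of a kernel: a minor that does not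
    vanish at a limit point does not vanish at some point of the set either. *)
Lemma kernel_semicontinuous d (S : rep K d -> Prop) M (V : vectType K) (T : finType)
    (Phi : rep K d -> V -> T -> K) (Z : rep K d -> {vspace V}) :
    (forall N x, linear_for *%R (fun v => Phi N v x)) ->
    (forall v x, polyfun (fun N => Phi N v x)) ->
    (forall N v, v \in Z N <-> forall x, Phi N v x = 0) ->
  zariski_closure S M -> exists2 N, S N & (\dim (Z N) <= \dim (Z M))%N.
Proof.
move=> linP polP ZP cM.
pose U := (Z M)^C%VS; pose u := vbasis U.
pose A N := \matrix_(i < \dim U, j < #|T|) Phi N u`_i (enum_val j).
have PhiE N (c : 'rV_(\dim U)) x :
    Phi N (\sum_i c 0 i *: u`_i) x = (c *m A N) 0 (enum_rank x).
  rewrite mxE.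
  pose f v := Phi N v x.
  have fl : linear_for *%R f by exact: linP.
  pose fL : {linear V -> K | *%R} := HB.pack f (GRing.isLinear.Build K V K *%R f fl).
  rewrite -[Phi N _ x]/(fL _) linear_sum; apply: eq_bigr => i _.
  by rewrite linearZ /= mxE enum_rankK.
have freeA : row_free (A M).
  apply: inj_row_free => c cA.
  pose w := \sum_i c 0 i *: u`_i.
  have wU : w \in U.
    by apply: memv_suml => i _; apply: memvZ; apply: vbasis_mem; rewrite mem_nth ?size_tuple.
  have wZ : w \in Z M by apply/ZP => x; rewrite PhiE cA mxE.
  have w0 : w = 0.
    by apply/eqP; rewrite -memv0 -(capv_compl (Z M)) memv_cap wZ.
  have /freeP fr := basis_free (vbasisP U).
  by apply/rowP => i; rewrite mxE; exact: (fr (fun i => c 0 i) w0).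
have /row_freeP[B AB] := freeA.
have polA : polyfun (fun N => \det (A N *m B)).
  apply: polyfun_det; apply: (@polyfun_mulmx _ _ _ _ A (fun _ => B)).
    by move=> i j; apply: polyfun_ext (polP u`_i (enum_val j)) => N; rewrite mxE.
  by move=> i j; apply: polyfun_const.
have [|N SN detN] := closure_test cM polA; first by rewrite AB det1 oner_eq0.
exists N => //.
have cap0 : (Z N :&: U = 0)%VS.
  apply/eqP; rewrite -subv0; apply/subvP => w; rewrite memv_cap memv0 => /andP[wZ wU].
  have wE := coord_vbasis wU; rewrite -/u in wE.
  pose c := \row_i vector.coord u i w.
  have wE' : w = \sum_i c 0 i *: u`_i by rewrite {1}wE; apply: eq_bigr => i _; rewrite mxE.
  have cA : c *m A N = 0.
    apply/rowP => j; rewrite -(enum_valK j) -PhiE -wE' mxE.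
    by have /ZP -> := wZ.
  have uAB : A N *m B \in unitmx by rewrite unitmxE unitfE.
  have c0 : c = 0 by apply: (can_inj (mulmxK uAB)); rewrite mulmxA cA !mul0mx.
  by rewrite wE' big1 // => i _; rewrite c0 mxE scale0r.
have := dimvS (subvf (Z N + U)%VS); rewrite dimv_disjoint_sum // dimv_compl.
have := dimvS (subvf (Z M)); move: (\dim _) (\dim _) (\dim _) => a b c.
by lia.
Qed.

End PolynomialFunctions.

(** * Morphisms and direct sums *)

Section Homs.
Variables (K : fieldType) (n : nat).
Implicit Types d e f : dimvec n.

Definition fam_of d e (h : forall i, 'M[K]_(d i, e i)) : mxfam K d e :=
  [ffun x => h (tag x) (tagged x).1 (tagged x).2].

Lemma fam_ofK d e (h : forall i, 'M[K]_(d i, e i)) i : fam_mx (fam_of h) i = h i.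
Proof. by apply/matrixP=> a b; rewrite mxE ffunE. Qed.

Lemma fam_mx_inj d e (g h : mxfam K d e) : (forall i, fam_mx g i = fam_mx h i) -> g = h.
Proof.
move=> gh; apply/ffunP => -[i [a b]].
by have /matrixP/(_ a b) := gh i; rewrite !mxE.
Qed.

Lemma fam_mx0 d e i : fam_mx (0 : mxfam K d e) i = 0.
Proof. by apply/matrixP => a b; rewrite !mxE ffunE. Qed.

(** Dimensions of morphism spaces are compared throughout by maps that are
    injective on one space and carry it into the other. *)
Lemma dim_le_inj (V W : vectType K) (f : {linear V -> W}) (A : {vspace V}) (B : {vspace W}) :
    (forall v, v \in A -> f v \in B) ->
    (forall v, v \in A -> f v = 0 -> v = 0) -> (\dim A <= \dim B)%N.
Proof.
move=> fAB f0; have := limg_ker_dim (linfun f) A.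
have -> : (A :&: lker (linfun f) = 0)%VS.
  apply/eqP; rewrite -subv0; apply/subvP => v; rewrite memv_cap memv_ker lfunE memv0.
  by case/andP => vA /eqP /(f0 _ vA) ->.
rewrite dimv0 add0n => <-; apply: dimvS; apply/subvP => w /memv_imgP[v vA ->].
by rewrite lfunE; apply: fAB.
Qed.

(** Composition on both sides with families of matrices: this covers the
    transport along isomorphisms and the components of maps between direct
    sums. *)
Definition sandwich d e d' e' (P : forall i, 'M[K]_(d' i, d i)) (Q : forall i, 'M[K]_(e i, e' i))
  (g : mxfam K d e) : mxfam K d' e' := fam_of (fun i => P i *m fam_mx g i *m Q i).

Lemma sandwich_linear d e d' e' P Q : linear (@sandwich d e d' e' P Q).
Proof.
move=> a g h; apply: fam_mx_inj => i.
by rewrite fam_mx_linear !fam_ofK fam_mx_linear mulmxDr mulmxDl -scalemxAr -scalemxAl.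
Qed.

HB.instance Definition _ d e d' e' P Q :=
  GRing.isLinear.Build K (mxfam K d e) (mxfam K d' e') _ (@sandwich d e d' e' P Q)
    (sandwich_linear P Q).

Lemma is_hom_ext d e (M : rep K d) (N : rep K e) g h :
  (forall i, g i = h i) -> is_hom M N g -> is_hom M N h.
Proof. by move=> gh [ga gl]; split=> [i|]; rewrite -!gh. Qed.

Lemma is_hom_comp d e f (M : rep K d) (N : rep K e) (L : rep K f) g h :
  is_hom M N g -> is_hom N L h -> is_hom M L (fun i => g i *m h i).
Proof.
move=> [ga gl] [ha hl]; split=> [i|]; first by rewrite mulmxA ga -mulmxA ha mulmxA.
by rewrite mulmxA gl -mulmxA hl mulmxA.
Qed.

Lemma is_hom1 d (M : rep K d) : is_hom M M (fun i => 1%:M).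
Proof. by split=> [i|]; rewrite mulmx1 mul1mx. Qed.

Lemma iso_refl d (M : rep K d) : iso M M.
Proof.
exists (fun i => 1%:M), (fun i => 1%:M); split; try exact: is_hom1.
all: by move=> i; rewrite mulmx1.
Qed.

Lemma iso_sym d e (M : rep K d) (N : rep K e) : iso M N -> iso N M.
Proof. by move=> [h [k [? ? ? ?]]]; exists k, h. Qed.

Lemma iso_trans d e f (M : rep K d) (N : rep K e) (L : rep K f) :
  iso M N -> iso N L -> iso M L.
Proof.
move=> [h [k [Hh Hk hk kh]]] [h' [k' [Hh' Hk' hk' kh']]].
exists (fun i => h i *m h' i), (fun i => k' i *m k i); split;
  [exact: is_hom_comp Hh Hh' | exact: is_hom_comp Hk' Hk | |].
  by move=> i; rewrite mulmxA -(mulmxA (h i)) hk' mulmx1.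
by move=> i; rewrite mulmxA -(mulmxA (k' i)) kh mulmx1.
Qed.

Lemma homdim_le_iso d e d' e' (X : rep K d) (Y : rep K e) (X' : rep K d') (Y' : rep K e') :
  iso X X' -> iso Y Y' -> (homdim X Y <= homdim X' Y')%N.
Proof.
move=> [h [k [Hh Hk hk kh]]] [h' [k' [Hh' Hk' hk' kh']]].
apply: (@dim_le_inj _ _ (sandwich k h')).
  move=> g /mem_Hom gH; apply/mem_Hom.
  apply: (@is_hom_ext _ _ _ _ (fun i => k i *m fam_mx g i *m h' i)).
    by move=> i; rewrite fam_ofK.
  exact: is_hom_comp (is_hom_comp Hk gH) Hh'.
move=> g gH g0; apply: fam_mx_inj => i; rewrite fam_mx0.
have : k i *m fam_mx g i *m h' i = 0 by rewrite -[LHS](fam_ofK (fun i => k i *m fam_mx g i *m h' i)) -/(sandwich k h' g) g0 fam_mx0.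
move/(congr1 (fun A => h i *m A *m k' i)).
by rewrite mulmx0 mul0mx !mulmxA hk mul1mx -mulmxA hk' mulmx1.
Qed.

Lemma homdim_iso d e d' e' (X : rep K d) (Y : rep K e) (X' : rep K d') (Y' : rep K e') :
  iso X X' -> iso Y Y' -> homdim X Y = homdim X' Y'.
Proof.
move=> XX YY; apply/eqP; rewrite eqn_leq !homdim_le_iso //; exact: iso_sym.
Qed.

Lemma iso_dim d e (M : rep K d) (N : rep K e) i : iso M N -> d i = e i.
Proof.
move=> [h [k [_ _ /(_ i) hk /(_ i) kh]]].
have le a b (A : 'M[K]_(a, b)) (B : 'M_(b, a)) : A *m B = 1%:M -> (a <= b)%N.
  move=> AB; rewrite -[X in (X <= _)%N](mxrank1 K a) -AB.
  exact: leq_trans (mxrankM_maxl _ _) (rank_leq_col _).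
by apply/eqP; rewrite eqn_leq (le _ _ _ _ hk) (le _ _ _ _ kh).
Qed.

Lemma GL_orbit_iso d (M N : rep K d) : GL_orbit M N <-> iso M N.
Proof.
split=> [[g [ug gA gL]]|[h [k [Hh Hk hk kh]]]].
  exists (fun i => invmx (g i)), g; split; last 2 first.
  - by move=> i; rewrite mulVmx.
  - by move=> i; rewrite mulmxV.
  - split=> [i|]; first by rewrite gA !mulmxA mulVmx // mul1mx.
    by rewrite gL !mulmxA mulVmx // mul1mx.
  - split=> [i|]; first by rewrite gA -mulmxA mulVmx // mulmx1.
    by rewrite gL -mulmxA mulVmx // mulmx1.
have uk i : k i \in unitmx by case: (mulmx1_unit (hk i)).
have khV i : invmx (k i) = h i by rewrite -[RHS]mulmx1 -(mulmxV (uk i)) mulmxA hk mul1mx.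
exists k; split=> // [i|].
  by case: Hk => Hk _; rewrite -Hk -mulmxA mulmxV // mulmx1.
by case: Hk => _ Hk; rewrite -Hk -mulmxA mulmxV // mulmx1.
Qed.

Lemma dsum_homE d e f (X : rep K d) (Y : rep K e) (Z : rep K f)
    (g : forall i, 'M[K]_(d i, f i)) (h : forall i, 'M[K]_(e i, f i)) :
  is_hom (dsum X Y) Z (fun i => col_mx (g i) (h i)) <-> is_hom X Z g /\ is_hom Y Z h.
Proof.
have blockE a b c a' b' (A : 'M[K]_(a, a')) (B : 'M_(b, b')) (G : 'M_(a', c)) (H : 'M_(b', c)) :
    block_mx A 0 0 B *m col_mx G H = col_mx (A *m G) (B *m H).
  by rewrite mul_block_col !mul0mx addr0 add0r.
split=> [[ga gl]|[[ga gl] [ha hl]]].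
  split; split=> [i|]; first [have := ga i | have := gl];
    by rewrite /= (@blockE) mul_col_mx => /eq_col_mx[].
by split=> [i|]; rewrite /= (@blockE) mul_col_mx ?ga ?ha ?gl ?hl.
Qed.

Lemma hom_dsumE d e f (X : rep K d) (Y : rep K e) (Z : rep K f)
    (g : forall i, 'M[K]_(f i, d i)) (h : forall i, 'M[K]_(f i, e i)) :
  is_hom Z (dsum X Y) (fun i => row_mx (g i) (h i)) <-> is_hom Z X g /\ is_hom Z Y h.
Proof.
have blockE a b c a' b' (A : 'M[K]_(a, a')) (B : 'M_(b, b')) (G : 'M_(c, a)) (H : 'M_(c, b)) :
    row_mx G H *m block_mx A 0 0 B = row_mx (G *m A) (H *m B).
  by rewrite mul_row_block !mulmx0 addr0 add0r.
split=> [[ga gl]|[[ga gl] [ha hl]]].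
  split; split=> [i|]; first [have := ga i | have := gl];
    by rewrite /= (@blockE) mul_mx_row => /eq_row_mx[].
by split=> [i|]; rewrite /= (@blockE) mul_mx_row ?ga ?ha ?gl ?hl.
Qed.

(** Restriction to [Y] maps the morphisms from the direct sum onto those from
    [Y], with kernel the morphisms from [X]. *)
Lemma homdim_dsuml d e f (X : rep K d) (Y : rep K e) (Z : rep K f) :
  homdim (dsum X Y) Z = (homdim X Z + homdim Y Z)%N.
Proof.
pose inY i : 'M[K]_(e i, dimvecD d e i) := row_mx 0 1%:M.
pose inX i : 'M[K]_(d i, dimvecD d e i) := row_mx 1%:M 0.
pose prX i : 'M[K]_(dimvecD d e i, d i) := col_mx 1%:M 0.
pose prY i : 'M[K]_(dimvecD d e i, e i) := col_mx 0 1%:M.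
pose rY := sandwich inY (fun i => 1%:M : 'M[K]_(f i)).
pose rX := sandwich inX (fun i => 1%:M : 'M[K]_(f i)).
pose eX := sandwich prX (fun i => 1%:M : 'M[K]_(f i)).
pose eY := sandwich prY (fun i => 1%:M : 'M[K]_(f i)).
have rYE g i : fam_mx (rY g) i = dsubmx (fam_mx g i).
  by rewrite fam_ofK mulmx1 -[fam_mx g i]vsubmxK mul_row_col mul0mx add0r mul1mx col_mxKd.
have rXE g i : fam_mx (rX g) i = usubmx (fam_mx g i).
  by rewrite fam_ofK mulmx1 -[fam_mx g i]vsubmxK mul_row_col mul0mx addr0 mul1mx col_mxKu.
have eXE g i : fam_mx (eX g) i = col_mx (fam_mx g i) 0.
  by rewrite fam_ofK mulmx1 mul_col_mx mul0mx mul1mx.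
have eYE g i : fam_mx (eY g) i = col_mx 0 (fam_mx g i).
  by rewrite fam_ofK mulmx1 mul_col_mx mul0mx mul1mx.
have homP g : g \in Defs.Hom (dsum X Y) Z <-> rX g \in Defs.Hom X Z /\ rY g \in Defs.Hom Y Z.
  split=> [/mem_Hom gH|[/mem_Hom gX /mem_Hom gY]].
    have /dsum_homE[gX gY] : is_hom (dsum X Y) Z
        (fun i => col_mx (fam_mx (rX g) i) (fam_mx (rY g) i)).
      by apply: is_hom_ext gH => i; rewrite rXE rYE vsubmxK.
    by split; apply/mem_Hom.
  apply/mem_Hom; have := (dsum_homE X Y Z _ _).2 (conj gX gY).
  by apply: is_hom_ext => i; rewrite rXE rYE vsubmxK.
have rXeX g : rX (eX g) = g by apply: fam_mx_inj => i; rewrite rXE eXE col_mxKu.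
have rYeX g : rY (eX g) = 0 by apply: fam_mx_inj => i; rewrite rYE eXE col_mxKd fam_mx0.
have rXeY g : rX (eY g) = 0 by apply: fam_mx_inj => i; rewrite rXE eYE col_mxKu fam_mx0.
have rYeY g : rY (eY g) = g by apply: fam_mx_inj => i; rewrite rYE eYE col_mxKd.
rewrite /homdim -(limg_ker_dim (linfun rY) (Defs.Hom (dsum X Y) Z)); congr (_ + _)%N.
  apply/eqP; rewrite eqn_leq; apply/andP; split.
    apply: (@dim_le_inj _ _ rX) => g; rewrite memv_cap memv_ker lfunE /=.
      by case/andP => /homP[].
    case/andP => _ /eqP gY gX; apply: fam_mx_inj => i.
    have {}gX : rX g = 0 by exact: gX.
    have {}gY : rY g = 0 by exact: gY.
    by rewrite -[fam_mx g i]vsubmxK -rXE -rYE gX gY !fam_mx0 col_mx0.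
  apply: (@dim_le_inj _ _ eX) => g gH.
    rewrite memv_cap memv_ker lfunE; apply/andP; split; last exact/eqP/rYeX.
    by apply/(homP (eX g)); rewrite rXeX rYeX mem0v.
  by move/(congr1 rX); rewrite [LHS]rXeX => ->; apply: linear0.
congr (\dim _); apply/vspaceP => g; apply/memv_imgP/idP => [[h /homP[_ hY] ->]|gH].
  by rewrite lfunE.
by exists (eY g); [apply/homP; rewrite rXeY rYeY mem0v | rewrite lfunE; exact/esym/rYeY].
Qed.

Lemma homdim_dsumr d e f (X : rep K d) (Y : rep K e) (Z : rep K f) :
  homdim Z (dsum X Y) = (homdim Z X + homdim Z Y)%N.
Proof.
pose inY i : 'M[K]_(e i, dimvecD d e i) := row_mx 0 1%:M.
pose inX i : 'M[K]_(d i, dimvecD d e i) := row_mx 1%:M 0.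
pose prX i : 'M[K]_(dimvecD d e i, d i) := col_mx 1%:M 0.
pose prY i : 'M[K]_(dimvecD d e i, e i) := col_mx 0 1%:M.
pose rY := sandwich (fun i => 1%:M : 'M[K]_(f i)) prY.
pose rX := sandwich (fun i => 1%:M : 'M[K]_(f i)) prX.
pose eX := sandwich (fun i => 1%:M : 'M[K]_(f i)) inX.
pose eY := sandwich (fun i => 1%:M : 'M[K]_(f i)) inY.
have rYE g i : fam_mx (rY g) i = rsubmx (fam_mx g i).
  by rewrite fam_ofK mul1mx -[fam_mx g i]hsubmxK mul_row_col mulmx0 add0r mulmx1 row_mxKr.
have rXE g i : fam_mx (rX g) i = lsubmx (fam_mx g i).
  by rewrite fam_ofK mul1mx -[fam_mx g i]hsubmxK mul_row_col mulmx0 addr0 mulmx1 row_mxKl.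
have eXE g i : fam_mx (eX g) i = row_mx (fam_mx g i) 0.
  by rewrite fam_ofK mul1mx mul_mx_row mulmx0 mulmx1.
have eYE g i : fam_mx (eY g) i = row_mx 0 (fam_mx g i).
  by rewrite fam_ofK mul1mx mul_mx_row mulmx0 mulmx1.
have homP g : g \in Defs.Hom Z (dsum X Y) <-> rX g \in Defs.Hom Z X /\ rY g \in Defs.Hom Z Y.
  split=> [/mem_Hom gH|[/mem_Hom gX /mem_Hom gY]].
    have /hom_dsumE[gX gY] : is_hom Z (dsum X Y)
        (fun i => row_mx (fam_mx (rX g) i) (fam_mx (rY g) i)).
      by apply: is_hom_ext gH => i; rewrite rXE rYE hsubmxK.
    by split; apply/mem_Hom.
  apply/mem_Hom; have := (hom_dsumE X Y Z _ _).2 (conj gX gY).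
  by apply: is_hom_ext => i; rewrite rXE rYE hsubmxK.
have rXeX g : rX (eX g) = g by apply: fam_mx_inj => i; rewrite rXE eXE row_mxKl.
have rYeX g : rY (eX g) = 0 by apply: fam_mx_inj => i; rewrite rYE eXE row_mxKr fam_mx0.
have rXeY g : rX (eY g) = 0 by apply: fam_mx_inj => i; rewrite rXE eYE row_mxKl fam_mx0.
have rYeY g : rY (eY g) = g by apply: fam_mx_inj => i; rewrite rYE eYE row_mxKr.
rewrite /homdim -(limg_ker_dim (linfun rY) (Defs.Hom Z (dsum X Y))); congr (_ + _)%N.
  apply/eqP; rewrite eqn_leq; apply/andP; split.
    apply: (@dim_le_inj _ _ rX) => g; rewrite memv_cap memv_ker lfunE /=.
      by case/andP => /homP[].
    case/andP => _ /eqP gY gX; apply: fam_mx_inj => i.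
    have {}gX : rX g = 0 by exact: gX.
    have {}gY : rY g = 0 by exact: gY.
    by rewrite -[fam_mx g i]hsubmxK -rXE -rYE gX gY !fam_mx0 row_mx0.
  apply: (@dim_le_inj _ _ eX) => g gH.
    rewrite memv_cap memv_ker lfunE; apply/andP; split; last exact/eqP/rYeX.
    by apply/(homP (eX g)); rewrite rXeX rYeX mem0v.
  by move/(congr1 rX); rewrite [LHS]rXeX => ->; apply: linear0.
congr (\dim _); apply/vspaceP => g; apply/memv_imgP/idP => [[h /homP[_ hY] ->]|gH].
  by rewrite lfunE.
by exists (eY g); [apply/homP; rewrite rXeY rYeY mem0v | rewrite lfunE; exact/esym/rYeY].
Qed.

End Homs.

(** * Direct summands *)

Section Summands.
Variables (K : fieldType) (n : nat).
Implicit Types d e f : dimvec n.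

Lemma is_hom0 d e (M : rep K d) (N : rep K e) : is_hom M N (fun i => 0).
Proof. by split=> [i|]; rewrite mulmx0 mul0mx. Qed.

Lemma iso_dsum_congl d e f (M : rep K d) (M' : rep K e) (N : rep K f) :
  iso M M' -> iso (dsum M N) (dsum M' N).
Proof.
move=> [h [k [Hh Hk hk kh]]].
exists (fun i => col_mx (row_mx (h i) 0) (row_mx 0 1%:M)),
       (fun i => col_mx (row_mx (k i) 0) (row_mx 0 1%:M)); split.
- by apply/dsum_homE; split; apply/hom_dsumE; split=> //; [exact: is_hom0..|exact: is_hom1].
- by apply/dsum_homE; split; apply/hom_dsumE; split=> //; [exact: is_hom0..|exact: is_hom1].
- move=> i; rewrite mul_col_mx !mul_row_col !mul0mx addr0 add0r mul1mx mul_mx_row hk mulmx0.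
  exact/esym/scalar_mx_block.
- move=> i; rewrite mul_col_mx !mul_row_col !mul0mx addr0 add0r mul1mx mul_mx_row kh mulmx0.
  exact/esym/scalar_mx_block.
Qed.

Lemma iso_dsumC d e (M : rep K d) (N : rep K e) : iso (dsum M N) (dsum N M).
Proof.
exists (fun i => col_mx (row_mx 0 1%:M) (row_mx 1%:M 0)),
       (fun i => col_mx (row_mx 0 1%:M) (row_mx 1%:M 0)); split.
1,2: by apply/dsum_homE; split; apply/hom_dsumE; split; try exact: is_hom0; exact: is_hom1.
all: move=> i; rewrite mul_col_mx !mul_row_col !mul0mx addr0 add0r !mul1mx.
all: exact/esym/scalar_mx_block.
Qed.

Lemma iso_dsumA d e f (X : rep K d) (Y : rep K e) (Z : rep K f) :
  iso (dsum (dsum X Y) Z) (dsum X (dsum Y Z)).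
Proof.
have one2 p q : col_mx (row_mx 1%:M 0) (row_mx 0 1%:M) = 1%:M :> 'M[K]_(p + q).
  exact/esym/scalar_mx_block.
exists (fun i => col_mx (col_mx (row_mx 1%:M (row_mx 0 0)) (row_mx 0 (row_mx 1%:M 0)))
                        (row_mx 0 (row_mx 0 1%:M))),
       (fun i => col_mx (row_mx (row_mx 1%:M 0) 0)
                        (col_mx (row_mx (row_mx 0 1%:M) 0) (row_mx (row_mx 0 0) 1%:M))); split.
- apply/dsum_homE; split; first (apply/dsum_homE; split);
    by do 2?[apply/hom_dsumE; split]; try exact: is_hom0; exact: is_hom1.
- apply/dsum_homE; split; last (apply/dsum_homE; split);
    by do 2?[apply/hom_dsumE; split]; try exact: is_hom0; exact: is_hom1.
- move=> i; rewrite !(mul_col_mx, mul_row_col, mul0mx, mul1mx, addr0, add0r).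
  rewrite -[X in col_mx X _]/(block_mx _ _ _ _) block_mxEh col_mx0 row_mx0.
  by rewrite one2; apply/esym/scalar_mx_block.
move=> i; rewrite !(mul_col_mx, mul_row_col, mul0mx, mul1mx, addr0, add0r).
rewrite -[X in col_mx _ X]/(block_mx _ _ _ _) block_mxEh col_mx0 row_mx0.
by rewrite one2; apply/esym/scalar_mx_block.
Qed.

Lemma summand_refl d (W : rep K d) : direct_summand W W.
Proof.
pose z : dimvec n := fun _ => 0%N.
have zz : (0 : 'M[K]_(z ord_max)) *m (0 : 'M[K]_(z ord_max)) = 0 by rewrite mulmx0.
pose Z : rep K z := @Rep K n z (fun _ => 0) 0 zz.
exists z, Z, (fun i => row_mx 1%:M 0), (fun i => col_mx 1%:M 0); split.
- by apply/hom_dsumE; split; [exact: is_hom1|exact: is_hom0].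
- by apply/dsum_homE; split; [exact: is_hom1|exact: is_hom0].
- by move=> i; rewrite mul_row_col mul1mx mulmx0 addr0.
move=> i; rewrite mul_col_mx mul1mx mul0mx -[RHS]vsubmxK; congr col_mx; last by rewrite !flatmx0.
rewrite -[RHS]hsubmxK; congr row_mx; last by rewrite !thinmx0.
by apply/matrixP => a b; rewrite !mxE -val_eqE.
Qed.

Lemma summand_iso d e f (Y : rep K d) (W : rep K e) (Y' : rep K f) :
  iso Y Y' -> direct_summand Y W -> direct_summand Y' W.
Proof.
by move=> YY [g [Z WZ]]; exists g, Z; apply: iso_trans WZ _; apply: iso_dsum_congl.
Qed.

Lemma summand_dsuml d e f (X : rep K d) (Y : rep K e) (W : rep K f) :
  direct_summand (dsum X Y) W -> direct_summand X W.
Proof.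
by move=> [g [Z WZ]]; exists (dimvecD e g), (dsum Y Z); apply: iso_trans WZ (iso_dsumA _ _ _).
Qed.

Lemma summand_dsumr d e f (X : rep K d) (Y : rep K e) (W : rep K f) :
  direct_summand (dsum X Y) W -> direct_summand Y W.
Proof. by move=> /(summand_iso (iso_dsumC X Y)); apply: summand_dsuml. Qed.

Lemma homdim_zerol d e (X : rep K d) (M : rep K e) : zero_dim d -> homdim X M = 0%N.
Proof.
move=> d0; apply/eqP; rewrite /homdim dimv_eq0 -subv0; apply/subvP => g _; rewrite memv0.
apply/eqP/fam_mx_inj => i; apply/matrixP => a b.
by have := leq_trans (ltn_ord a) (eq_leq (d0 i)).
Qed.

Lemma homdim_zeror d e (X : rep K d) (M : rep K e) : zero_dim d -> homdim M X = 0%N.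
Proof.
move=> d0; apply/eqP; rewrite /homdim dimv_eq0 -subv0; apply/subvP => g _; rewrite memv0.
apply/eqP/fam_mx_inj => i; apply/matrixP => a b.
by have := leq_trans (ltn_ord b) (eq_leq (d0 i)).
Qed.

(** Existence of decompositions into indecomposables, in the form of an
    induction principle over the direct summands of [W]. *)
Lemma summand_ind (W_dim : dimvec n) (W : rep K W_dim) (P : forall f, rep K f -> Prop) :
    (forall f (X : rep K f), zero_dim f -> P f X) ->
    (forall f (X : rep K f), indecomposable X -> direct_summand X W -> P f X) ->
    (forall d e f (X : rep K f) (Y : rep K d) (Z : rep K e),
       iso X (dsum Y Z) -> P d Y -> P e Z -> P f X) ->
  P W_dim W.
Proof.
move=> P0 P1 PD.
suff H k : forall f (X : rep K f), (\sum_i f i < k)%N -> direct_summand X W -> P f X.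
  exact: (H (\sum_i W_dim i).+1%N _ _ (ltnSn _) (summand_refl W)).
elim: k => // k IH f X fk XW.
case: (pselect (zero_dim f)) => [|nz]; first exact: P0.
case: (pselect (indecomposable X)) => [iX|nX]; first exact: P1.
have [d [e [Y [Z [XYZ dz ez]]]]] : exists d e (Y : rep K d) (Z : rep K e),
    [/\ iso X (dsum Y Z), ~ zero_dim d & ~ zero_dim e].
  apply: contrapT => none; apply: nX; split=> // d e Y Z XYZ.
  apply: contrapT => /not_orP[dz ez]; apply: none.
  by exists d, e, Y, Z.
have pos (g : dimvec n) : ~ zero_dim g -> (0 < \sum_i g i)%N.
  move=> gz; rewrite lt0n; apply/eqP => s0; apply: gz => i.
  by apply/eqP; rewrite -leqn0 -s0 (bigD1 i) //= leq_addr.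
have fE : (\sum_i f i = \sum_i d i + \sum_i e i)%N.
  by rewrite -big_split; apply: eq_bigr => i _; apply: iso_dim XYZ.
have dpos := pos _ dz; have epos := pos _ ez.
have YZW := summand_iso XYZ XW.
apply: PD XYZ _ _; apply: IH; try by lia.
  exact: summand_dsuml YZW.
exact: summand_dsumr YZW.
Qed.

End Summands.

(** * Degenerations *)

Section Degenerations.
Variables (K : fieldType) (n : nat).
Implicit Types d e f : dimvec n.

Lemma peval_ext d (p : {mpoly K[#|coord d|]}) (M N : rep K d) :
  (forall i, arrow M i = arrow N i) -> loop M = loop N -> peval p M = peval p N.
Proof.
by move=> MA ML; apply: meval_eq => k; case: (enum_val k) => x /=; rewrite ?MA ?ML.
Qed.

Lemma conj_sq0 (d : nat) (g : 'M[K]_d) (L : 'M_d) :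
  g \in unitmx -> L *m L = 0 -> (g *m L *m invmx g) *m (g *m L *m invmx g) = 0.
Proof.
move=> ug LL; rewrite !mulmxA -(mulmxA _ (invmx g) g) mulVmx // mulmx1.
by rewrite -(mulmxA g L L) LL mulmx0 mul0mx.
Qed.

(** Base change is a polynomial map and preserves the orbit. *)
Lemma closure_GL d (M M' N : rep K d) :
  zariski_closure (GL_orbit M) M' -> GL_orbit M' N -> zariski_closure (GL_orbit M) N.
Proof.
move=> cM' [g [ug gA gL]] p p0.
pose act (L : rep K d) : rep K d := @Rep _ _ d
  (fun i => g (src i) *m arrow L i *m invmx (g (tgt i)))
  (g ord_max *m loop L *m invmx (g ord_max)) (conj_sq0 (ug _) (loop_sq0 L)).
rewrite (peval_ext p (N := act M')) //.
have [q qE] : polyfun (fun L => peval p (act L)).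
  apply: polyfun_comp => -[[i [a b]]|[a b]] /=.
    do 2?apply: polyfun_mulmx => *; do ?exact: polyfun_const; exact: polyfun_arrow.
  do 2?apply: polyfun_mulmx => *; do ?exact: polyfun_const; exact: polyfun_loop.
rewrite -qE; apply: cM' => L ML; rewrite qE; apply: p0.
apply/GL_orbit_iso; move/GL_orbit_iso: ML => /iso_trans; apply.
by apply/GL_orbit_iso; exists g.
Qed.

Lemma deg_leP d (M M' : rep K d) :
  deg_le M M' <-> zariski_closure (GL_orbit M) M'.
Proof.
split=> [|cM' N]; first by apply; apply/GL_orbit_iso; apply: iso_refl.
exact: closure_GL.
Qed.

Lemma deg_le_trans d (M N L : rep K d) : deg_le M N -> deg_le N L -> deg_le M L.
Proof. by move=> MN NL L' LL' p p0; apply: (NL _ LL') => N' /MN; apply. Qed.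

Lemma deg_le_iso d (M N : rep K d) : iso M N -> deg_le M N.
Proof. by move=> /GL_orbit_iso MN; apply/deg_leP => p; apply. Qed.

(** Morphisms are the kernel of a linear map whose coefficients are polynomial
    in the representation. *)
Lemma homdim_deg_le_cod d e (M M' : rep K d) (X : rep K e) :
  deg_le M M' -> (homdim X M <= homdim X M')%N.
Proof.
move=> /deg_leP cM'.
pose T : finType := ({i : 'I_n & ('I_(e (src i)) * 'I_(d (tgt i)))%type}
   + ('I_(e ord_max) * 'I_(d ord_max)))%type.
pose Phi (N : rep K d) (h : mxfam K e d) (x : T) : K :=
  match x with
  | inl u => arrow_defect X N (tag u) h (tagged u).1 (tagged u).2
  | inr u => loop_defect X N h u.1 u.2
  end.
have [] := @kernel_semicontinuous K n d _ M' (mxfam K e d) T Phi (fun N => Hom X N) _ _ _ cM'.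
- move=> N [u|u] a g h; rewrite /Phi.
    by rewrite arrow_defect_linear !mxE.
  by rewrite loop_defect_linear !mxE.
- move=> h [u|u]; rewrite /Phi /arrow_defect /loop_defect.
    apply: (@polyfun_ext _ _ _ (fun N => (arrow X (tag u) *m fam_mx h (tgt (tag u))) (tagged u).1 (tagged u).2
       + (-1) * (fam_mx h (src (tag u)) *m arrow N (tag u)) (tagged u).1 (tagged u).2)).
      by move=> N; rewrite [RHS]mxE [X in _ = _ + X]mxE mulN1r.
    apply: polyfunD; first exact: polyfun_const.
    apply: polyfunM; first exact: polyfun_const.
    by apply: polyfun_mulmx => *; [exact: polyfun_const|exact: polyfun_arrow].
  apply: (@polyfun_ext _ _ _ (fun N => (loop X *m fam_mx h ord_max) u.1 u.2
       + (-1) * (fam_mx h ord_max *m loop N) u.1 u.2)).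
    by move=> N; rewrite [RHS]mxE [X in _ = _ + X]mxE mulN1r.
  apply: polyfunD; first exact: polyfun_const.
  apply: polyfunM; first exact: polyfun_const.
  by apply: polyfun_mulmx => *; [exact: polyfun_const|exact: polyfun_loop].
- move=> N h; split=> [/mem_Hom[hA hL] [u|u]|h0].
  + by rewrite /Phi /arrow_defect hA subrr mxE.
  + by rewrite /Phi /loop_defect hL subrr mxE.
  apply/mem_Hom; split=> [i|]; apply/eqP; rewrite -subr_eq0; apply/eqP/matrixP => a b.
    by rewrite [RHS]mxE; apply: (h0 (inl (Tagged (fun i => ('I_(e (src i)) * 'I_(d (tgt i)))%type) (a, b)))).
  by rewrite [RHS]mxE; apply: (h0 (inr (a, b))).
move=> N MN; apply: leq_trans.
by rewrite (homdim_iso (iso_refl X) (Y' := N)) //; apply/GL_orbit_iso.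
Qed.

Lemma homdim_deg_le_dom d e (M M' : rep K d) (X : rep K e) :
  deg_le M M' -> (homdim M X <= homdim M' X)%N.
Proof.
move=> /deg_leP cM'.
pose T : finType := ({i : 'I_n & ('I_(d (src i)) * 'I_(e (tgt i)))%type}
   + ('I_(d ord_max) * 'I_(e ord_max)))%type.
pose Phi (N : rep K d) (h : mxfam K d e) (x : T) : K :=
  match x with
  | inl u => arrow_defect N X (tag u) h (tagged u).1 (tagged u).2
  | inr u => loop_defect N X h u.1 u.2
  end.
have [] := @kernel_semicontinuous K n d _ M' (mxfam K d e) T Phi (fun N => Hom N X) _ _ _ cM'.
- move=> N [u|u] a g h; rewrite /Phi.
    by rewrite arrow_defect_linear !mxE.
  by rewrite loop_defect_linear !mxE.
- move=> h [u|u]; rewrite /Phi /arrow_defect /loop_defect.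
    apply: (@polyfun_ext _ _ _ (fun N => (arrow N (tag u) *m fam_mx h (tgt (tag u))) (tagged u).1 (tagged u).2
       + (-1) * (fam_mx h (src (tag u)) *m arrow X (tag u)) (tagged u).1 (tagged u).2)).
      by move=> N; rewrite [RHS]mxE [X in _ = _ + X]mxE mulN1r.
    apply: polyfunD; last exact: polyfun_const.
    by apply: polyfun_mulmx => *; [exact: polyfun_arrow|exact: polyfun_const].
  apply: (@polyfun_ext _ _ _ (fun N => (loop N *m fam_mx h ord_max) u.1 u.2
       + (-1) * (fam_mx h ord_max *m loop X) u.1 u.2)).
    by move=> N; rewrite [RHS]mxE [X in _ = _ + X]mxE mulN1r.
  apply: polyfunD; last exact: polyfun_const.
  by apply: polyfun_mulmx => *; [exact: polyfun_loop|exact: polyfun_const].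
- move=> N h; split=> [/mem_Hom[hA hL] [u|u]|h0].
  + by rewrite /Phi /arrow_defect hA subrr mxE.
  + by rewrite /Phi /loop_defect hL subrr mxE.
  apply/mem_Hom; split=> [i|]; apply/eqP; rewrite -subr_eq0; apply/eqP/matrixP => a b.
    by rewrite [RHS]mxE; apply: (h0 (inl (Tagged (fun i => ('I_(d (src i)) * 'I_(e (tgt i)))%type) (a, b)))).
  by rewrite [RHS]mxE; apply: (h0 (inr (a, b))).
move=> N MN; apply: leq_trans.
by rewrite (homdim_iso (X' := N) _ (iso_refl X)) //; apply/GL_orbit_iso.
Qed.

Lemma rep_injP d (M : rep K d) : rep_inj M <-> forall i, row_free (arrow M i).
Proof.
split=> H i; last by move=> u v; apply: row_free_inj.
by apply: inj_row_free => v vM; apply: (H i); rewrite vM mul0mx.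
Qed.

Lemma rep_inj_deg_le d (M M' : rep K d) : deg_le M M' -> rep_inj M' -> rep_inj M.
Proof.
move=> /deg_leP cM' /rep_injP injM'; apply/rep_injP => i.
pose Phi (N : rep K d) (v : 'rV[K]_(d (src i))) (x : 'I_(d (tgt i))) := (v *m arrow N i) 0 x.
pose Z (N : rep K d) := lker (linfun (mulmxr (arrow N i) : 'rV[K]_(d (src i)) -> _)).
have ZP N v : v \in Z N <-> v *m arrow N i = 0.
  by rewrite memv_ker lfunE /=; split=> /eqP.
have [] := @kernel_semicontinuous K n d _ M' _ _ Phi Z _ _ _ cM'.
- by move=> N x a u v; rewrite /Phi mulmxDl -scalemxAl !mxE.
- by move=> v x; apply: polyfun_mulmx => *; [exact: polyfun_const|exact: polyfun_arrow].
- move=> N v; rewrite ZP; split=> [vN x|H]; first by rewrite /Phi vN mxE.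
  by apply/rowP => x; rewrite [RHS]mxE; apply: H.
have -> : Z M' = 0%VS.
  apply/eqP; rewrite -subv0; apply/subvP => v /ZP vN; rewrite memv0.
  by apply/eqP; apply: (row_free_inj (injM' i)); rewrite vN mul0mx.
move=> N /GL_orbit_iso [h [k [[hA _] _ hk kh]]]; rewrite dimv0 leqn0 dimv_eq0 => /eqP ZN.
apply: inj_row_free => v vM.
have : v *m h (src i) \in Z N by apply/ZP; rewrite -mulmxA -hA mulmxA vM mul0mx.
rewrite ZN memv0 => /eqP/(congr1 (mulmxr (k (src i)))) /=.
by rewrite -mulmxA hk mulmx1 mul0mx.
Qed.

(** A polynomial vanishing along the punctured line vanishes at the origin,
    since in characteristic zero the line has infinitely many points. *)
Lemma deg_le_curve d (M : rep K d) (F : K -> rep K d) (q : coord d -> {poly K}) :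
    [pchar K] =i pred0 ->
    (forall t c, coordinate (F t) c = (q c).[t]) ->
    (forall t, t != 0 -> iso M (F t)) -> deg_le M (F 0).
Proof.
move=> /pcharf0P char0 qE isoF; apply/deg_leP => p p0.
pose Q := \sum_(k <- msupp p) (p@_k)%:P * \prod_i (q (enum_val i)) ^+ k i.
have QE t : peval p (F t) = Q.[t].
  rewrite /peval mevalE /Q horner_sum; apply: eq_bigr => k _.
  rewrite hornerM hornerC horner_prod; congr (_ * _); apply: eq_bigr => i _.
  by rewrite horner_exp qE.
rewrite QE; suff -> : Q = 0 by rewrite horner0.
apply/eqP/negP => /negP Q0.
pose rs := [seq k.+1%:R : K | k <- iota 0 (size Q)].
have := @max_poly_roots _ Q rs Q0; rewrite size_map size_iota ltnn => H.
suff : false by []; apply: H.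
  apply/allP => _ /mapP[k _ ->]; rewrite /root -QE p0 //.
  by apply/GL_orbit_iso; apply: isoF; rewrite char0.
rewrite map_inj_in_uniq ?iota_uniq // => i j _ _.
wlog ij : i j / (i <= j)%N => [H'|/eqP].
  by case/orP: (leq_total i j) => [/H'|/H' h e] //; rewrite h.
rewrite eq_sym -subr_eq0 -natrB // char0 subSS subn_eq0 => ji.
by apply/eqP; rewrite eqn_leq ij.
Qed.

End Degenerations.

(** * Coordinate flags *)

Section Standard.
Variables (K : fieldType) (n : nat).
Implicit Types d e f : dimvec n.

Definition flag_rep d (L : 'M[K]_(d ord_max)) (LL : L *m L = 0) : rep K d :=
  @Rep K n d (fun i => pid_mx (d (src i))) L LL.

Definition monotone d := forall i : 'I_n, (d (src i) <= d (tgt i))%N.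

(** The column factor of the Gaussian decomposition of [A] acts on the first
    coordinates only and is extended by the identity to the others. *)
Lemma completion r p (A : 'M[K]_(r, p)) : row_free A ->
  exists2 g : 'M[K]_p, g \in unitmx & pid_mx r *m g = A.
Proof.
move=> fA; have rp : (r <= p)%N by rewrite -(eqP fA) rank_leq_col.
set C := col_ebase A; have uC : C \in unitmx := col_ebase_unit A.
pose P : 'M[K]_(r, p) := pid_mx r; pose P' : 'M[K]_(p, r) := pid_mx r.
have PP' : P *m P' = 1%:M by rewrite mul_pid_mx minnn (minn_idPr rp) pid_mx_1.
pose Q : 'M[K]_p := 1%:M - P' *m P.
have QP' : Q *m P' = 0 by rewrite mulmxBl mul1mx -mulmxA PP' mulmx1 subrr.
have PQ : P *m Q = 0 by rewrite mulmxBr mulmx1 mulmxA PP' mul1mx subrr.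
have QQ : Q *m Q = Q by rewrite {1}/Q mulmxBl mul1mx -mulmxA PQ mulmx0 subr0.
have QE : P' *m P + Q = 1%:M by rewrite /Q addrC subrK.
clearbody Q; exists ((P' *m C *m P + Q) *m row_ebase A).
  rewrite unitmx_mul row_ebase_unit andbT.
  suff /mulmx1_unit[] : (P' *m C *m P + Q) *m (P' *m invmx C *m P + Q) = 1%:M by [].
  rewrite mulmxDr !mulmxDl QQ -!(mulmxA _ P) PQ !mulmx0 add0r.
  rewrite !mulmxA QP' !mul0mx addr0 -(mulmxA _ P P') PP' mulmx1.
  by rewrite -(mulmxA P' C) mulmxV // mulmx1.
rewrite mulmxA mulmxDr PQ addr0 !mulmxA PP' mul1mx.
by rewrite -[RHS]mulmx_ebase (eqP fA).
Qed.

Lemma inj_monotone d (M : rep K d) : rep_inj M -> monotone d.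
Proof. by move=> /rep_injP fM i; rewrite -(eqP (fM i)) rank_leq_col. Qed.

(** Bases adapted to the images of the arrows are chosen from the first vertex
    upwards, extending at each vertex the basis of the previous one. *)
Lemma flag_rep_exists d (M : rep K d) : rep_inj M ->
  exists (L : 'M_(d ord_max)) (LL : L *m L = 0), iso M (flag_rep LL).
Proof.
move=> /rep_injP fM.
have /(_ n (leqnn n))[g [ug gA]] k : (k <= n)%N ->
    exists g : forall i, 'M[K]_(d i), (forall i, g i \in unitmx) /\
    forall i : 'I_n, (i < k)%N -> g (src i) *m arrow M i = pid_mx (d (src i)) *m g (tgt i).
  elim: k => [_|k IH kn].
    by exists (fun i => 1%:M); split=> // i; rewrite unitmx1.
  have [g [ug gA]] := IH (ltnW kn).
  pose i0 : 'I_n := Ordinal kn.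
  have fg : row_free (g (src i0) *m arrow M i0).
    by rewrite /row_free mxrankMfree ?fM // mxrank_unit.
  have [h uh hE] := completion fg.
  exists (dfwith g h); split=> [i|i].
    by case: dfwithP.
  rewrite ltnS leq_eqVlt => /orP[/eqP ik|ik].
    have -> : i = i0 by apply: val_inj.
    rewrite dfwith_in dfwith_out ?hE //.
    by rewrite -val_eqE /= /bump /=; lia.
  by rewrite !dfwith_out ?gA // -val_eqE /= /bump /=; lia.
pose L := g ord_max *m loop M *m invmx (g ord_max).
have LL : L *m L = 0 := conj_sq0 (ug _) (loop_sq0 M).
exists L, LL; apply/GL_orbit_iso; exists g; split=> // i.
by rewrite gA // mulmxK.
Qed.

(** An invertible triangular matrix preserves the flag, and its leading
    blocks are the components of the isomorphism. *)
Lemma triangular_iso d (dm : forall i, (d i <= d ord_max)%N) (h L L' : 'M[K]_(d ord_max))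
    (LL : L *m L = 0) (LL' : L' *m L' = 0) :
    (forall a b : 'I_(d ord_max), (a < b)%N -> h a b = 0) -> (forall a, h a a != 0) ->
    h *m L = L' *m h -> monotone d -> iso (flag_rep LL) (flag_rep LL').
Proof.
move=> htrig hdiag hL mono.
pose g i : 'M[K]_(d i) := \matrix_(a, b) h (widen_ord (dm i) a) (widen_ord (dm i) b).
have ug i : g i \in unitmx.
  rewrite unitmxE det_trig.
    by rewrite unitfE; apply/prodf_neq0 => a _; rewrite mxE.
  by apply/is_trig_mxP => a b ab; rewrite mxE htrig.
have gmax : g ord_max = h.
  by apply/matrixP => a b; rewrite mxE; congr (h _ _); apply: val_inj.
apply/GL_orbit_iso; exists g; split=> [i|i|] //; last first.
  rewrite gmax /= hL mulmxK //; by rewrite -gmax.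
suff : pid_mx (d (src i)) *m g (tgt i) = g (src i) *m pid_mx (d (src i)).
  by rewrite /= => <-; rewrite mulmxK.
apply/matrixP => a b.
rewrite !mxE (bigD1 (widen_ord (mono i) a)) //= big1 ?addr0 => [|c ca]; last first.
  rewrite mxE; case: eqP => [ac|]; last by rewrite mul0r.
  by case/eqP: ca; apply: val_inj.
rewrite !mxE eqxx ltn_ord mul1r.
case: (ltnP b (d (src i))) => bd.
  rewrite (bigD1 (Ordinal bd)) //= big1 ?addr0 => [|c cb]; last first.
    rewrite !mxE; case: eqP => [cb'|]; last by rewrite mulr0.
    by case/eqP: cb; apply: val_inj.
  by rewrite !mxE eqxx bd mulr1; congr (h _ _); apply: val_inj.
rewrite big1; last first.
  move=> c _; rewrite !mxE; case: eqP => [cb|]; last by rewrite mulr0.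
  by have := ltn_ord c; rewrite cb ltnNge bd.
by apply: htrig => /=; apply: leq_trans bd.
Qed.

End Standard.

(** * Morphisms between patterns *)

Section Entries.
Variable K : fieldType.

Lemma label_dot p x y : label K p x *m (label K p y)^T = (((0 < x <= p)%N && (x == y))%:R)%:M.
Proof.
apply/matrixP => i j; rewrite !mxE !ord1 /= mulr1n.
case: (boolP (0 < x <= p)%N) => [xp|xp] /=.
  have x1p : (x.-1 < p)%N by lia.
  rewrite (bigD1 (Ordinal x1p)) //= big1 ?addr0 => [|c cx]; last first.
    by rewrite !mxE; case: eqP => [e|]; [case/eqP: cx; apply: val_inj; rewrite /= e | rewrite mul0r].
  by rewrite !mxE /= prednK ?eqxx ?mul1r 1?eq_sym //; lia.
rewrite big1 // => c _; rewrite !mxE; case: eqP => [e|]; last by rewrite mul0r.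
by case/negP: xp; rewrite e /= ltn_ord.
Qed.

(** Matrix entries addressed by labels; they vanish outside the matrix. *)
Definition lentry p q (A : 'M[K]_(p, q)) (x y : nat) : K :=
  (label K p x *m A *m (label K q y)^T) 0 0.

Lemma lentryE p q (A : 'M[K]_(p, q)) (a : 'I_p) (b : 'I_q) : lentry A a.+1 b.+1 = A a b.
Proof.
have labelE r (i : 'I_r) : label K r i.+1 = delta_mx 0 i.
  by apply/rowP => j; rewrite !mxE eqSS eq_sym -val_eqE.
by rewrite /lentry !labelE trmx_delta -rowE -colE !mxE.
Qed.

Lemma lentry_out p q (A : 'M[K]_(p, q)) x y :
  ~~ ((0 < x <= p) && (0 < y <= q))%N -> lentry A x y = 0.
Proof.
have out r z : ~~ (0 < z <= r)%N -> label K r z = 0.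
  case: z => [_|z zr]; first exact: label0.
  by apply: label_out; lia.
rewrite negb_and => /orP[] /out e; rewrite /lentry e; first by rewrite !mul0mx mxE.
by rewrite trmx0 mulmx0 mxE.
Qed.

Lemma lentry_ext p q (A B : 'M[K]_(p, q)) :
  (forall x y, (0 < x <= p)%N -> (0 < y <= q)%N -> lentry A x y = lentry B x y) -> A = B.
Proof.
move=> AB; apply/matrixP => a b; rewrite -!lentryE; apply: AB; by rewrite /= ltn_ord.
Qed.

Lemma lentry_fun p q (F : nat -> nat -> K) x y : (0 < x <= p)%N -> (0 < y <= q)%N ->
  lentry (\matrix_(a < p, b < q) F a.+1 b.+1) x y = F x y.
Proof.
case: x y => // x [] // y xp yq.
by rewrite (lentryE _ (Ordinal (xp : x < p)%N) (Ordinal (yq : y < q)%N)) mxE.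
Qed.

Lemma pattern_label_tr m s t y : link_pattern m s t ->
  pattern_mx K m s *m (label K m y)^T = (label K m (t y))^T.
Proof.
move=> st; apply/matrixP => a j; rewrite !ord1 {j}.
transitivity ((label K m a.+1 *m (pattern_mx K m s *m (label K m y)^T)) 0 0).
  by rewrite (_ : label K m a.+1 = delta_mx 0 a) -?rowE ?mxE //; apply/rowP => j; rewrite !mxE eqSS eq_sym -val_eqE.
rewrite mulmxA label_pattern ?(pattern_0 st) ?ltn_ord // label_dot !mxE mulr1n.
congr (_%:R); congr nat_of_bool.
have [Fa _] := pattern_facts st a.+1; have [_ Fy] := pattern_facts st y.
case: (eqVneq (s a.+1) y) => [e|ne]; first by rewrite e in Fa; lia.
rewrite andbF; apply/esym/eqP => e; rewrite e in Fy; lia.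
Qed.

End Entries.

Section HomDimension.
Variables (K : fieldType) (n : nat).
Implicit Types d e : dimvec n.

Lemma monotone_leq d (i : 'I_n.+1) : monotone d -> (d i <= d ord_max)%N.
Proof.
move=> mono; have [k] := ubnP (n - i)%N; elim: k i => // k IH i nik.
case: (ltnP i n) => [il|ni]; last first.
  by have -> : i = ord_max by apply: val_inj => /=; have := ltn_ord i; lia.
have -> : i = src (Ordinal il) by apply: val_inj.
apply: leq_trans (mono _) _; apply: IH => /=.
by rewrite /bump /=; lia.
Qed.

(** A morphism between flags is a matrix at the last vertex that respects the
    steps; its other components are leading blocks. *)
Lemma flag_homE d e (L : 'M[K]_(e ord_max)) (L' : 'M[K]_(d ord_max))
    (LL : L *m L = 0) (LL' : L' *m L' = 0) (g : forall i, 'M[K]_(e i, d i)) :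
    monotone d -> monotone e ->
  is_hom (flag_rep LL) (flag_rep LL') g <->
  [/\ forall i a b, g i a b = lentry (g ord_max) a.+1 b.+1,
      forall i x y, (x <= e i)%N -> (d i < y)%N -> lentry (g ord_max) x y = 0
    & L *m g ord_max = g ord_max *m L'].
Proof.
move=> md me.
have lE i (a : 'I_(e (src i))) (b : 'I_(d (tgt i))) :
    (pid_mx (e (src i)) *m g (tgt i)) a b = g (tgt i) (widen_ord (me i) a) b.
  rewrite mxE (bigD1 (widen_ord (me i) a)) //= big1 ?addr0 => [|c ca].
    by rewrite !mxE eqxx ltn_ord mul1r.
  by rewrite mxE; case: eqP => [ac|]; [case/eqP: ca; apply: val_inj | rewrite mul0r].
have rE i (a : 'I_(e (src i))) (b : 'I_(d (tgt i))) (bd : (b < d (src i))%N) :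
    (g (src i) *m pid_mx (d (src i))) a b = g (src i) a (Ordinal bd).
  rewrite mxE (bigD1 (Ordinal bd)) //= big1 ?addr0 => [|c ca].
    by rewrite !mxE eqxx /= bd mulr1.
  by rewrite mxE; case: eqP => [ac|]; [case/eqP: ca; apply: val_inj | rewrite mulr0].
have rE0 i (a : 'I_(e (src i))) (b : 'I_(d (tgt i))) : (d (src i) <= b)%N ->
    (g (src i) *m pid_mx (d (src i))) a b = 0.
  move=> bd; rewrite mxE big1 // => c _; rewrite mxE; case: eqP => [cb|]; last by rewrite mulr0.
  by have := ltn_ord c; rewrite cb ltnNge bd.
split=> [[gA gL]|[gE g0 gL]].
  suff H (i : 'I_n.+1) : (forall a b, g i a b = lentry (g ord_max) a.+1 b.+1) /\
      (forall x y, (x <= e i)%N -> (d i < y)%N -> lentry (g ord_max) x y = 0).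
    by split=> // i; have [] := H i.
  have [k] := ubnP (n - i)%N; elim: k i => // k IH i nik.
  case: (ltnP i n) => [il|ni]; last first.
    have -> : i = ord_max by apply: val_inj => /=; have := ltn_ord i; lia.
    split=> [a b|x y _ dy]; first by rewrite lentryE.
    by apply: lentry_out; lia.
  have -> : i = src (Ordinal il) by apply: val_inj.
  set j := Ordinal il; have [|IH1 IH2] := IH (tgt j); first by rewrite /= /bump /=; lia.
  have gj := gA j; rewrite /= in gj.
  split=> [a b|x y xe dy].
    have bd : (widen_ord (md j) b < d (src j))%N := ltn_ord b.
    have := rE j a (widen_ord (md j) b) bd; rewrite -gj lE IH1 /= => ->.
    by congr (g _ _ _); apply: val_inj.
  case: (leqP y (d (tgt j))) => [yd|]; last by apply: IH2; apply: leq_trans xe (me j).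
  case: x xe => [_|x xe]; first by apply: lentry_out.
  case: y dy yd => // y dy yd.
  have := rE0 j (Ordinal (xe : x < e (src j))%N) (Ordinal (yd : y < d (tgt j))%N) dy.
  by rewrite -gj lE IH1.
split=> // i /=; apply/matrixP => a b; rewrite lE gE /=.
case: (ltnP b (d (src i))) => bd; first by rewrite rE gE.
by rewrite rE0 // (g0 (src i)).
Qed.

Variables (d e : dimvec n) (s t u v : nat -> nat).
Hypotheses (md : monotone d) (me : monotone e).
Hypothesis st : link_pattern (d ord_max) s t.
Hypothesis uv : link_pattern (e ord_max) u v.

Definition pattern_rep d s t (st : link_pattern (d ord_max) s t) : rep K d :=
  flag_rep (pattern_sq0 K st).

Definition below (x y : nat) : bool := [forall i, (x <= e i)%N ==> (y <= d i)%N].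

Lemma belowPn x y : reflect (exists2 i, x <= e i & d i < y)%N (~~ below x y).
Proof.
rewrite /below negb_forall; apply: (iffP existsP) => [[i nb]|[i xe dy]]; exists i.
- by move: nb; rewrite negb_imply => /andP[].
- by move: nb; rewrite negb_imply -ltnNge => /andP[].
by rewrite negb_imply xe -ltnNge.
Qed.

(** Pairs [(x, y)] for which some morphism sends the label [x] to the label
    [y]: here [x] is not a head, and [y] is available at the step of [x] and
    is sent no higher than [x] is. *)
Definition hom_basis (x y : nat) : bool :=
  [&& v x == 0%N, below x y & (s y == 0%N) || ((u x != 0%N) && below (u x) (s y))].

(** The coefficients at the pairs of [hom_basis] are free coordinates. The
    other coefficients are zero, or are repetitions along the arcs: the
    coefficient at the heads of two arcs is the one at their tails. *)
Lemma homdim_pattern :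
  homdim (pattern_rep uv) (pattern_rep st) =
  (\sum_(1 <= x < (e ord_max).+1) \sum_(1 <= y < (d ord_max).+1) hom_basis x y)%N.
Proof.
set p := e ord_max; set q := d ord_max.
pose Q (ab : 'I_p * 'I_q) := hom_basis ab.1.+1 ab.2.+1.
have -> : (\sum_(1 <= x < p.+1) \sum_(1 <= y < q.+1) hom_basis x y)%N = #|[pred ab | Q ab]|.
  transitivity (\sum_(a < p) \sum_(b < q) Q (a, b))%N.
    rewrite big_add1 /= big_mkord; apply: eq_bigr => a _.
    by rewrite big_add1 /= big_mkord.
  rewrite pair_bigA /= -sum1_card [RHS]big_mkcond /=.
  by apply: eq_bigr => -[a b] _; rewrite inE; case: (Q _).
pose T := {ffun {ab | Q ab} -> K^o}.
have dimT : \dim {: T} = #|[pred ab | Q ab]| by rewrite dimvf /dim /= muln1 card_sig.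
rewrite -dimT.
have homP g : g \in Hom (pattern_rep uv) (pattern_rep st) <->
  [/\ forall i a b, fam_mx g i a b = lentry (fam_mx g ord_max) a.+1 b.+1,
      forall i x y, (x <= e i)%N -> (d i < y)%N -> lentry (fam_mx g ord_max) x y = 0
    & forall x y, (0 < x <= p)%N -> (0 < y <= q)%N ->
        lentry (fam_mx g ord_max) (u x) y = lentry (fam_mx g ord_max) x (t y)].
  rewrite mem_Hom flag_homE //; split=> -[gE g0 gL]; split=> //.
    move=> x y xp yq; rewrite /lentry -(label_pattern K (pattern_0 uv)); last by lia.
    by rewrite -(pattern_label_tr K y st) -(mulmxA _ _ (fam_mx g _)) gL !mulmxA.
  apply: lentry_ext => x y xp yq; have := gL x y xp yq.
  rewrite {1 2}/lentry -(label_pattern K (pattern_0 uv)); last by lia.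
  by rewrite -(pattern_label_tr K y st) /lentry !mulmxA.
apply/eqP; rewrite eqn_leq; apply/andP; split.
  pose ev (g : mxfam K e d) : T := [ffun ab => fam_mx g ord_max (val ab).1 (val ab).2].
  have evl : linear ev.
    by move=> a g h; apply/ffunP => ab; rewrite !ffunE fam_mx_linear !mxE.
  pose evL : {linear mxfam K e d -> T} := HB.pack ev (GRing.isLinear.Build K _ _ _ ev evl).
  apply: (@dim_le_inj _ _ _ evL) => [g _|g /homP[gE g0 gL] ev0]; first exact: memvf.
  have {}ev0 : ev g = 0 by exact: ev0.
  have H0 x y : v x = 0%N -> lentry (fam_mx g ord_max) x y = 0.
    move=> vx; case: (boolP ((0 < x <= p) && (0 < y <= q))%N) => [/andP[xp yq]|]; last exact: lentry_out.
    case: (boolP (below x y)) => [bxy|/belowPn[i xe dy]]; last first.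
      exact: (g0 i).
    case: (boolP (hom_basis x y)) => [hb|].
      case: x y xp yq hb {bxy vx} => // x [] // y xp yq hb.
      pose ab : {ab | Q ab} := exist Q (Ordinal (xp : x < p)%N, Ordinal (yq : y < q)%N) hb.
      by move/ffunP/(_ ab): ev0; rewrite !ffunE /= -lentryE.
    rewrite /hom_basis vx eqxx bxy /= negb_or => /andP[sy].
    have sq : (0 < s y <= q)%N by have [Fy _] := pattern_facts st y; lia.
    have := gL x (s y) xp sq; rewrite (pattern_tK st sy) => <-.
    case: (eqVneq (u x) 0%N) => [->|ux] /=; first by move=> _; apply: lentry_out.
    by case/belowPn => i xe dy; apply: (g0 i).
  have H x y : (0 < x <= p)%N -> (0 < y <= q)%N -> lentry (fam_mx g ord_max) x y = 0.
    move=> xp yq; case: (eqVneq (v x) 0%N) => [|vx]; first exact: H0.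
    have vp : (0 < v x <= p)%N by have [_ Fx] := pattern_facts uv x; lia.
    have := gL (v x) y vp yq; rewrite (pattern_sK uv vx) => ->; apply: H0.
    by have [_ Fx] := pattern_facts uv x; have [Fx' _] := pattern_facts uv (v x); lia.
  apply: fam_mx_inj => i; rewrite fam_mx0; apply/matrixP => a b; rewrite gE mxE; apply: H.
    by rewrite /=; apply: leq_trans (ltn_ord a) (monotone_leq i me).
  by rewrite /=; apply: leq_trans (ltn_ord b) (monotone_leq i md).
pose C (c : T) : 'M[K]_(p, q) :=
  \matrix_(a, b) oapp c 0 (insub (a, b) : option {ab | Q ab}).
have Clin a c c' : C (a *: c + c') = a *: C c + C c'.
  by apply/matrixP => x y; rewrite !mxE; case: insubP => [w _ _|_] /=; rewrite ?mulr0 ?addr0 // !ffunE.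
have C0 c x y : ~~ hom_basis x y -> lentry (C c) x y = 0.
  move=> nb; case: (boolP ((0 < x <= p) && (0 < y <= q))%N) => [/andP[]|]; last exact: lentry_out.
  case: x y nb => // x [] // y nb xp yq.
  rewrite (lentryE _ (Ordinal (xp : x < p)%N) (Ordinal (yq : y < q)%N)) mxE insubN //.
pose H c : 'M[K]_(p, q) := \matrix_(a, b) (lentry (C c) a.+1 b.+1 + lentry (C c) (v a.+1) (t b.+1)).
pose f c : mxfam K e d := fam_of (fun i => \matrix_(a, b) lentry (H c) a.+1 b.+1).
have Hentry c x y : (0 < x <= p)%N -> (0 < y <= q)%N ->
    lentry (H c) x y = lentry (C c) x y + lentry (C c) (v x) (t y).
  by move=> xp yq; rewrite (lentry_fun (fun x y => lentry (C c) x y + lentry (C c) (v x) (t y))).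
have lentry_lin p' q' (A B : 'M[K]_(p', q')) a x y : lentry (a *: A + B) x y = a * lentry A x y + lentry B x y.
  by rewrite /lentry mulmxDr mulmxDl -scalemxAr -scalemxAl !mxE.
have Hlin a c c' : H (a *: c + c') = a *: H c + H c'.
  apply/matrixP => x y; rewrite !mxE Clin !lentry_lin mulrDr; exact: addrACA.
have flin : linear f.
  move=> a c c'; apply: fam_mx_inj => i; rewrite fam_mx_linear !fam_ofK.
  by apply/matrixP => x y; rewrite !mxE Hlin lentry_lin.
pose fL : {linear T -> mxfam K e d} := HB.pack f (GRing.isLinear.Build K _ _ _ f flin).
have fmax c : fam_mx (f c) ord_max = H c.
  by rewrite fam_ofK; apply/matrixP => a b; rewrite mxE lentryE.
apply: (@dim_le_inj _ _ _ fL) => [c _|c _ fc0].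
  apply/(homP (f c)); rewrite fmax; split=> [i a b|i x y xe dy|x y xp yq].
  - by rewrite fam_ofK mxE.
  - case: (boolP ((0 < x <= p) && (0 < y <= q))%N) => [/andP[xp yq]|]; last exact: lentry_out.
    have nb : ~~ below x y by apply/belowPn; exists i.
    rewrite Hentry // C0 ?add0r; last by rewrite /hom_basis (negPf nb) andbF.
    case: (eqVneq (t y) 0%N) => [->|ty]; first by apply: lentry_out; lia.
    case: (eqVneq (v x) 0%N) => [->|vx]; first by apply: lentry_out; lia.
    apply: C0; rewrite /hom_basis (pattern_sK st ty) (pattern_sK uv vx) (negPf nb).
    by apply/negP => /and3P[_ _ /orP[|/andP[_]]] //; lia.
  - have tty : t (t y) = 0%N.
      case: (eqVneq (t y) 0%N) => [ty|ty]; last first.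
        by have [_ Fy] := pattern_facts st y; have [Fty _] := pattern_facts st (t y); lia.
      by rewrite ty; have [_ F0] := pattern_facts st 0%N; lia.
    have -> : lentry (H c) x (t y) = lentry (C c) x (t y).
      case: (eqVneq (t y) 0%N) => [->|ty]; first by rewrite !lentry_out //; lia.
      rewrite Hentry //; last by have [_ Fy] := pattern_facts st y; lia.
      by rewrite tty [X in _ + X]lentry_out ?addr0 //; lia.
    case: (eqVneq (u x) 0%N) => [ux|ux].
      rewrite ux lentry_out; last by lia.
      case: (eqVneq (t y) 0%N) => [->|ty]; first by rewrite lentry_out //; lia.
      rewrite C0 // /hom_basis (pattern_sK st ty) ux eqxx orbF.
      by apply/negP => /and3P[_ _]; lia.
    have [Fx _] := pattern_facts uv x.
    rewrite Hentry //; last by lia.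
    rewrite (pattern_tK uv ux) C0 ?add0r // /hom_basis (pattern_tK uv ux).
    by have -> : (x == 0%N) = false by lia.
have {}fc0 : f c = 0 by exact: fc0.
apply/ffunP => -[[a b] hb]; rewrite [RHS]ffunE.
have := fmax c; rewrite fc0 fam_mx0 => /matrixP/(_ a b); rewrite !mxE.
have /andP[/eqP /= va _] : hom_basis a.+1 b.+1 := hb.
rewrite va [X in _ + X]lentry_out ?addr0; last by lia.
rewrite lentryE mxE => /esym.
by rewrite (insubT Q hb).
Qed.

End HomDimension.

(** * Elementary moves are degenerations *)

Section Moves.
Variables (K : fieldType) (n : nat).
Hypothesis char0 : [pchar K] =i pred0.
Variable d : dimvec n.
Hypothesis md : monotone d.
Local Notation m := (d ord_max).
Local Notation label := (label K m).

(** The operators [L z] are conjugate to the pattern [s], for [z != 0], by the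
    triangular matrix with rows [H z], and specialise to the pattern [u]. *)
Lemma deg_pattern_line s t u v (st : link_pattern m s t) (uv : link_pattern m u v)
    (L1 L2 : 'M[K]_m) (H : K -> nat -> 'rV[K]_m) :
    (forall z x, z != 0 -> (0 < x <= m)%N ->
       H z x *m (pattern_mx K m u + z *: L1 + z ^+ 2 *: L2) =
         if s x == 0%N then 0 else H z (s x)) ->
    (forall z x, z != 0 -> (0 < x <= m)%N ->
       exists2 c, c != 0 & in_flag (H z x - c *: label x) x.-1) ->
  deg_le (pattern_rep K st) (pattern_rep K uv).
Proof.
move=> HL Hlead; pose L z := pattern_mx K m u + z *: L1 + z ^+ 2 *: L2.
pose h z := of_rows (H z).
have hL z : z != 0 -> h z *m L z = pattern_mx K m s *m h z.
  move=> z0; apply: label_ext => x xm; rewrite !mulmxA label_mul // HL //.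
  rewrite label_pattern ?(pattern_0 st) //; last by lia.
  case: (eqVneq (s x) 0%N) => [->|sx]; first by rewrite label0 mul0mx.
  by rewrite label_mul //; have [Fx _] := pattern_facts st x; lia.
have htrig z : z != 0 -> forall a b : 'I_m, (a < b)%N -> h z a b = 0.
  move=> z0 a b ab; have am : (0 < a.+1 <= m)%N by rewrite /= ltn_ord.
  have [c c0 /(_ b)] := Hlead z a.+1 z0 am; rewrite !mxE => /(_ (ltnW ab)).
  have -> : (a.+1 == b.+1)%N = false by lia.
  by rewrite mulr0 subr0.
have hdiag z : z != 0 -> forall a : 'I_m, h z a a != 0.
  move=> z0 a; have am : (0 < a.+1 <= m)%N by rewrite /= ltn_ord.
  have [c c0 /(_ a)] := Hlead z a.+1 z0 am; rewrite !mxE => /(_ (leqnn _)).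
  by rewrite eqxx mulr1 => /eqP; rewrite subr_eq0 => /eqP ->.
have L0 : L 0 = pattern_mx K m u by rewrite /L expr0n !scale0r !addr0.
have LL z : L z *m L z = 0.
  case: (eqVneq z 0) => [->|z0]; first by rewrite L0; apply: pattern_sq0 uv.
  have uh : h z \in unitmx.
    rewrite unitmxE det_trig; last exact/is_trig_mxP/htrig.
    by rewrite unitfE; apply/prodf_neq0 => a _; apply: hdiag.
  apply: (can_inj (mulKmx uh)); rewrite mulmx0 mulmxA hL // -mulmxA hL // mulmxA.
  by rewrite (pattern_sq0 K st) mul0mx.
pose q (c : coord d) : {poly K} := match c with
  | inl ab => (pid_mx (d (src (tag ab))) (tagged ab).1 (tagged ab).2 : K)%:P
  | inr ab => (pattern_mx K m u ab.1 ab.2)%:P + (L1 ab.1 ab.2)%:P * 'X + (L2 ab.1 ab.2)%:P * 'X^2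
  end.
have := @deg_le_curve K n d (pattern_rep K st) (fun z => flag_rep (LL z)) q char0 _ _.
move=> D; apply: deg_le_trans (D _ _) _ => [z [ab|ab]|z z0|].
- by rewrite /= hornerC.
- by rewrite /= !hornerD !hornerM !hornerC !hornerX !mxE; ring.
- apply: iso_sym; apply: (triangular_iso (fun i => monotone_leq i md) (LL z) _ (htrig z z0) (hdiag z z0)) => //.
  exact: hL.
by apply: deg_le_iso; exists (fun i => 1%:M), (fun i => 1%:M);
   split=> [||i|i]; rewrite ?mulmx1 //; split=> [i|] /=; rewrite ?mul1mx ?mulmx1 // L0.
Qed.

(** The curve is the conjugate of the pattern [u] by [1 + z F], where [F] sends
    the label [x] to the label [y]. For [x < y], the only case of interest,
    this matrix does not preserve the flag, so that the curve may leave the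
    orbit of the pattern [u]. *)
Lemma deg_pattern_swap s t u v (st : link_pattern m s t) (uv : link_pattern m u v) x y
    (H : K -> nat -> 'rV[K]_m) : (0 < x <= m)%N -> (0 < y <= m)%N -> x != y ->
    let G z j := label j - (z * (j == x)%:R) *: label y in
    (forall z (L : 'M[K]_m), z != 0 ->
       (forall i, (i <= m)%N -> label i *m L = G z (u i) + (z * (i == x)%:R) *: G z (u y)) ->
       forall i, (0 < i <= m)%N -> H z i *m L = if s i == 0%N then 0 else H z (s i)) ->
    (forall z i, z != 0 -> (0 < i <= m)%N ->
       exists2 c, c != 0 & in_flag (H z i - c *: label i) i.-1) ->
  deg_le (pattern_rep K st) (pattern_rep K uv).
Proof.
move=> xm ym xy G HG Hlead.
pose F : 'M[K]_m := of_rows (fun i => (i == x)%:R *: label y).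
pose P := pattern_mx K m u.
apply: (@deg_pattern_line s t u v st uv (F *m P - P *m F) (- (F *m P *m F)) H) => // z i z0 im.
apply: (HG z _ z0) => // {im}i im.
have labelF j : (j <= m)%N -> label j *m F = (j == x)%:R *: label y.
  move=> jm; case: (posnP j) => [->|j0]; last by rewrite label_mul // j0.
  by have -> : (0%N == x)%N = false by [lia]; rewrite label0 mul0mx [_ *: _]scale0r.
have u0 := pattern_0 uv.
have labelP j : (j <= m)%N -> label j *m P = label (u j) by exact: label_pattern.
have GE j : (j <= m)%N -> G z j = label j - z *: (label j *m F).
  by move=> jm; rewrite labelF // scalerA.
have um j : (u j <= m)%N := pattern_le j uv.
have ym' : (y <= m)%N by lia.
rewrite !GE ?um // mulmxDr mulmxDr -!scalemxAr mulmxDr !mulmxN !mulmxA -/P.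
rewrite (labelF i) // -!scalemxAl (labelP i) // (labelP y) //.
move: (label (u i)) (label (u i) *m F) (label (u y)) (label (u y) *m F) => A B C D.
rewrite !scalerBr !scalerN !scalerA addrA [RHS]addrA [A - _ + _]addrAC.
by congr (_ - _ *: _); ring.
Qed.

Lemma lead_label x : exists2 c : K, c != 0 & in_flag (label x - c *: label x) x.-1.
Proof. by exists 1; [exact: oner_neq0|move=> b _; rewrite scale1r subrr mxE]. Qed.

Lemma lead_scale c v x : c != 0 ->
  (exists2 a, a != 0 & in_flag (v - a *: label x) x.-1) ->
  exists2 a, a != 0 & in_flag (c *: v - a *: label x) x.-1.
Proof.
move=> c0 [a a0 va]; exists (c * a); first by rewrite mulf_neq0.
by rewrite -scalerA -scalerBr; apply: in_flagZ.
Qed.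

Lemma lead_add w v x : in_flag w x.-1 ->
  (exists2 a, a != 0 & in_flag (v - a *: label x) x.-1) ->
  exists2 a, a != 0 & in_flag (w + v - a *: label x) x.-1.
Proof. by move=> wx [a a0 va]; exists a => //; rewrite -addrA; apply: in_flagD. Qed.

Lemma in_flag_label_lt j x : (j < x)%N -> in_flag (label j) x.-1.
Proof. by move=> jx; apply: in_flagW (@in_flag_label K m j); lia. Qed.

(** For the exchange of [x] and [y], the vector [label x - z *: label y] plays
    the role of the label [y], and the head of the arc leaving [x] is scaled
    by [z] accordingly; for a deletion the head of the arc is scaled. *)
Theorem elementary_move_deg s t u v (st : link_pattern m s t) (uv : link_pattern m u v) :
  elementary_move m s t u v -> deg_le (pattern_rep K st) (pattern_rep K uv).
Proof.
have F := pattern_facts st.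
case=> [x y xy ym ty sxy uE vE|k z z0 zk sz tz uE vE|x y xy sx ty tyx uE vE
       |x sx xsx uE vE|k sk uE vE].
- have [Fx _] := F x; have [Fy _] := F y.
  pose H (c : K) i := if i == y then label x - c *: label y
                else if i == s x then label (s y) + c *: label (s x) else label i.
  have sx0 : s x != 0%N by lia.
  have Hl c i : i <> y -> i <> s x -> H c i = label i.
    by rewrite /H => /eqP/negPf -> /eqP/negPf ->.
  have Ha c : H c (s x) = label (s y) + c *: label (s x).
    rewrite /H eqxx; case: eqP => // e; have [_ Fsx] := F (s x); rewrite e in Fsx Fx; lia.
  have Hy c : H c y = label x - c *: label y by rewrite /H eqxx.
  apply: (@deg_pattern_swap s t u v st uv x y H); try lia.
    move=> c L c0 LE i im.
    have nx j : u j <> x.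
      rewrite uE; case: eqP => _; first exact: (pattern_head_neq_tail st sx0).
      by case: eqP => _; exact: (pattern_head_neq_tail st sx0).
    have {}LE j : (j <= m)%N -> label j *m L = label (u j) + (c * (j == x)%:R) *: label (s x).
      move=> jm; rewrite LE //; congr (_ + _ *: _).
        by rewrite (introF eqP (nx j)) mulr0 scale0r subr0.
      rewrite (introF eqP (nx y)) mulr0 scale0r subr0 uE eqxx.
      by have -> : (y == x) = false by lia.
    have ux : u x = s y by rewrite uE eqxx.
    have uy : u y = s x by rewrite uE eqxx; have -> : (y == x) = false by lia.
    have headE h : (h = s x \/ h = s y) -> label h *m L = 0.
      move=> hE; case: (posnP h) => [->|h0]; first by rewrite label0 mul0mx.
      have sh : s h = 0%N by case: hE => e; have [Fh Fh'] := F h; have := F x; have := F y; rewrite e in Fh Fh' *; lia.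
      rewrite LE; last by case: hE => ->; lia.
      have hx : h <> x by move=> e; rewrite e in sh; lia.
      have hy : h <> y.
        by move=> e; have [_ Fh] := F h; case: hE => e'; rewrite e' in Fh; rewrite -e e' in ty; lia.
      rewrite (introF eqP hx) mulr0 scale0r addr0 uE (introF eqP hx) (introF eqP hy).
      by rewrite sh label0.
    case: (eqVneq i x) => [->|/eqP ix].
      rewrite (negPf sx0) Ha Hl; [|lia|exact: nesym (pattern_head_neq_tail st sx0)].
      by rewrite LE ?ux ?eqxx ?mulr1 //; lia.
    case: (eqVneq i y) => [->|/eqP iy].
      rewrite Hy mulmxBl -scalemxAl !LE; try lia.
      rewrite ux uy eqxx mulr1; have -> : (y == x) = false by lia.
      rewrite mulr0 scale0r addr0 addrK.
      case: (eqVneq (s y) 0%N) => [->|sy]; first by rewrite label0.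
      rewrite Hl //; last by lia.
      by move=> e; rewrite e in Fy; have := F y; lia.
    case: (eqVneq i (s x)) => [->|/eqP ia].
      rewrite Ha mulmxDl -scalemxAl !headE; [|by left|by right].
      by rewrite scaler0 addr0; have [Fsx Fsx'] := F (s x); have -> : s (s x) == 0%N by lia.
    rewrite Hl // LE; last by lia.
    rewrite (introF eqP ix) mulr0 scale0r addr0 uE (introF eqP ix) (introF eqP iy).
    case: (eqVneq (s i) 0%N) => [->|si]; first by rewrite label0.
    rewrite Hl //; first by move=> e; have [Fi _] := F i; rewrite e in Fi; lia.
    by move/(pattern_s_inj st sx0).
  move=> c i c0 im; rewrite /H; case: (eqVneq i y) => [->|_].
    by apply: lead_add (in_flag_label_lt xy) _; rewrite -scaleNr; apply: lead_scale (lead_label y); rewrite oppr_eq0.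
  case: (eqVneq i (s x)) => [->|_]; last exact: lead_label.
  by apply: lead_add (in_flag_label_lt sxy) _; apply: lead_scale (lead_label _).
- have sk : s k != 0%N by lia.
  have [Fk _] := F k; have [Flk Flk'] := F (s k).
  pose H (c : K) i := if i == s k then label z - c *: label (s k) else label i.
  have Hl c i : i <> s k -> H c i = label i by rewrite /H => /eqP/negPf ->.
  have Ha c : H c (s k) = label z - c *: label (s k) by rewrite /H eqxx.
  have kz : k <> z by move=> e; move: sk; rewrite e sz.
  have uz : u z = 0%N by rewrite uE (introF eqP (nesym kz)).
  have ul : u (s k) = 0%N.
    by rewrite uE; case: eqP => e; [have := pattern_head_neq_tail st sk e | lia].
  apply: (@deg_pattern_swap s t u v st uv z (s k) H); try lia.
    move=> c L c0; rewrite ul => LE i im.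
    have {}LE j : (j <= m)%N -> label j *m L = label (u j) - (c * (u j == z)%:R) *: label (s k).
      move=> jm; rewrite LE // label0.
      have -> : (0%N == z) = false by lia.
      by rewrite mulr0 scale0r subr0 scaler0 addr0.
    case: (eqVneq i (s k)) => [->|/eqP ia].
      rewrite Ha mulmxBl -scalemxAl !LE ?uz ?ul; try lia.
      have -> : (0%N == z) = false by lia.
      by rewrite label0 mulr0 scale0r subr0 scaler0 subr0; have -> : s (s k) == 0%N by lia.
    case: (eqVneq i k) => [->|/eqP ik].
      rewrite (negPf sk) Ha Hl ?LE; [|lia|by move=> e; have := pattern_head_neq_tail st sk (esym e)].
      by rewrite uE !eqxx mulr1.
    rewrite Hl // LE; last by lia.
    rewrite uE (introF eqP ik).
    have -> : (s i == z) = false by apply/eqP => e; have [Fi _] := F i; rewrite e in Fi; lia.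
    rewrite mulr0 scale0r subr0; case: (eqVneq (s i) 0%N) => [->|si]; first by rewrite label0.
    by rewrite Hl //; move/(pattern_s_inj st sk).
  move=> c i c0 im; rewrite /H; case: (eqVneq i (s k)) => [->|_]; last exact: lead_label.
  apply: lead_add (in_flag_label_lt zk) _; rewrite -scaleNr; apply: lead_scale (lead_label _).
  by rewrite oppr_eq0.
- have [Fx _] := F x; have [_ Fy] := F y.
  have [Fsx Fsx'] := F (s x); have [Fty Fty'] := F (t y).
  pose H (c : K) i := if i == y then label x - c *: label y
                else if i == s x then c *: label (s x) else label i.
  have xa := pattern_head_neq_tail st sx (i := x).
  have ya : s x <> y by move=> e; move: tyx; rewrite -e (pattern_tK st sx) eqxx.
  have Hl c i : i <> y -> i <> s x -> H c i = label i.
    by rewrite /H => /eqP/negPf -> /eqP/negPf ->.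
  have Ha c : H c (s x) = c *: label (s x) by rewrite /H eqxx (introF eqP ya).
  have Hy c : H c y = label x - c *: label y by rewrite /H eqxx.
  have by' : t y <> y by move=> e; rewrite e in Fy; lia.
  have ba : t y <> s x by move=> e; rewrite e in Fy Fty; lia.
  have ux : u x = 0%N by rewrite uE eqxx.
  have uy : u y = s x by rewrite uE eqxx; have -> : (y == x) = false by lia.
  have ub : u (t y) = x by rewrite uE (negPf tyx) (introF eqP by') eqxx.
  have ua : u (s x) = 0%N by rewrite uE (introF eqP xa) (introF eqP ya) (introF eqP (nesym ba)); lia.
  apply: (@deg_pattern_swap s t u v st uv x y H); try lia.
    move=> c L c0; rewrite uy (introF eqP xa) mulr0 scale0r subr0 => LE i im.
    case: (eqVneq i x) => [->|/eqP ix].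
      rewrite (negPf sx) Ha Hl ?LE ?ux ?eqxx; [|lia|lia|exact: nesym].
      have -> : (0%N == x) = false by lia.
      by rewrite label0 mulr0 scale0r subr0 add0r mulr1.
    case: (eqVneq i y) => [->|/eqP iy].
      rewrite Hy mulmxBl -scalemxAl !LE ?uy ?ux ?eqxx; try lia.
      have -> : (0%N == x) = false by lia.
      have -> : (y == x) = false by lia.
      rewrite (introF eqP xa) label0 !mulr0 !scale0r !subr0 add0r addr0 mulr1 subrr.
      by have -> : s y == 0%N by lia.
    case: (eqVneq i (s x)) => [->|/eqP ia].
      rewrite Ha -scalemxAl LE ?ua; last by lia.
      have -> : (0%N == x) = false by lia.
      rewrite (introF eqP xa) label0 !mulr0 !scale0r subr0 addr0 scaler0.
      by have -> : s (s x) == 0%N by lia.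
    rewrite Hl // LE; last by lia.
    rewrite (introF eqP ix) mulr0 scale0r addr0.
    case: (eqVneq i (t y)) => [->|/eqP ib].
      by rewrite ub eqxx mulr1 (pattern_sK st ty) Hy; have -> : (y == 0%N) = false by lia.
    rewrite uE (introF eqP ix) (introF eqP iy) (introF eqP ib).
    rewrite (introF eqP (pattern_head_neq_tail st sx (i := i))) mulr0 scale0r subr0.
    case: (eqVneq (s i) 0%N) => [->|si]; first by rewrite label0.
    rewrite Hl //; first by move=> e; have := pattern_tK st si; rewrite e; lia.
    by move/(pattern_s_inj st sx).
  move=> c i c0 im; rewrite /H; case: (eqVneq i y) => [->|_].
    apply: lead_add (in_flag_label_lt xy) _; rewrite -scaleNr; apply: lead_scale (lead_label _).
    by rewrite oppr_eq0.
  by case: (eqVneq i (s x)) => [->|_]; [apply: lead_scale (lead_label _)|exact: lead_label].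
- have [Fx _] := F x; have [Fsx Fsx'] := F (s x).
  pose H (c : K) i := if i == s x then c *: (label x - c *: label (s x)) else label i.
  have xa := pattern_head_neq_tail st sx (i := x).
  have Hl c i : i <> s x -> H c i = label i by rewrite /H => /eqP/negPf ->.
  have Ha c : H c (s x) = c *: (label x - c *: label (s x)) by rewrite /H eqxx.
  have ux : u x = 0%N by rewrite uE eqxx.
  have ua : u (s x) = x by rewrite uE (introF eqP xa) eqxx.
  apply: (@deg_pattern_swap s t u v st uv x (s x) H); try lia.
    move=> c L c0; rewrite ua eqxx mulr1 => LE i im.
    have e0 : (0%N == x) = false by lia.
    case: (eqVneq i x) => [->|/eqP ix].
      rewrite (negPf sx) Ha Hl ?LE ?ux ?e0 ?eqxx; [|lia|exact: nesym].
      by rewrite label0 mulr0 scale0r subr0 add0r mulr1.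
    case: (eqVneq i (s x)) => [->|/eqP ia].
      rewrite Ha -scalemxAl mulmxBl -scalemxAl !LE ?ux ?ua ?e0 ?eqxx; try lia.
      rewrite label0 (introF eqP xa) !mulr0 !scale0r subr0 add0r addr0 !mulr1 subrr scaler0.
      by have -> : s (s x) == 0%N by lia.
    rewrite Hl // LE; last by lia.
    rewrite (introF eqP ix) mulr0 scale0r addr0 uE (introF eqP ix) (introF eqP ia).
    rewrite (introF eqP (pattern_head_neq_tail st sx (i := i))) mulr0 scale0r subr0.
    case: (eqVneq (s i) 0%N) => [->|si]; first by rewrite label0.
    by rewrite Hl //; move/(pattern_s_inj st sx).
  move=> c i c0 im; rewrite /H; case: (eqVneq i (s x)) => [->|_]; last exact: lead_label.
  apply: lead_scale => //; apply: lead_add (in_flag_label_lt xsx) _.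
  by rewrite -scaleNr; apply: lead_scale (lead_label _); rewrite oppr_eq0.
have [Fk _] := F k; have [Fsk Fsk'] := F (s k).
pose H (c : K) i := if i == s k then c *: label (s k) else label i.
have Hl c i : i <> s k -> H c i = label i by rewrite /H => /eqP/negPf ->.
have Ha c : H c (s k) = c *: label (s k) by rewrite /H eqxx.
have kl := pattern_head_neq_tail st sk (i := k).
pose L1 : 'M[K]_m := of_rows (fun i => (i == k)%:R *: label (s k)).
apply: (@deg_pattern_line s t u v st uv L1 0 H) => c i c0 im; last first.
  rewrite /H; case: (eqVneq i (s k)) => [->|_]; last exact: lead_label.
  exact: lead_scale (lead_label _).
have LE j : (0 < j <= m)%N -> label j *m (pattern_mx K m u + c *: L1 + c ^+ 2 *: 0) =
    label (u j) + (c * (j == k)%:R) *: label (s k).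
  by move=> jm; rewrite scaler0 addr0 mulmxDr -scalemxAr !label_mul // scalerA.
case: (eqVneq i (s k)) => [->|/eqP ia].
  rewrite Ha -scalemxAl LE; last by lia.
  rewrite uE (introF eqP kl) mulr0 scale0r addr0.
  have -> : s (s k) = 0%N by [lia]; by rewrite eqxx label0 scaler0.
rewrite Hl // LE // uE; case: (eqVneq i k) => [->|/eqP ik].
  by rewrite label0 add0r mulr1 (negPf sk) Ha.
rewrite mulr0 scale0r addr0; case: (eqVneq (s i) 0%N) => [->|si]; first by rewrite label0.
by rewrite Hl //; move/(pattern_s_inj st sk).
Qed.

End Moves.

(** * Corner counts and degenerations *)

Local Close Scope ring_scope.

Section Thin.
Variables (K : fieldType) (n : nat).
Implicit Types d e f : dimvec n.

Definition thin d : Prop := d ord0 <= 1 /\ forall i : 'I_n, d (src i) <= d (tgt i) <= (d (src i)).+1.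

Lemma thin_monotone d : thin d -> monotone d.
Proof. by move=> [_ td] i; have /andP[] := td i. Qed.

Lemma monotone_le d (i j : 'I_n.+1) : monotone d -> i <= j -> d i <= d j.
Proof.
move=> md; have [k] := ubnP (j - i); elim: k j => // k IH j jik ij.
case: (eqVneq i j) => [->//|ne].
have ij' : i < j by rewrite ltn_neqAle ij andbT.
have jn : j.-1 < n by have := ltn_ord j; lia.
have je : j = tgt (Ordinal jn) by apply: val_inj; rewrite /= /bump /=; lia.
rewrite je; apply: leq_trans (md _); apply: IH => /=; lia.
Qed.

(** Every label appears as the last one at some vertex, so that the vertices
    separate the steps of the flag. *)
Lemma thin_hit d x : thin d -> 0 < x <= d ord_max -> exists i, d i = x.
Proof.
move=> [d0 td] /andP[x0 xm].
have [i xi imin] : exists2 i : 'I_n.+1, x <= d i & forall j : 'I_n.+1, j < i -> ~~ (x <= d j).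
  have [k [i [ik xi]] kmin] := @least_nat (fun k => exists i : 'I_n.+1, val i = k /\ x <= d i)
    (ex_intro _ n (ex_intro _ ord_max (conj erefl xm))).
  by exists i => // j ji; apply/negP => xj; apply: (kmin j); [rewrite -ik|exists j].
exists i; apply/eqP; rewrite eqn_leq xi andbT.
case: (posnP i) => [i0|i0].
  have -> : i = ord0 by apply: val_inj.
  exact: leq_trans d0 x0.
have jn : i.-1 < n by have := ltn_ord i; lia.
have ie : i = tgt (Ordinal jn) by apply: val_inj; rewrite /= /bump /=; lia.
have := imin (src (Ordinal jn)); have := td (Ordinal jn); rewrite -ie /=; lia.
Qed.

Lemma below_thin d x y : thin d -> 0 < x <= d ord_max -> below d d x y = (y <= x).
Proof.
move=> td xm; apply/forallP/idP => [H|yx i]; last by apply/implyP; apply: leq_trans.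
by have [i di] := thin_hit td xm; have := H i; rewrite di leqnn.
Qed.

Lemma homdim_pattern_end d s t (st : link_pattern (d ord_max) s t) : thin d ->
  homdim (pattern_rep K st) (pattern_rep K st) = end_count (d ord_max) s t.
Proof.
move=> td; have md := thin_monotone td.
rewrite homdim_pattern //; apply: eq_big_nat => x xm.
rewrite /corner_count big_distrr /=; apply: eq_big_nat => y ym.
rewrite /hom_basis; case: (t x == 0); rewrite ?mul0n //= mul1n below_thin //.
congr nat_of_bool; congr (_ && _).
case: (eqVneq (s y) 0) => [->|sy] //=.
case: (eqVneq (s x) 0) => [->|sx] /=; first by lia.
by rewrite below_thin //; have := pattern_range st sx; lia.
Qed.

Section TestObject.
Variables (p q : nat).
Definition test_dim : dimvec n := fun i => (p <= i) + (q <= i).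

(** One label appears at vertex [p] and its image at vertex [q]; when
    [q > n] the second label is missing and the loop vanishes. *)
Definition test_tail (x : nat) : nat :=
  if n < q then 0 else if p <= q then (if x == 1 then 2 else 0) else (if x == 2 then 1 else 0).
Definition test_head (x : nat) : nat :=
  if n < q then 0 else if p <= q then (if x == 2 then 1 else 0) else (if x == 1 then 2 else 0).

Lemma test_pattern : p <= n -> link_pattern (test_dim ord_max) test_tail test_head.
Proof.
move=> pn; rewrite /test_dim /test_tail /test_head /= pn.
case: (ltnP n q) => nq; first by split.
case: (leqP p q) => pq; split=> x;
  by case: (eqVneq x 1) => [->|n1] //=; case: (eqVneq x 2) => [->|n2] //=; rewrite nq.
Qed.

Lemma homdim_test d s t (st : link_pattern (d ord_max) s t) (pn : p <= n) :
  monotone d ->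
  homdim (pattern_rep K (test_pattern pn)) (pattern_rep K st) =
  corner_count (d ord_max) s (d (inord p)) (if n < q then 0 else d (inord q)).
Proof.
move=> md.
have mt : monotone test_dim by move=> i; rewrite /test_dim /= /bump /=; lia.
have pE : (inord p : 'I_n.+1) = p :> nat by rewrite inordK.
have qE : q <= n -> (inord q : 'I_n.+1) = q :> nat by move=> qn; rewrite inordK.
rewrite homdim_pattern //.
have belowE x y r : (r <= n) -> (forall i : 'I_n.+1, (x <= test_dim i) = (r <= i)) ->
    below d test_dim x y = (y <= d (inord r)).
  move=> rn xr; apply/forallP/idP => [H|yr i].
    by have := H (inord r); rewrite xr inordK // leqnn.
  apply/implyP; rewrite xr => ri; apply: leq_trans yr _.
  by apply: monotone_le => //; rewrite inordK.
rewrite /corner_count exchange_big /=; apply: eq_big_nat => y ym.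
have [x0 [x0m x0p x0b x0t]] : exists x0, [/\ 0 < x0 <= test_dim ord_max,
    (forall i : 'I_n.+1, (x0 <= test_dim i) = (p <= i)),
    (forall x, 0 < x <= test_dim ord_max -> (test_head x == 0) = (x == x0)) &
    if n < q then test_tail x0 = 0 else test_tail x0 <> 0 /\
       forall i : 'I_n.+1, (test_tail x0 <= test_dim i) = (q <= i)].
  rewrite /test_dim /test_tail /test_head /= pn; case: (ltnP n q) => nq.
    exists 1; split=> //; first by move=> i; have := ltn_ord i; lia.
    by move=> x; lia.
  case: (leqP p q) => pq.
    exists 1; split=> //=; first by move=> i; lia.
      by move=> x; case: (eqVneq x 2) => [->|x2] //=; lia.
    by split=> // i; lia.
  exists 2; split=> //=; first by move=> i; lia.
    by move=> x; case: (eqVneq x 1) => [->|x1] //=; lia.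
  by split=> // i; lia.
rewrite (@sum_le1 _ _ x0) //; last first.
  by move=> x xm xx0; rewrite /hom_basis x0b // (negPf xx0).
rewrite /hom_basis x0b // eqxx (belowE _ _ p) //=; congr nat_of_bool; congr (_ && _).
move: x0t; case: (ltnP n q) => nq => [->|[tx0 qx0]]; first by rewrite orbF leqn0.
rewrite (introF eqP tx0) /= (belowE _ _ q) //.
by case: (eqVneq (s y) 0) => [->|].
Qed.

End TestObject.

(** Corner counts are dimensions of morphisms from test objects, which can
    only grow under degeneration. *)
Lemma corner_count_deg_le d s t u v (st : link_pattern (d ord_max) s t) (uv : link_pattern (d ord_max) u v) :
  thin d -> deg_le (pattern_rep K st) (pattern_rep K uv) ->
  forall p q, corner_count (d ord_max) s p q <= corner_count (d ord_max) u p q.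
Proof.
move=> td D p q; have md := thin_monotone td; set m := d ord_max.
have le_m (a b : nat -> nat) q' : link_pattern m a b -> m <= q' ->
    forall p', corner_count m a p' q' = corner_count m a p' m.
  move=> ab mq p'; apply: eq_big_nat => i im.
  by have [Fi _] := pattern_facts ab i; lia.
wlog pm : p / p <= m => [H|].
  case: (leqP p m) => [/H //|/ltnW mp].
  by rewrite (corner_count_sat s q mp) (corner_count_sat u q mp); apply: H.
wlog qm : q / q <= m => [H|].
  case: (leqP q m) => [/H //|/ltnW mq].
  by rewrite (le_m _ _ _ st mq) (le_m _ _ _ uv mq); apply: H.
case: (posnP p) => [->|p0].
  by rewrite /corner_count big1_seq // => i; rewrite mem_index_iota; lia.
have [|i di] := thin_hit td (x := p); first by rewrite p0.
have in' : i <= n by rewrite -ltnS ltn_ord.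
have inK : inord i = i by apply: val_inj; rewrite /= inordK.
case: (posnP q) => [->|q0].
  have := homdim_deg_le_cod (pattern_rep K (test_pattern n.+1 in')) D.
  by rewrite !homdim_test // ltnSn inK di.
have [|j dj] := thin_hit td (x := q); first by rewrite q0.
have jn : (n < j) = false by have := ltn_ord j; lia.
have jnK : inord j = j by apply: val_inj; rewrite /= inordK.
have := homdim_deg_le_cod (pattern_rep K (test_pattern j in')) D.
by rewrite !homdim_test // jn inK jnK di dj.
Qed.

End Thin.

Local Open Scope ring_scope.
Local Open Scope complex_scope.

(** * Minimal degenerations have codimension one *)

Section Codimension.
Variables (K : fieldType) (n : nat).
Hypothesis char0 : [pchar K] =i pred0.
Implicit Types d e f : dimvec n.

Lemma pattern_of_rep d (M : rep K d) : rep_inj M ->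
  exists s t (st : link_pattern (d ord_max) s t), iso M (pattern_rep K st).
Proof.
move=> injM; have md := inj_monotone injM.
have [L [LL ML]] := flag_rep_exists injM.
have [s [t [h [st htrig hdiag hL]]]] := normal_form LL.
exists s, t, st; apply: iso_trans ML _.
by apply: (triangular_iso (fun i => monotone_leq i md) LL _ htrig hdiag hL md).
Qed.

Lemma pattern_rep_ext d s t u v (st : link_pattern (d ord_max) s t)
  (uv : link_pattern (d ord_max) u v) :
  (forall i, s i = u i) -> iso (pattern_rep K st) (pattern_rep K uv).
Proof.
move=> su; have e : pattern_mx K (d ord_max) s = pattern_mx K (d ord_max) u.
  by apply/matrixP => a b; rewrite !mxE su.
by exists (fun i => 1%:M), (fun i => 1%:M);
   split=> [||i|i]; rewrite ?mulmx1 //; split=> [i|] /=; rewrite ?mul1mx ?mulmx1 // e.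
Qed.

(** Elementary moves are applied until the larger pattern is reached; the
    process stops because [end_count] grows at each move and is bounded. *)
Lemma corner_count_le_deg d (td : thin d) s t u v (st : link_pattern (d ord_max) s t)
    (uv : link_pattern (d ord_max) u v) :
    (forall p q, (corner_count (d ord_max) s p q <= corner_count (d ord_max) u p q)%N) ->
  deg_le (pattern_rep K st) (pattern_rep K uv) /\
  ((exists i, s i <> u i) -> (end_count (d ord_max) s t < end_count (d ord_max) u v)%N).
Proof.
have md := thin_monotone td; set B := \dim {: mxfam K d d}.
have cB s' t' (st' : link_pattern (d ord_max) s' t') : (end_count (d ord_max) s' t' <= B)%N.
  by rewrite -(homdim_pattern_end K st' td); apply: dimvS (subvf _).
have [k] := ubnP (B - end_count (d ord_max) s t)%N.
elim: k s t st => // k IH s t st Bk le_su.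
case: (pselect (exists i, s i <> u i)) => [su|same]; last first.
  split=> // {k IH Bk}; apply/deg_le_iso/pattern_rep_ext => i.
  by apply: contrapT => si; apply: same; exists i.
have [s1 [t1 [mv le1 c1]]] := move_below st uv le_su su.
have st1 := move_pattern st mv; have c1B := cB _ _ st1.
have [|D1 C1] := IH s1 t1 st1 _ le1; first by lia.
split=> [|_]; first by apply: deg_le_trans D1; apply: elementary_move_deg mv.
case: (pselect (exists i, s1 i <> u i)) => [/C1|same]; first by lia.
suff -> : end_count (d ord_max) u v = end_count (d ord_max) s1 t1 by lia.
have us : iso (pattern_rep K uv) (pattern_rep K st1).
  by apply: pattern_rep_ext => i; apply: contrapT => si; apply: same; exists i; apply: nesym.
rewrite -(homdim_pattern_end K uv td) -(homdim_pattern_end K st1 td).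
exact: (homdim_iso us us).
Qed.

(** The first elementary move towards the pattern of [M'] gives the
    intermediate representation. *)
Lemma deg_lt_step d (td : thin d) (M M' : rep K d) : rep_inj M -> rep_inj M' -> deg_lt M M' ->
  (homdim M M < homdim M' M')%N /\
  exists L : rep K d, [/\ deg_le M L, deg_le L M' & homdim L L = (homdim M M).+1].
Proof.
move=> injM injM' [D nMM']; have md := thin_monotone td.
have [s [t [st Ms]]] := pattern_of_rep injM; have [u [v [uv Mu]]] := pattern_of_rep injM'.
have D' : deg_le (pattern_rep K st) (pattern_rep K uv).
  apply: deg_le_trans (deg_le_iso (iso_sym Ms)) _.
  exact: deg_le_trans D (deg_le_iso Mu).
have le_su := corner_count_deg_le td D'.
have su : exists i, s i <> u i.
  apply: contrapT => same; apply: nMM'; apply: iso_trans Ms _; apply: iso_trans _ (iso_sym Mu).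
  by apply: pattern_rep_ext => i; apply: contrapT => si; apply: same; exists i.
rewrite (homdim_iso Ms Ms) (homdim_iso Mu Mu) !homdim_pattern_end //; split.
  by have [_ H] := corner_count_le_deg td st uv le_su; apply: H.
have [s1 [t1 [mv le1 c1]]] := move_below st uv le_su su; have st1 := move_pattern st mv.
exists (pattern_rep K st1); split.
- by apply: deg_le_trans (deg_le_iso Ms) _; apply: elementary_move_deg mv.
- apply: deg_le_trans (deg_le_iso (iso_sym Mu)).
  by have [] := corner_count_le_deg td st1 uv le1.
by rewrite homdim_pattern_end.
Qed.

(** Codimension one leaves no room for an intermediate representation, since
    [homdim L L] grows strictly along degenerations; conversely the
    intermediate representation of [deg_lt_step] must be isomorphic to [M']. *)
Lemma mdeg_lt_codim1 d (td : thin d) (M M' : rep K d) : rep_inj M -> rep_inj M' -> deg_lt M M' ->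
  (mdeg_lt M M' <-> homdim M' M' = (homdim M M).+1).
Proof.
move=> injM injM' ltMM'; split=> [[_ minM]|codim1].
  have [_ [L [ML LM' cL]]] := deg_lt_step td injM injM' ltMM'.
  have [LM|LM'i] := minM L ML LM'.
    by move: cL; rewrite (homdim_iso LM LM); lia.
  by rewrite -cL (homdim_iso LM'i LM'i).
split=> // L ML LM'; have injL := rep_inj_deg_le LM' injM'.
apply: contrapT => /not_orP[nLM nLM'].
have [|c1 _] := deg_lt_step td injM injL; first by split=> // /iso_sym.
have [|c2 _] := deg_lt_step td injL injM'; first by split.
by lia.
Qed.

Lemma rep_inj_dsumr d e (M : rep K d) (N : rep K e) : rep_inj (dsum M N) -> rep_inj N.
Proof.
move=> /rep_injP inj; apply/rep_injP => i; apply: inj_row_free => v vN.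
have : row_mx 0 v *m arrow (dsum M N) i = 0 *m arrow (dsum M N) i.
  by rewrite /= mul_row_block !mul0mx mulmx0 vN !addr0 row_mx0.
by move/(row_free_inj (inj i)); rewrite -row_mx0 => /eq_row_mx[].
Qed.

(** By semicontinuity the equalities for [W] are sums of inequalities, one for
    each direct summand. *)
Lemma homdim_summands d e (D : rep K d) (D' : rep K d) (W : rep K e) : deg_le D D' ->
  (homdim W D = homdim W D' /\ homdim D W = homdim D' W) <->
  (forall f (X : rep K f), indecomposable X -> direct_summand X W ->
     homdim X D = homdim X D' /\ homdim D X = homdim D' X).
Proof.
move=> DD'; split=> [[eWD eDW] f X _ [g [Y WXY]]|H].
  have := homdim_deg_le_cod X DD'; have := homdim_deg_le_cod Y DD'.
  have := homdim_deg_le_dom X DD'; have := homdim_deg_le_dom Y DD'.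
  move: eWD eDW; rewrite !(homdim_iso WXY (iso_refl _)) !(homdim_iso (iso_refl _) WXY).
  by rewrite !homdim_dsuml !homdim_dsumr; lia.
apply: (summand_ind (P := fun f X => homdim X D = homdim X D' /\ homdim D X = homdim D' X)).
- by move=> f X f0; rewrite !(homdim_zerol _ _ f0) !(homdim_zeror _ _ f0).
- by move=> f X iX XW; apply: H.
move=> a b f X Y Z XYZ [eY eY'] [eZ eZ'].
rewrite !(homdim_iso XYZ (iso_refl _)) !(homdim_iso (iso_refl _) XYZ).
by rewrite !homdim_dsuml !homdim_dsumr eY eZ eY' eZ'.
Qed.

(** Both degenerations are minimal exactly when they have codimension one, and
    their codimensions differ by a sum of two nonnegative differences. *)
Theorem mdeg_lt_dsumP d e (D D' : rep K d) (W : rep K e) :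
    thin d -> thin (dimvecD d e) -> rep_inj D -> rep_inj D' -> mdeg_lt D D' ->
    rep_inj (dsum D W) -> rep_inj (dsum D' W) -> deg_lt (dsum D W) (dsum D' W) ->
  mdeg_lt (dsum D W) (dsum D' W) <->
  (forall f (X : rep K f), indecomposable X -> direct_summand X W ->
     homdim X D = homdim X D' /\ homdim D X = homdim D' X).
Proof.
move=> td tde injD injD' minDD' injDW injD'W degDW; have [[DD' nDD'] _] := minDD'.
have codim1 := (mdeg_lt_codim1 td injD injD' (conj DD' nDD')).1 minDD'.
apply: iff_trans (mdeg_lt_codim1 tde injDW injD'W degDW) _.
apply: (iff_trans _ (homdim_summands W DD')).
rewrite !homdim_dsuml !homdim_dsumr codim1.
have le1 := homdim_deg_le_cod W DD'; have le2 := homdim_deg_le_dom W DD'.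
by split; lia.
Qed.

End Codimension.

Theorem theorem5p8 (R : realType) (n : nat) (d e : dimvec n)
    (D D' : rep R[i] d) (W : rep R[i] e)
    (injD : rep_inj D) (injD' : rep_inj D')
    (minDD' : mdeg_lt D D') (disjDD' : disjoint_reps D D')
    (dimB : forall i, dimvecD d e i = dimvecB i)
    (injDW : rep_inj (dsum D W)) (injD'W : rep_inj (dsum D' W))
    (degDW : deg_lt (dsum D W) (dsum D' W)) :
  mdeg_lt (dsum D W) (dsum D' W) <->
  (forall (f : dimvec n) (X : rep R[i] f),
     indecomposable X -> direct_summand X W ->
     (homdim X D)%:Z - (homdim X D')%:Z = 0 /\
     (homdim D X)%:Z - (homdim D' X)%:Z = 0).
Proof.
have char0 : [pchar R[i]] =i pred0 := Num.Theory.pchar_num _.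
have md := inj_monotone injD; have me := inj_monotone (rep_inj_dsumr injDW).
have dimB' i : (d i + e i = i.+1)%N := dimB i.
have tgtE (i : 'I_n) : nat_of_ord (tgt i) = (nat_of_ord (src i)).+1 by [].
have td : thin d.
  split; first by have := dimB' ord0; clear; rewrite /=; lia.
  move=> i; have := md i; have := me i; have := dimB' (src i); have := dimB' (tgt i).
  by rewrite tgtE; clear; lia.
have tde : thin (dimvecD d e).
  split; first by rewrite dimB.
  by move=> i; rewrite !dimB /dimvecB tgtE; clear; lia.
apply: iff_trans (mdeg_lt_dsumP char0 td tde injD injD' minDD' injDW injD'W degDW) _.
have diff0 (a b : nat) : a%:Z - b%:Z = 0 <-> a = b.
  by split=> [/eqP|->]; [rewrite subr_eq0 => /eqP[] | rewrite subrr].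
by split=> H f X iX XW; have [? ?] := H f X iX XW; split; apply/diff0.
Qed.
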